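(* There is a universal constant $C>0$ such that the following holds. Suppose $d\le n$, that $Q$ and $R$ are positive definite with $\underline\sigma(R)\ge1$, and that $(A_\star,B_\star)$ is $(\ell,\nu)$-controllable with $\nu>0$. Let $\rho$ and $\gamma$ be two real values such that $\rho(A_\star)\le\rho$ and $\rho(L_\star)\le\gamma<1$. Let $\varepsilon>0$ be such that $\|\widehat A-A_\star\|\le\varepsilon$ and $\|\widehat B-B_\star\|\le\varepsilon$, and define $\beta=\max\{1,\varepsilon\,\tau(A_\star,\rho)+\rho\}$. Then the certainty equivalent controller $\mathbf u_t=\widehat K\mathbf x_t$ satisfies $$\widehat J-J_\star\le C\,\sigma_w^2\,d\,\ell^5\,\Gamma_\star^{15}\,\tau(A_\star,\rho)^6\,\beta^{4(\ell-1)}\,\frac{\tau(L_\star,\gamma)^2}{1-\gamma^2}\,\frac{\max\{\|Q\|^2,\|R\|^2\}}{\min\{\underline\sigma(Q)^2,\underline\sigma(R)^2\}}\Big(1+\frac1\nu\Big)^2\varepsilon^2,$$ as long as the right-hand side is smaller than $\sigma_w^2$.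
   Context: $\|\cdot\|$ is the Euclidean norm for vectors and the spectral (operator) norm for matrices; $\rho(\cdot)$ applied to a matrix is the spectral radius; $\underline\sigma(\cdot)$ is the smallest singular value (for an $n\times m$ matrix with $n$ rows, the $n$-th singular value). For a square matrix $M$ and real $\rho$, $\tau(M,\rho):=\sup\{\|M^k\|\rho^{-k}: k\ge 0\}\in[1,\infty]$. LQR: $A_\star\in\mathbb R^{n\times n}$, $B_\star\in\mathbb R^{n\times d}$ are the true system matrices; $Q\in\mathbb R^{n\times n}$, $R\in\mathbb R^{d\times d}$ are known symmetric cost matrices. The dynamics are $\mathbf x_{t+1}=A_\star\mathbf x_t+B_\star\mathbf u_t+\mathbf w_t$, with $\mathbf x_0\sim\mathcal N(0,I_n)$ and i.i.d. noise $\mathbf w_t\sim\mathcal N(0,\sigma_w^2I_n)$, $\sigma_w>0$. For matrices $(A,B)$ and a gain $K$, $J(A,B,K)$ is the cost $\lim_{T\to\infty}\mathbb E\big[\frac1T\sum_{t=0}^T\mathbf x_t^\top Q\mathbf x_t+\mathbf u_t^\top R\mathbf u_t\big]$ obtained when $\mathbf x_{t+1}=A\mathbf x_t+B\mathbf u_t+\mathbf w_t$ and $\mathbf u_t=K\mathbf x_t$. $P=\mathsf{dare}(A,B,Q,R)$ is the unique positive semidefinite solution of $P=A^\top PA-A^\top PB(R+B^\top PB)^{-1}B^\top PA+Q$. Put $P_\star=\mathsf{dare}(A_\star,B_\star,Q,R)$, $K_\star=-(R+B_\star^\top P_\star B_\star)^{-1}B_\star^\top P_\star A_\star$ (the optimal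 gain), and $L_\star=A_\star+B_\star K_\star$. Given estimates $(\widehat A,\widehat B)$ of the same dimensions, $\widehat P=\mathsf{dare}(\widehat A,\widehat B,Q,R)$ and $\widehat K=-(R+\widehat B^\top\widehat P\widehat B)^{-1}\widehat B^\top\widehat P\widehat A$. Finally $\widehat J:=J(A_\star,B_\star,\widehat K)$, $J_\star:=J(A_\star,B_\star,K_\star)$, and $\Gamma_\star:=1+\max\{\|A_\star\|,\|B_\star\|,\|P_\star\|,\|K_\star\|\}$. For an integer $\ell\ge1$, the system $(A,B)$ is $(\ell,\nu)$-controllable if the matrix $\mathcal C_\ell:=\begin{bmatrix}B&AB&\cdots&A^{\ell-1}B\end{bmatrix}$ has $n$-th singular value $\underline\sigma(\mathcal C_\ell)=\sqrt{\lambda_{\min}(\mathcal C_\ell\mathcal C_\ell^\top)}\ge\nu$. ''Universal constant'' means independent of all dimensions and problem data. *)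

(* Defs.v *)
From HB Require Import structures.
From mathcomp Require Import all_boot all_order all_algebra.
From mathcomp Require Import complex.
From mathcomp Require Import all_classical all_reals all_analysis.

Set Implicit Arguments.
Unset Strict Implicit.
Unset Printing Implicit Defensive.

Import Order.TTheory GRing.Theory Num.Theory.
Import numFieldNormedType.Exports.

Local Open Scope classical_set_scope.
Local Open Scope ring_scope.

Section MatrixNotions.
Context {R : realType}.

Definition l2norm {n} (x : 'cV[R]_n) : R := Num.sqrt (\sum_(i < n) x i 0 ^+ 2).

(* Not the library norm `|M| on matrices, which is the entrywise maximum. *)
Definition opnorm {m n} (M : 'M[R]_(m, n)) : R :=
  sup [set l2norm (M *m x) | x in [set x : 'cV[R]_n | l2norm x <= 1]].

Definition spectral_radius {n} (M : 'M[R]_n) : R :=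
  sup [set Normc.normc z | z in
    [set z : R[i] | eigenvalue (map_mx (real_complex R) M) z]].

(* Used only on symmetric matrices, all of whose eigenvalues are real. *)
Definition lambda_min {n} (S : 'M[R]_n) : R :=
  inf [set a : R | eigenvalue S a].

(* The n-th singular value of a matrix with n rows. For n = 0 it is 0, since
   inf set0 = 0. *)
Definition sigma_min {n m} (M : 'M[R]_(n, m)) : R :=
  Num.sqrt (lambda_min (M *m M^T)).

(* With ereal conventions 0^-1 = +oo and 0 * +oo = 0, so that for rho = 0 the
   k-th term (k >= 1) is 0 if M ^+ k = 0 and +oo otherwise. *)
Definition tau {n} (M : 'M[R]_n) (rho : R) : \bar R :=
  ereal_sup [set ((opnorm (M ^+ k))%:E * ((rho ^+ k)%:E)^-1)%E | k in [set: nat]].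

Definition quad {n} (M : 'M[R]_n) (x : 'cV[R]_n) : R := (x^T *m M *m x) 0 0.

Definition posdef {n} (M : 'M[R]_n) : Prop :=
  M^T = M /\ forall x : 'cV[R]_n, x != 0 -> 0 < quad M x.

Definition possemidef {n} (M : 'M[R]_n) : Prop :=
  M^T = M /\ forall x : 'cV[R]_n, 0 <= quad M x.

Definition controllability_mx {n d} (l : nat) (A : 'M[R]_n) (B : 'M[R]_(n, d)) :=
  \mxrow_(j < l) (A ^+ j *m B).

Definition controllable {n d} (l : nat) (nu : R)
    (A : 'M[R]_n) (B : 'M[R]_(n, d)) : Prop :=
  nu <= sigma_min (controllability_mx l A B).

Definition dare_solution {n d} (A : 'M[R]_n) (B : 'M[R]_(n, d))
    (Q : 'M[R]_n) (Rc : 'M[R]_d) (P : 'M[R]_n) : Prop :=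
  possemidef P /\
  P = A^T *m P *m A
      - A^T *m P *m B *m invmx (Rc + B^T *m P *m B) *m B^T *m P *m A + Q.

Definition is_dare {n d} (A : 'M[R]_n) (B : 'M[R]_(n, d))
    (Q : 'M[R]_n) (Rc : 'M[R]_d) (P : 'M[R]_n) : Prop :=
  dare_solution A B Q Rc P /\
  forall P', dare_solution A B Q Rc P' -> P' = P.

(* The unique positive semidefinite solution; the default value 0 is returned
   when there is no such unique solution. *)
Definition dare {n d} (A : 'M[R]_n) (B : 'M[R]_(n, d))
    (Q : 'M[R]_n) (Rc : 'M[R]_d) : 'M[R]_n :=
  xget 0 [set P | is_dare A B Q Rc P].

Definition lqr_gain {n d} (A : 'M[R]_n) (B : 'M[R]_(n, d))
    (Q : 'M[R]_n) (Rc : 'M[R]_d) : 'M[R]_(d, n) :=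
  let P := dare A B Q Rc in
  - (invmx (Rc + B^T *m P *m B) *m B^T *m P *m A).

End MatrixNotions.

Section LQR.
Context {d0 : measure_display} {T : measurableType d0} {R : realType}.
Variable P : probability T R.

Definition mutually_independent {I : eqType} (X : I -> {RV P >-> R}) : Prop :=
  forall (J : seq I) (E : I -> set R), uniq J -> (forall i, measurable (E i)) ->
    P (\bigcap_(i in [set` J]) (X i @^-1` E i)) =
    (\prod_(i <- J) P (X i @^-1` E i))%E.

(* s is the standard deviation. The laws are compared on measurable sets only. *)
Definition centered_normal (s : R) (X : {RV P >-> R}) : Prop :=
  forall E : set R, measurable E -> P (X @^-1` E) = normal_prob 0 s E.

(* x0 ~ N(0, I_n) and i.i.d. w_t ~ N(0, sw^2 I_n), independent of x0. As the
   coordinates of an N(0, s^2 I_n) vector are independent N(0, s^2) variables,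
   this amounts to mutual independence of all the scalar coordinates of
   x0, w_0, w_1, etc; in the index (t, i), t = 0 stands for x0 and t.+1 for w_t. *)
Definition lqr_noise {n} (sw : R) (x0 : 'I_n -> {RV P >-> R})
    (w : nat -> 'I_n -> {RV P >-> R}) : Prop :=
  [/\ forall i, centered_normal 1 (x0 i),
      forall t i, centered_normal sw (w t i) &
      mutually_independent
        (fun ti : nat * 'I_n => if ti.1 is t.+1 then w t ti.2 else x0 ti.2)].

Fixpoint lqr_state {n d} (x0 : 'I_n -> {RV P >-> R})
    (w : nat -> 'I_n -> {RV P >-> R}) (A : 'M[R]_n) (B : 'M[R]_(n, d))
    (K : 'M[R]_(d, n)) (t : nat) (omega : T) : 'cV[R]_n :=
  if t is s.+1 then
    let x := lqr_state x0 w A B K s omega in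
    A *m x + B *m (K *m x) + \col_i w s i omega
  else \col_i x0 i omega.

Definition lqr_avg_cost {n d} (Q : 'M[R]_n) (Rc : 'M[R]_d)
    (x0 : 'I_n -> {RV P >-> R}) (w : nat -> 'I_n -> {RV P >-> R})
    (A : 'M[R]_n) (B : 'M[R]_(n, d)) (K : 'M[R]_(d, n)) (N : nat) : \bar R :=
  'E_P [fun omega => N%:R^-1 * \sum_(0 <= t < N.+1)
          (let x := lqr_state x0 w A B K t omega in
           quad Q x + quad Rc (K *m x))].

(* J(A, B, K) exists, is finite, and equals J. *)
Definition is_lqr_cost {n d} (Q : 'M[R]_n) (Rc : 'M[R]_d)
    (x0 : 'I_n -> {RV P >-> R}) (w : nat -> 'I_n -> {RV P >-> R})
    (A : 'M[R]_n) (B : 'M[R]_(n, d)) (K : 'M[R]_(d, n)) (J : R) : Prop :=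
  lqr_avg_cost Q Rc x0 w A B K N @[N --> \oo] --> J%:E.

End LQR.

(* Main.v *)
(* Controllability bounds the value P of the optimal controller by a multiple of the
   cost it pays over l + 1 steps, hence P decays by a fixed factor per block of steps
   of the optimal closed loop L, and U = (1 + t) sum_{j <= l} (L^j)^T P L^j satisfies
   P + L^T U L <= U <= T P. Running the gain K of the true system on the perturbed one,
   (1 + eta/2) P + (eta/2T) U still dissipates the running cost for eta of order eps,
   so Phat <= (1 + eta) P; as the estimated system is (l, nu/2)-controllable, the roles
   can be exchanged, and |Phat - P| <= eta P. This makes (Khat - K)^T M (Khat - K) at
   most 36 eta^2 P with M = R + B^T P B, which keeps the true system stable under Khat.
   Completing the square, the excess cost is
   sw^2 sum_k tr((Khat - K)^T M (Khat - K) Lhat^k (Lhat^k)^T) with Lhat = A + B Khat,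
   which is quadratic in eps. *)
Require Import Defs.
From HB Require Import structures.
From mathcomp Require Import all_boot all_order all_algebra.
From mathcomp Require Import complex.
From mathcomp Require Import all_classical all_reals all_analysis.
From mathcomp Require Import measurable_realfun ring lra.

Set Implicit Arguments.
Unset Strict Implicit.
Unset Printing Implicit Defensive.

Import Order.TTheory GRing.Theory Num.Theory.
Import numFieldNormedType.Exports.

Local Open Scope classical_set_scope.
Local Open Scope ring_scope.

(** * Gaussian moments *)

(** The bound contains [W = tau(L, gamma)^2 / (1 - gamma^2)] only to the first power, and this
    shapes the proof. The decay constant t of P comes from controllability and the costs, so neither
    t nor eta involves W. When the gain is changed, a Lyapunov function built from the powers of L
    has to absorb the gain error. Bounding that function by W on the error would cost a second
    factor W; instead the error is small in the P-seminorm, and the decay of P sums it up at a rate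
    free of W.

    Comparing quadratic forms rather than norms keeps n out of the estimate: the weight (Khat - K)^T
    M (Khat - K) splits into d linear functionals, each small in the P-seminorm, which is the origin
    of the factor d. The trace bound [2 * W * n%:R] serves only to show that the average cost
    converges.

    The assumption that the bound is below sw^2 has two uses. It makes both values of [tau] finite,
    and it makes eps so small that controllability survives, eta is at most 1/2 and the change of
    gain is harmless. *)

Section GaussianMoments.
Context {R : realType}.
Local Notation mu := (@lebesgue_measure R).

(** The Radon-Nikodym derivative and the density have the same integral over every measurable set,
    so they agree almost everywhere. *)
Lemma ge0_integral_normal_prob (s : R) (f : R -> R) :
  measurable_fun setT f -> (forall x, 0 <= f x) ->
  (\int[normal_prob 0 s]_x (f x)%:E
   = \int[mu]_x (f x * normal_pdf 0 s x)%:E)%E.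
Proof.
move=> mf f0.
have dom := normal_prob_dominates (0 : R) s.
rewrite -(Radon_Nikodym_SigmaFinite.change_of_variables dom)//=; [|exact/measurable_EFinP].
under [RHS]eq_integral do rewrite EFinM.
apply: ae_eq_integral => //.
- apply: emeasurable_funM; first exact/measurable_EFinP.
  exact: measurable_int (Radon_Nikodym_SigmaFinite.f_integrable dom).
- apply: emeasurable_funM; first exact/measurable_EFinP.
  apply/measurable_EFinP; exact: measurable_normal_pdf.
- apply: ae_eqe_mul2l; apply: integral_ae_eq => //.
  + exact: Radon_Nikodym_SigmaFinite.f_integrable.
  + apply/measurable_EFinP; exact: measurable_normal_pdf.
  + by move=> E _ mE; rewrite -(Radon_Nikodym_SigmaFinite.f_integral dom).
Qed.

Lemma normal_pdf0_even (s x : R) : s != 0 ->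
  normal_pdf 0 s (- x) = normal_pdf 0 s x.
Proof.
by move=> s0; rewrite !normal_pdfE// /normal_fun !subr0 sqrrN.
Qed.

Lemma is_derive_normal_pdf0 (s x : R) : s != 0 ->
  is_derive x 1 (normal_pdf 0 s) (- (x / s ^+ 2) * normal_pdf 0 s x).
Proof.
move=> s0.
have -> : normal_pdf 0 s = fun x => normal_peak s * expR (- (s ^+ 2 *+ 2)^-1 * x ^+ 2).
  apply/funext => y; rewrite normal_pdfE// /normal_fun subr0; congr (_ * expR _).
  by rewrite !mulNr mulrC.
have D : is_derive x (1:R) (fun y : R => - (s ^+ 2 *+ 2)^-1 * y ^+ 2) (- (x / s ^+ 2)).
  rewrite (_ : (fun y => _) = (- (s ^+ 2 *+ 2)^-1) *: (id ^+ 2)); last by apply/funext => y; rewrite !fctE.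
  apply: is_derive_eq; rewrite /GRing.scale/= expr1 mulr1 -mulr_natr; field.
  exact: s0.
rewrite (_ : (fun x => _) = normal_peak s *: (expR \o (fun y : R => - (s ^+ 2 *+ 2)^-1 * y ^+ 2))); last by apply/funext => y; rewrite !fctE.
by apply: is_derive_eq; rewrite /GRing.scale/= mulrA mulrC.
Qed.

(** The integration by parts behind the second moment: up to a boundary term, x^2 may be replaced by
    s^2 under the density. *)
Lemma is_derive_mul_normal_pdf0 (s x : R) : s != 0 ->
  is_derive x 1 (fun y => - s ^+ 2 * (y * normal_pdf 0 s y))
    (x ^+ 2 * normal_pdf 0 s x - s ^+ 2 * normal_pdf 0 s x).
Proof.
move=> s0; have D := is_derive_normal_pdf0 x s0.
rewrite (_ : (fun y => _) = (- s ^+ 2) *: (id * normal_pdf 0 s)); last by apply/funext => y; rewrite !fctE.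
apply: is_derive_eq; rewrite /GRing.scale/= mulr1; field.
exact: s0.
Qed.

Lemma cvg_mul_normal_pdf0 (s : R) : s != 0 ->
  n%:R * normal_pdf 0 s n%:R @[n --> \oo] --> (0 : R).
Proof.
move=> s0.
have s20 : 0 < s ^+ 2 by rewrite exprn_even_gt0.
apply: (@squeeze_cvgr _ _ _ _ (cst 0) (fun n => normal_peak s * (s ^+ 2 * 2) * n%:R^-1)).
- near=> n; apply/andP; split => /=.
    by rewrite mulr_ge0 ?ler0n// normal_pdf_ge0.
  have n0 : 0 < n%:R :> R by rewrite ltr0n; near: n; exact: nbhs_infty_gt.
  rewrite normal_pdfE// /normal_fun subr0 mulrCA -mulrA ler_wpM2l ?normal_peak_ge0//.
  rewrite mulNr expRN ler_pdivrMr ?expR_gt0//.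
  (* From u <= exp u with u = n^2 / (2 s^2), the quantity to be bounded is O(1/n). *)
  have e1 : n%:R ^+ 2 / (s ^+ 2 *+ 2) <= expR (n%:R ^+ 2 / (s ^+ 2 *+ 2)).
    by apply: le_trans (expR_ge1Dx _); rewrite lerDr.
  apply: (@le_trans _ _ (s ^+ 2 * 2 / n%:R * (n%:R ^+ 2 / (s ^+ 2 *+ 2)))).
    rewrite le_eqVlt; apply/orP; left; apply/eqP; rewrite -mulr_natr; field.
    by rewrite s0 gt_eqF.
  by rewrite ler_wpM2l// divr_ge0 ?ler0n// mulr_ge0 ?ler0n// ltW.
- exact: cvg_cst.
- rewrite -(mulr0 (normal_peak s * (s ^+ 2 * 2))).
  apply: cvgM; first exact: cvg_cst.
  apply/gtr0_cvgV0; first by near=> n; rewrite ltr0n; near: n; exact: nbhs_infty_gt.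
  exact: cvgr_idn.
Unshelve. all: by end_near. Qed.

Lemma integral0n_sqr_normal_pdf0 (s : R) n : s != 0 -> (0 < n)%N ->
  (\int[mu]_(x in `[0%R, n%:R]) (x ^+ 2 * normal_pdf 0 s x)%:E =
   (s ^+ 2)%:E * \int[mu]_(x in `[0%R, n%:R]) (normal_pdf 0 s x)%:E
   - (s ^+ 2 * (n%:R * normal_pdf 0 s n%:R))%:E)%E.
Proof.
move=> s0 n0.
have cp : continuous (normal_pdf (0:R) s) by exact: continuous_normal_pdf.
have cp2 : continuous (fun x : R => x ^+ 2 * normal_pdf 0 s x : R).
  by move=> x; apply: cvgM; [exact: sqr_continuous|exact: cp].
have isP (f : R -> R) : continuous f -> mu.-integrable `[0%R, n%:R] (EFin \o f).
  move=> cf; apply: continuous_compact_integrable; first exact: segment_compact.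
  exact: continuous_subspaceT.
have iP := isP _ cp; have iP2 := isP _ cp2.
have D x := is_derive_mul_normal_pdf0 x s0.
have FTC : (\int[mu]_(x in `[0%R, n%:R]) (x ^+ 2 * normal_pdf 0 s x - s ^+ 2 * normal_pdf 0 s x)%:E
   = (- s ^+ 2 * (n%:R * normal_pdf 0 s n%:R))%:E - (- s ^+ 2 * (0 * normal_pdf 0 s 0))%:E)%E.
  apply: (continuous_FTC2 (F := fun y => - s ^+ 2 * (y * normal_pdf 0 s y))).
  - by rewrite ltr0n.
  - apply: continuous_subspaceT => x; apply: cvgB; first exact: cp2.
    by apply: cvgM; [exact: cvg_cst|exact: cp].
  - have dF (x : R) : derivable (fun y : R => - s ^+ 2 * (y * normal_pdf 0 s y)) x 1 by case: (D x).
    have cF : continuous (fun y : R => - s ^+ 2 * (y * normal_pdf 0 s y) : R).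
      by move=> x; apply: differentiable_continuous; exact/derivable1_diffP/dF.
    split.
    + by move=> x _.
    + by apply: cvg_at_right_filter; exact: cF.
    + by apply: cvg_at_left_filter; exact: cF.
  - by move=> x _; rewrite derive1E; case: (D x).
move: FTC; rewrite mul0r mulr0 sube0 => FTC.
have : (\int[mu]_(x in `[0%R, n%:R]) (x ^+ 2 * normal_pdf 0 s x)%:E
  - (s ^+ 2)%:E * \int[mu]_(x in `[0%R, n%:R]) (normal_pdf 0 s x)%:E
  = (- s ^+ 2 * (n%:R * normal_pdf 0 s n%:R))%:E)%E.
  rewrite -FTC -integralZl//; under [RHS]eq_integral do rewrite EFinB.
  by rewrite integralB//=; exact: (integrableZl _ _ iP).
have f1 : (\int[mu]_(x in `[0%R, n%:R]) (normal_pdf 0 s x)%:E)%E \is a fin_num.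
  by apply: integrable_fin_num iP.
have f2 : (\int[mu]_(x in `[0%R, n%:R]) (x ^+ 2 * normal_pdf 0 s x)%:E)%E \is a fin_num.
  by apply: integrable_fin_num iP2.
move: f1 f2 => /=; set I1 := integral _ _ _; set I2 := integral _ _ _.
move: I1 I2 => [a| |] [b| |] // _ _ [] h; congr EFin.
by rewrite -mulNr -h addrC subrK.
Qed.

Lemma integral_sqr_normal_prob (s : R) : s != 0 ->
  (\int[normal_prob 0 s]_x (x ^+ 2)%:E = (s ^+ 2)%:E)%E.
Proof.
move=> s0.
have cp : continuous (normal_pdf (0:R) s) by exact: continuous_normal_pdf.
have cp2 : continuous (fun x : R => x ^+ 2 * normal_pdf 0 s x : R).
  by move=> x; apply: cvgM; [exact: sqr_continuous|exact: cp].
have p0 x : 0 <= normal_pdf 0 s x by exact: normal_pdf_ge0.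
have p20 x : 0 <= x ^+ 2 * normal_pdf 0 s x by rewrite mulr_ge0 ?sqr_ge0.
have ge0E : [set x : R | 0 <= x] = `[0, +oo[%classic.
  by apply/seteqP; split => x /=; rewrite in_itv/= andbT.
have half : (2%:E * \int[mu]_(x in `[0%R, +oo[) (normal_pdf 0 s x)%:E = 1)%E.
  rewrite -ge0E -ge0_symfun_integralT ?integral_normal_pdf//.
  by move=> x /=; rewrite normal_pdf0_even.
have fin : (\int[mu]_(x in `[0%R, +oo[) (normal_pdf 0 s x)%:E)%E \is a fin_num.
  move: half; case: (integral _ _ _) => [r| |] //=.
  - by rewrite mulry gtr0_sg// mul1e.
  - by rewrite mulrNy gtr0_sg// mul1e.
rewrite ge0_integral_normal_prob//.
rewrite ge0_symfun_integralT//; last first.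
  by move=> x /=; rewrite sqrrN normal_pdf0_even.
rewrite ge0E.
have mp := continuous_measurable_fun cp.
have mp2 := continuous_measurable_fun cp2.
have lim1 := @ge0_cvgn_integral R mu _ p0 mp.
have lim2 := @ge0_cvgn_integral R mu _ p20 mp2.
have -> : (\int[mu]_(x in `[0%R, +oo[) (x ^+ 2 * normal_pdf 0 s x)%:E
  = (s ^+ 2)%:E * \int[mu]_(x in `[0%R, +oo[) (normal_pdf 0 s x)%:E)%E.
  apply: cvg_unique lim2 _ => //.
  have lim3 : ((s ^+ 2)%:E * (\int[mu]_(x in `[0%R, n%:R]) (normal_pdf 0 s x)%:E)
     - (s ^+ 2 * (n%:R * normal_pdf 0 s n%:R))%:E)%E @[n --> \oo] -->
     ((s ^+ 2)%:E * \int[mu]_(x in `[0%R, +oo[) (normal_pdf 0 s x)%:E - (s ^+ 2 * 0)%:E)%E.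
    apply: cvgeB; first by rewrite fin_num_adde_defl.
    - by apply: cvgeZl.
    - apply: cvg_EFin; first exact: nearW.
      by apply: cvgM; [exact: cvg_cst|exact: cvg_mul_normal_pdf0].
  move: lim3; rewrite mulr0 sube0; apply: cvg_trans; apply: near_eq_cvg.
  near=> n; rewrite integral0n_sqr_normal_pdf0//.
  by near: n; exact: nbhs_infty_gt.
- by rewrite muleCA half mule1.
- by move=> x; rewrite sqr_ge0.
Unshelve. all: by end_near. Qed.

Lemma ge0_integralT_split (h : R -> R) : (forall x, 0 <= h x) -> continuous h ->
  (\int[mu]_x (h x)%:E = \int[mu]_(x in `[0%R, +oo[) (h x)%:E
     + \int[mu]_(x in `[0%R, +oo[) (h (- x))%:E)%E.
Proof.
move=> h0 ch.
have mh : measurable_fun [set: R] h by exact: continuous_measurable_fun.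
have mD : measurable (`[0%R, +oo[%classic : set R) by [].
rewrite -(setUv `[0%R, +oo[%classic) ge0_integral_setU//= ; last 4 first.
- exact: measurableC.
- by apply/measurable_EFinP; rewrite setUv.
- by move=> x _; rewrite lee_fin.
- exact/disj_setPCl.
congr +%E; rewrite setCitvr.
rewrite integral_itv_bndo_bndc; last exact/measurable_EFinP/measurable_funTS.
rewrite -{1}oppr0 ge0_integration_by_substitutionNy//.
exact: continuous_subspaceT.
Qed.

(** Applied to the function max(x, 0), this makes the positive and negative parts of a centered
    normal variable equal in mean. *)
Lemma ge0_integral_normal_prob_oppr (s : R) (f : R -> R) : s != 0 ->
  continuous f -> (forall x, 0 <= f x) ->
  (\int[normal_prob 0 s]_x (f (- x))%:E = \int[normal_prob 0 s]_x (f x)%:E)%E.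
Proof.
move=> s0 cf f0.
have cp : continuous (normal_pdf (0:R) s) by exact: continuous_normal_pdf.
have cfN : continuous (fun x : R => f (- x) : R).
  by move=> x; apply: continuous_comp; [exact: opp_continuous|exact: cf].
have mf := continuous_measurable_fun cf.
have mfN := continuous_measurable_fun cfN.
rewrite !ge0_integral_normal_prob// !ge0_integralT_split//; first last.
- by move=> x; apply: cvgM; [exact: cfN|exact: cp].
- by move=> x; rewrite mulr_ge0 ?normal_pdf_ge0.
- by move=> x; apply: cvgM; [exact: cf|exact: cp].
- by move=> x; rewrite mulr_ge0 ?normal_pdf_ge0.
rewrite addeC; congr (_ + _)%E; apply: eq_integral => x _;
  by rewrite ?opprK normal_pdf0_even.
Qed.

End GaussianMoments.

Section GaussianRV.
Context {d0 : measure_display} {T : measurableType d0} {R : realType}.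
Variable P : probability T R.

Lemma ge0_integral_centered_normal (s : R) (X : {RV P >-> R}) (f : R -> R) :
  centered_normal s X -> measurable_fun setT f -> (forall x, 0 <= f x) ->
  (\int[P]_w (f (X w))%:E = \int[normal_prob 0 s]_x (f x)%:E)%E.
Proof.
move=> nX mf f0.
have mX : measurable_fun setT (X : T -> measurableTypeR R).
  by move=> _ A mA; exact: (@measurable_funP _ _ _ _ setT X).
pose X' : {mfun T >-> measurableTypeR R} := HB.pack (X : T -> measurableTypeR R)
  (isMeasurableFun.Build _ _ _ _ _ mX).
rewrite -[LHS](@ge0_integral_distribution _ _ _ _ _ P X' (EFin \o f))//; last first.
  by apply/measurable_EFinP.
by apply: eq_measure_integral => A mA _; exact: nX.
Qed.

Lemma integral_sqr_centered_normal (s : R) (X : {RV P >-> R}) : s != 0 ->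
  centered_normal s X -> (\int[P]_w (X w ^+ 2)%:E = (s ^+ 2)%:E)%E.
Proof.
move=> s0 nX; rewrite (ge0_integral_centered_normal (f := fun x => x ^+ 2) nX)//.
- exact: integral_sqr_normal_prob.
- by move=> x; rewrite sqr_ge0.
Qed.

Lemma integrable_sqr_centered_normal (s : R) (X : {RV P >-> R}) : s != 0 ->
  centered_normal s X -> P.-integrable setT (fun w => (X w ^+ 2)%:E).
Proof.
move=> s0 nX; apply/integrableP; split.
  by apply/measurable_EFinP; exact: measurable_funX.
under eq_integral do rewrite gee0_abs ?lee_fin ?sqr_ge0//.
by rewrite (integral_sqr_centered_normal s0 nX) ltry.
Qed.

Lemma integrable_mul_centered_normal (s s' : R) (X Y : {RV P >-> R}) :
  s != 0 -> s' != 0 -> centered_normal s X -> centered_normal s' Y ->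
  P.-integrable setT (fun w => (X w * Y w)%:E).
Proof.
move=> s0 s'0 nX nY.
apply: (@le_integrable _ _ _ P setT _ _ (fun w => (X w ^+ 2)%:E + (Y w ^+ 2)%:E)%E) => //.
- by apply/measurable_EFinP; exact: measurable_funM.
- move=> w _; rewrite -EFinD /= lee_fin [leRHS]ger0_norm ?addr_ge0 ?sqr_ge0//.
  rewrite normrM -(real_normK (num_real (X w))) -(real_normK (num_real (Y w))).
  have := sqr_ge0 (`|X w| - `|Y w|); have := normr_ge0 (X w); have := normr_ge0 (Y w); nra.
- by apply: integrableD => //; [exact: integrable_sqr_centered_normal s0 nX|exact: integrable_sqr_centered_normal s'0 nY].
Qed.

Lemma integrable_centered_normal (s : R) (X : {RV P >-> R}) : s != 0 ->
  centered_normal s X -> P.-integrable setT (fun w => (X w)%:E).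
Proof.
move=> s0 nX.
apply: (@le_integrable _ _ _ P setT _ _ (fun w => 1 + (X w ^+ 2)%:E)%E) => //.
- by apply/measurable_EFinP; exact: measurable_funPT.
- move=> w _; rewrite -EFinD /= lee_fin [leRHS]ger0_norm ?addr_ge0 ?sqr_ge0//.
  rewrite -(real_normK (num_real (X w))).
  have := sqr_ge0 (`|X w| - 1); have := normr_ge0 (X w); nra.
- apply: integrableD => //; last exact: integrable_sqr_centered_normal s0 nX.
  exact: (finite_measure_integrable_cst P 1).
Qed.

Lemma integral_centered_normal (s : R) (X : {RV P >-> R}) : s != 0 ->
  centered_normal s X -> (\int[P]_w (X w)%:E = 0)%E.
Proof.
move=> s0 nX.
have iX := integrable_centered_normal s0 nX.
rewrite integralE.
have cmax : continuous (fun x : R => Num.max x 0 : R).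
  by move=> x; apply: continuous_max => //; exact: cvg_cst.
have max0 (x : R) : 0 <= Num.max x 0 by rewrite le_max lexx orbT.
have pE : (\int[P]_w (fun w => (X w)%:E)^\+ w = \int[normal_prob 0 s]_x (Num.max x 0)%:E)%E.
  rewrite -(ge0_integral_centered_normal (f := fun x => Num.max x 0) nX)//; last exact: continuous_measurable_fun.
  by apply: eq_integral => w _; rewrite funeposE -EFin_max.
have nE : (\int[P]_w (fun w => (X w)%:E)^\- w = \int[normal_prob 0 s]_x (Num.max (- x) 0)%:E)%E.
  rewrite -(ge0_integral_centered_normal (f := fun x => Num.max (- x) 0) nX)//.
    by apply: eq_integral => w _; rewrite funenegE -EFin_max.
  apply: continuous_measurable_fun => x.
  by apply: (@continuous_comp _ _ _ -%R (fun x : R => Num.max x 0)); [exact: opp_continuous|exact: cmax].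
rewrite pE nE (ge0_integral_normal_prob_oppr s0 cmax max0) subee// -pE.
exact: integrable_pos_fin_num.
Qed.

Definition pairwise_indep (X Y : {RV P >-> R}) : Prop :=
  forall E F : set R, measurable E -> measurable F ->
    P (X @^-1` E `&` Y @^-1` F) = (P (X @^-1` E) * P (Y @^-1` F))%E.

(** By uniqueness of the product measure the law of the pair is the product of the laws; in the
    iterated integral the inner integral over the second variable then vanishes. *)
Lemma integral_mul_indep0 (X Y : {RV P >-> R}) :
  pairwise_indep X Y -> P.-integrable setT (fun w => (X w * Y w)%:E) ->
  P.-integrable setT (fun w => (Y w)%:E) ->
  (\int[P]_w (Y w)%:E = 0)%E -> (\int[P]_w (X w * Y w)%:E = 0)%E.
Proof.
move=> ind iXY iY Y0.
have mXY : measurable_fun setT (fun w => (X w, Y w)) by apply: measurable_fun_pair.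
pose Z : {mfun T >-> (R * R)%type} := HB.pack (fun w => (X w, Y w)) (isMeasurableFun.Build _ _ _ _ _ mXY).
pose f (z : R * R) : \bar R := (z.1 * z.2)%:E.
have mf : measurable_fun setT f.
  by apply/measurable_EFinP; apply: measurable_funM; [exact: measurable_fst|exact: measurable_snd].
have E : forall A, measurable A -> (distribution P X \x distribution P Y)%E A = distribution P Z A.
  by apply: product_measure_unique => A B mA mB; exact: ind.
have -> : (\int[P]_w (X w * Y w)%:E = \int[distribution P Z]_z f z)%E.
  by rewrite (integral_distribution (X := Z)).
rewrite -(@eq_measure_integral _ _ _ _ _ (distribution P X \x distribution P Y)%E); last first.
  by move=> A mA _; exact: E.
have EI (g : R * R -> \bar R) : (\int[distribution P X \x distribution P Y]_z g z = \int[distribution P Z]_z g z)%E.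
  by apply: eq_measure_integral => A mA _; exact: E.
have iXYp : (distribution P X \x distribution P Y)%E.-integrable setT f.
  apply/integrableP; split => //.
  rewrite EI ge0_integral_distribution//; last exact: measurableT_comp.
  by case/integrableP: iXY.
rewrite -integral12_prod_meas1//.
have iYd : (distribution P Y).-integrable setT (fun y => y%:E).
  apply/integrableP; split; first by apply/measurable_EFinP.
  rewrite ge0_integral_distribution//; last by apply: measurableT_comp => //; apply/measurable_EFinP.
  by case/integrableP: iY.
rewrite integral0_eq// => x _; rewrite /fubini_F /f /=.
under eq_integral do rewrite EFinM.
rewrite integralZl//.
have -> : (\int[distribution P Y]_y y%:E = \int[P]_w (Y w)%:E)%E.
  by rewrite (integral_distribution (X := Y)) //; apply/measurable_EFinP.
by rewrite Y0 mule0.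
Qed.

End GaussianRV.

(** * Second moments of the state *)

Section Moments.
Context {d0 : measure_display} {T : measurableType d0} {R : realType}.
Variable P : probability T R.

(** Integrability is bundled with the value, so that means of finite sums combine without side
    conditions. *)
Definition has_mean (f : T -> R) (c : R) : Prop :=
  P.-integrable setT (EFin \o f) /\ (\int[P]_w (f w)%:E = c%:E)%E.

Lemma has_mean_eq (f g : T -> R) c : f =1 g -> has_mean f c -> has_mean g c.
Proof. by move=> /funext ->. Qed.

Lemma has_mean_congr (f g : T -> R) c c' : f =1 g -> c = c' ->
  has_mean f c -> has_mean g c'.
Proof. by move=> /funext -> ->. Qed.

Lemma has_meanD (f g : T -> R) a b : has_mean f a -> has_mean g b ->
  has_mean (fun w => f w + g w) (a + b).
Proof.
move=> [fi fE] [gi gE]; split; first exact: (integrableD measurableT fi gi).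
by under eq_integral do rewrite EFinD; rewrite integralD// fE gE.
Qed.

Lemma has_meanZ (f : T -> R) k a : has_mean f a ->
  has_mean (fun w => k * f w) (k * a).
Proof.
move=> [fi fE]; split; first exact: (integrableZl measurableT k fi).
by under eq_integral do rewrite EFinM; rewrite integralZl// fE.
Qed.

Lemma has_mean0 : has_mean (fun=> 0) 0.
Proof. by split; [exact: integrable0|rewrite integral0]. Qed.

Lemma has_mean_sum (I : Type) (r : seq I) (F : I -> T -> R) (c : I -> R) :
  (forall i, has_mean (F i) (c i)) ->
  has_mean (fun w => \sum_(i <- r) F i w) (\sum_(i <- r) c i).
Proof.
move=> H; elim: r => [|i r IH].
  rewrite big_nil; apply: has_mean_eq has_mean0 => w; by rewrite big_nil.
rewrite big_cons; apply: has_mean_eq (has_meanD (H i) IH) => w.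
by rewrite big_cons.
Qed.

End Moments.

Fixpoint state_cov {R : realType} {n} (sw : R) (L : 'M[R]_n) (t : nat) : 'M[R]_n :=
  if t is s.+1 then L *m state_cov sw L s *m L^T + (sw ^+ 2)%:M else 1%:M.

Section NoiseMoments.
Context {d0 : measure_display} {T : measurableType d0} {R : realType}.
Variable P : probability T R.
Variables (n d : nat) (sw : R) (x0 : 'I_n -> {RV P >-> R})
  (w : nat -> 'I_n -> {RV P >-> R}).
Hypothesis sw0 : 0 < sw.
Hypothesis noise : lqr_noise sw x0 w.

Let xi (ti : nat * 'I_n) : {RV P >-> R} := if ti.1 is t.+1 then w t ti.2 else x0 ti.2.
Let sd (ti : nat * 'I_n) : R := if ti.1 is t.+1 then sw else 1.

Let sd0 a : sd a != 0.
Proof. by rewrite /sd; case: a => -[|t] i /=; [exact: oner_neq0|exact: lt0r_neq0]. Qed.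

Let xi_normal a : centered_normal (sd a) (xi a).
Proof. by case: noise => h1 h2 _; case: a => -[|t] i; [exact: h1|exact: h2]. Qed.

Let xi_mean a b : has_mean P (fun v => xi a v * xi b v) (if a == b then sd a ^+ 2 else 0).
Proof.
have i2 := integrable_mul_centered_normal (sd0 a) (sd0 b) (xi_normal a) (xi_normal b).
split=> //; case: eqVneq => [->|ab].
  under eq_integral do rewrite -expr2.
  exact: integral_sqr_centered_normal (sd0 b) (xi_normal b).
apply: integral_mul_indep0 => //.
- move=> E F mE mF; case: noise => _ _ ind.
  have uab : uniq [:: a; b] by rewrite /= inE ab.
  have := ind [:: a; b] (fun c => if c == a then E else F) uab.
  rewrite !big_cons big_nil mule1 eqxx eq_sym (negbTE ab) => <-.
  + congr (P _); apply/seteqP; split => v /=.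
      move=> [Ev Fv] c /=; rewrite !inE => /orP[/eqP ->|/eqP ->].
        by rewrite eqxx.
      by rewrite eq_sym (negbTE ab).
    move=> H; split.
      by have := H a; rewrite /= eqxx; apply; rewrite inE eqxx.
    by have := H b; rewrite /= eq_sym (negbTE ab); apply; rewrite !inE eqxx orbT.
  + by move=> c; case: ifP.
- exact: integrable_centered_normal (sd0 b) (xi_normal b).
- exact: integral_centered_normal (sd0 b) (xi_normal b).
Qed.

Variables (A : 'M[R]_n) (B : 'M[R]_(n, d)) (K : 'M[R]_(d, n)).
Local Notation x := (lqr_state x0 w A B K).

Lemma lqr_stateS t v i : x t.+1 v i 0 =
  \sum_k (A + B *m K) i k * x t v k 0 + w t i v.
Proof.
by rewrite /= mulmxA -mulmxDl !mxE.
Qed.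

(** The cross terms of the recursion for second moments vanish because the state is uncorrelated
    with present and future noise, so both facts share one induction. *)
Lemma lqr_state_moments t :
  (forall i j, has_mean P (fun v => x t v i 0 * x t v j 0) (state_cov sw (A + B *m K) t i j)) /\
  (forall s i j, (t <= s)%N -> has_mean P (fun v => x t v i 0 * w s j v) 0).
Proof.
elim: t => [|t [IHx IHw]].
  split=> [i j|s i j _].
    have := xi_mean (0%N, i) (0%N, j); rewrite /xi /= /sd /= expr1n mxE xpair_eqE eqxx /=.
    rewrite -[(i == j)%:R]/((if i == j then 1%N else 0%N)%:R).
    by rewrite (fun_if (fun k => k%:R)); apply: has_mean_eq => v; rewrite !mxE.
  have := xi_mean (0%N, i) (s.+1, j); rewrite xpair_eqE /=.
  by apply: has_mean_eq => v; rewrite mxE.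
have wx i j : has_mean P (fun v => w t i v * x t v j 0) 0.
  by apply: has_mean_eq (IHw t j i (leqnn t)) => v; rewrite mulrC.
split=> [i j|s i j ts].
  set L := A + B *m K.
  have h1 := has_mean_sum (index_enum 'I_n) (fun k => has_mean_sum (index_enum 'I_n) (fun k' => has_meanZ (L i k * L j k') (IHx k k'))).
  have h2 := has_mean_sum (index_enum 'I_n) (fun k => has_meanZ (L i k) (IHw t k j (leqnn t))).
  have h3 := has_mean_sum (index_enum 'I_n) (fun k => has_meanZ (L j k) (wx i k)).
  have h4 := xi_mean (t.+1, i) (t.+1, j).
  move: (has_meanD (has_meanD h1 h2) (has_meanD h3 h4)).
  apply: has_mean_congr => [v|].
    rewrite !lqr_stateS -/L mulrDl !mulrDr; congr (_ + _ + (_ + _)).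
    - rewrite mulr_suml; apply: eq_bigr => k _.
      by rewrite mulr_sumr; apply: eq_bigr => k' _; ring.
    - by rewrite mulr_suml; apply: eq_bigr => k _; rewrite mulrA.
    - by rewrite mulr_sumr; apply: eq_bigr => k _; ring.
  - have z (f : 'I_n -> R) : \sum_k f k * 0 = 0 by rewrite big1// => k _; rewrite mulr0.
    rewrite !z add0r addr0 /= -/L !mxE; congr (_ + _).
      rewrite exchange_big /=; apply: eq_bigr => k' _; rewrite !mxE mulr_suml.
      by apply: eq_bigr => k _; ring.
    by rewrite xpair_eqE eqxx /= /sd /=; case: (i == j).
have h1 := has_mean_sum (index_enum 'I_n) (fun k => has_meanZ ((A + B *m K) i k) (IHw s k j (ltnW ts))).
have h2 := xi_mean (t.+1, i) (s.+1, j).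
apply: has_mean_congr (has_meanD h1 h2) => [v|].
  rewrite lqr_stateS mulrDl mulr_suml; congr (_ + _).
  by apply: eq_bigr => k _; rewrite mulrA.
rewrite big1 ?add0r => [|k _]; last by rewrite mulr0.
by rewrite xpair_eqE eqSS (ltn_eqF ts).
Qed.

Lemma lqr_avg_costE (Q : 'M[R]_n) (Rc : 'M[R]_d) N :
  lqr_avg_cost Q Rc x0 w A B K N =
  (N%:R^-1 * \sum_(0 <= t < N.+1)
    \tr ((Q + K^T *m Rc *m K) *m state_cov sw (A + B *m K) t))%:E.
Proof.
set Qc := Q + _.
have quadQc v : quad Q v + quad Rc (K *m v) = \sum_i \sum_j Qc i j * (v j 0 * v i 0).
  have -> : quad Q v + quad Rc (K *m v) = quad Qc v.
    by rewrite /quad /Qc mulmxDr mulmxDl [in RHS]mxE trmx_mul !mulmxA.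
  rewrite /quad mxE exchange_big; apply: eq_bigr => j _ /=; rewrite mxE mulr_suml.
  by apply: eq_bigr => i _; rewrite mxE; ring.
have H t : has_mean P (fun v => quad Q (x t v) + quad Rc (K *m x t v))
    (\tr (Qc *m state_cov sw (A + B *m K) t)).
  have [IHx _] := lqr_state_moments t.
  have := has_mean_sum (index_enum 'I_n) (fun i => has_mean_sum (index_enum 'I_n)
    (fun j => has_meanZ (Qc i j) (IHx j i))).
  apply: has_mean_congr => [v|]; first by rewrite quadQc.
  by rewrite /mxtrace; apply: eq_bigr => i _; rewrite mxE.
have [_ <-] := has_meanZ N%:R^-1 (has_mean_sum (index_iota 0 N.+1) H).
by rewrite /lqr_avg_cost unlock.
Qed.

End NoiseMoments.

(** * Quadratic forms, norms and spectra *)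

Section QuadraticForms.
Context {R : realType}.

Definition bil {n m} (M : 'M[R]_(n, m)) (x : 'cV[R]_n) (y : 'cV[R]_m) : R :=
  (x^T *m M *m y) 0 0.

Lemma quadE {n} (M : 'M[R]_n) x : quad M x = bil M x x. Proof. by []. Qed.

Section Bil.
Variables n m : nat.
Implicit Types (M : 'M[R]_(n, m)) (x : 'cV[R]_n) (y : 'cV[R]_m).

Lemma bilDl M x x' y : bil M (x + x') y = bil M x y + bil M x' y.
Proof. by rewrite /bil linearD /= !mulmxDl mxE. Qed.

Lemma bilDr M x y y' : bil M x (y + y') = bil M x y + bil M x y'.
Proof. by rewrite /bil mulmxDr mxE. Qed.

Lemma bilZl M a x y : bil M (a *: x) y = a * bil M x y.
Proof. by rewrite /bil linearZ /= -!scalemxAl mxE. Qed.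

Lemma bilZr M a x y : bil M x (a *: y) = a * bil M x y.
Proof. by rewrite /bil -!scalemxAr mxE. Qed.

Lemma bilNl M x y : bil M (- x) y = - bil M x y.
Proof. by rewrite -scaleN1r bilZl mulN1r. Qed.

Lemma bilNr M x y : bil M x (- y) = - bil M x y.
Proof. by rewrite -scaleN1r bilZr mulN1r. Qed.

Lemma bil0l M y : bil M 0 y = 0.
Proof. by rewrite /bil trmx0 !mul0mx mxE. Qed.

Lemma bil0r M x : bil M x 0 = 0.
Proof. by rewrite /bil mulmx0 mxE. Qed.

Lemma bilDm M M' x y : bil (M + M') x y = bil M x y + bil M' x y.
Proof. by rewrite /bil mulmxDr mulmxDl mxE. Qed.

Lemma bilNm M x y : bil (- M) x y = - bil M x y.
Proof. by rewrite /bil mulmxN mulNmx mxE. Qed.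

Lemma bilZm a M x y : bil (a *: M) x y = a * bil M x y.
Proof. by rewrite /bil -scalemxAr -scalemxAl mxE. Qed.

Lemma bil0m x y : bil (0 : 'M[R]_(n, m)) x y = 0.
Proof. by rewrite /bil mulmx0 mul0mx mxE. Qed.

Lemma bil_sum (I : Type) (r : seq I) (F : I -> 'M[R]_(n, m)) x y :
  bil (\sum_(i <- r) F i) x y = \sum_(i <- r) bil (F i) x y.
Proof.
elim: r => [|i r IH]; first by rewrite !big_nil bil0m.
by rewrite !big_cons bilDm IH.
Qed.

Lemma bil_tr M x y : bil M^T y x = bil M x y.
Proof.
rewrite /bil; have -> : y^T *m M^T *m x = (x^T *m M *m y)^T by rewrite !trmx_mul trmxK mulmxA.
by rewrite mxE.
Qed.

End Bil.

Lemma bil_delta n m (M : 'M[R]_(n, m)) i j :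
  bil M (delta_mx i 0) (delta_mx j 0) = M i j.
Proof. by rewrite /bil trmx_delta -rowE -colE !mxE. Qed.

Lemma bil_mulmx n n' m m' (A : 'M[R]_(n', n)) (B : 'M[R]_(m', m)) M x y :
  bil M (A *m x) (B *m y) = bil (A^T *m M *m B) x y.
Proof. by rewrite /bil trmx_mul !mulmxA. Qed.

Lemma quadDm n (M M' : 'M[R]_n) x : quad (M + M') x = quad M x + quad M' x.
Proof. exact: bilDm. Qed.

Lemma quadNm n (M : 'M[R]_n) x : quad (- M) x = - quad M x.
Proof. exact: bilNm. Qed.

Lemma quadZm n a (M : 'M[R]_n) x : quad (a *: M) x = a * quad M x.
Proof. exact: bilZm. Qed.

Lemma quad_mulmx n m (A : 'M[R]_(m, n)) M x :
  quad M (A *m x) = quad (A^T *m M *m A) x.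
Proof. exact: bil_mulmx. Qed.

Lemma quad_sum n (I : Type) (r : seq I) (F : I -> 'M[R]_n) x :
  quad (\sum_(i <- r) F i) x = \sum_(i <- r) quad (F i) x.
Proof. exact: bil_sum. Qed.

Lemma quad0 n (M : 'M[R]_n) : quad M 0 = 0. Proof. exact: bil0l. Qed.

Lemma quad0m n (x : 'cV[R]_n) : quad 0 x = 0. Proof. exact: bil0m. Qed.

Lemma quadZ n (M : 'M[R]_n) a x : quad M (a *: x) = a ^+ 2 * quad M x.
Proof. by rewrite !quadE bilZl bilZr mulrA expr2. Qed.

Lemma quadN n (M : 'M[R]_n) x : quad M (- x) = quad M x.
Proof. by rewrite !quadE bilNl bilNr opprK. Qed.

Lemma bilC n (M : 'M[R]_n) x y : M^T = M -> bil M x y = bil M y x.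
Proof. by move=> sM; rewrite -bil_tr sM. Qed.

Lemma quadD n (M : 'M[R]_n) x y : M^T = M ->
  quad M (x + y) = quad M x + 2 * bil M x y + quad M y.
Proof.
move=> sM; rewrite !quadE bilDl !bilDr (bilC y x sM); ring.
Qed.

Lemma eq_quad n (M M' : 'M[R]_n) : M^T = M -> M'^T = M' ->
  (forall x, quad M x = quad M' x) -> M = M'.
Proof.
move=> sM sM' E.
have B x y : bil M x y = bil M' x y.
  have := E (x + y); rewrite !quadD// !E => /eqP.
  rewrite (inj_eq (addIr _)) (inj_eq (addrI _)).
  by rewrite (inj_eq (mulfI _)) ?pnatr_eq0// => /eqP.
by apply/matrixP => i j; have := B (delta_mx i 0) (delta_mx j 0); rewrite !bil_delta.
Qed.

(** Homogeneity in s and t avoids division in the degenerate cases: each combination of signs is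
    settled by a single evaluation. *)
Lemma discriminant_le (a b c : R) :
  (forall s t, 0 <= s ^+ 2 * a + 2 * s * t * b + t ^+ 2 * c) -> b ^+ 2 <= a * c.
Proof.
move=> H; have a0 := H 1 0; have c0 := H 0 1.
have [x0|x0] := leP a 0; have [y0|y0] := leP c 0.
- have := H 1 (- b); nra.
- have := H c (- b); nra.
- have := H (- b) a; nra.
- have := H c (- b); nra.
Qed.

Lemma bil_CS n (M : 'M[R]_n) x y : possemidef M ->
  bil M x y ^+ 2 <= quad M x * quad M y.
Proof.
move=> [sM pM]; apply: discriminant_le => s t.
have := pM (s *: x + t *: y); rewrite quadD// !quadZ bilZl bilZr.
by rewrite !mulrA.
Qed.

(** The seminorm attached to a positive semidefinite [M]. *)
Definition pn {n} (M : 'M[R]_n) x : R := Num.sqrt (quad M x).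

Lemma pn_ge0 n (M : 'M[R]_n) x : 0 <= pn M x. Proof. exact: sqrtr_ge0. Qed.

Lemma sqr_pn n (M : 'M[R]_n) x : possemidef M -> pn M x ^+ 2 = quad M x.
Proof. by move=> [_ pM]; rewrite sqr_sqrtr. Qed.

Lemma bil_le_pn n (M : 'M[R]_n) x y : possemidef M ->
  `|bil M x y| <= pn M x * pn M y.
Proof.
move=> psdM; rewrite -sqrtrM ?(proj2 psdM)//.
by rewrite -sqrtr_sqr ler_wsqrtr// bil_CS.
Qed.

Lemma pn_triangle n (M : 'M[R]_n) x y : possemidef M ->
  pn M (x + y) <= pn M x + pn M y.
Proof.
move=> psdM; rewrite -(@ler_pXn2r _ 2)// ?nnegrE ?addr_ge0 ?pn_ge0//.
rewrite sqr_pn// quadD ?(proj1 psdM)// -!sqr_pn//.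
have := le_trans (ler_norm _) (bil_le_pn x y psdM).
have := pn_ge0 M x; have := pn_ge0 M y; nra.
Qed.

Lemma pnZ n (M : 'M[R]_n) a x : pn M (a *: x) = `|a| * pn M x.
Proof. by rewrite /pn quadZ sqrtrM ?sqr_ge0// sqrtr_sqr. Qed.

Lemma pnN n (M : 'M[R]_n) x : pn M (- x) = pn M x.
Proof. by rewrite /pn quadN. Qed.

Lemma psdD n (M M' : 'M[R]_n) : possemidef M -> possemidef M' ->
  possemidef (M + M').
Proof.
move=> [sM pM] [sM' pM']; split; first by rewrite linearD /= sM sM'.
by move=> x; rewrite quadDm addr_ge0.
Qed.

Lemma psdZ n a (M : 'M[R]_n) : 0 <= a -> possemidef M -> possemidef (a *: M).
Proof.
move=> a0 [sM pM]; split; first by rewrite linearZ /= sM.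
by move=> x; rewrite quadZm mulr_ge0.
Qed.

Lemma psd0 n : possemidef (0 : 'M[R]_n).
Proof. by split; [rewrite trmx0|move=> x; rewrite quad0m]. Qed.

Lemma psd_mulmx n m (A : 'M[R]_(m, n)) M : possemidef M ->
  possemidef (A^T *m M *m A).
Proof.
move=> [sM pM]; split; first by rewrite !trmx_mul trmxK sM mulmxA.
by move=> x; rewrite -quad_mulmx.
Qed.

Lemma psd_sum n (I : Type) (r : seq I) (F : I -> 'M[R]_n) :
  (forall i, possemidef (F i)) -> possemidef (\sum_(i <- r) F i).
Proof.
move=> H; elim: r => [|i r IH]; first by rewrite big_nil; exact: psd0.
by rewrite big_cons; exact: psdD.
Qed.

Lemma posdef_psd n (M : 'M[R]_n) : posdef M -> possemidef M.
Proof.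
move=> [sM pM]; split=> // x; have [->|x0] := eqVneq x 0; first by rewrite quad0.
exact/ltW/pM.
Qed.

(** Cauchy-Schwarz in the plane for the vectors (sqrt p, sqrt r) and (sqrt q, sqrt s), phrased with
    squares to avoid the roots. *)
Lemma sum_sqrt_CS (p q r s X Y : R) : 0 <= p -> 0 <= q -> 0 <= r -> 0 <= s ->
  X ^+ 2 <= p * q -> Y ^+ 2 <= r * s -> (X - Y) ^+ 2 <= (p + r) * (q + s).
Proof.
move=> p0 q0 r0 s0 hX hY.
have h0 : 0 <= p * s + r * q by rewrite addr_ge0 ?mulr_ge0.
have h1 : (2 * (X * Y)) ^+ 2 <= (p * s + r * q) ^+ 2.
  have -> : (p * s + r * q) ^+ 2 = (p * s - r * q) ^+ 2 + 4 * ((p * q) * (r * s)) by ring.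
  have -> : (2 * (X * Y)) ^+ 2 = 4 * (X ^+ 2 * Y ^+ 2) by ring.
  by apply: ler_wpDl; rewrite ?sqr_ge0// ler_pM2l// ler_pM ?sqr_ge0.
have h2 : `|2 * (X * Y)| <= p * s + r * q.
  by rewrite -(@ler_pXn2r _ 2)// ?nnegrE// real_normK ?num_real.
move: h2; rewrite ler_norml => /andP[h2 _].
have -> : (X - Y) ^+ 2 = X ^+ 2 + Y ^+ 2 - 2 * (X * Y) by ring.
have -> : (p + r) * (q + s) = p * q + r * s + (p * s + r * q) by ring.
lra.
Qed.

(** Both [c *: P + M] and [c *: P - M] are positive semidefinite and their forms differ by twice
    that of [M]; Cauchy-Schwarz for each is combined by [sum_sqrt_CS]. *)
Lemma quad_bounded_form n (P M : 'M[R]_n) c x y : possemidef P -> M^T = M ->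
  0 <= c -> (forall z, `|quad M z| <= c * quad P z) ->
  `|bil M x y| <= c * (pn P x * pn P y).
Proof.
move=> psdP sM c0 H.
have p1 : possemidef (c *: P + M).
  split; first by rewrite linearD linearZ /= (proj1 psdP) sM.
  move=> z; have := H z; rewrite quadDm quadZm ler_norml => /andP[]; lra.
have p2 : possemidef (c *: P - M).
  split; first by rewrite linearB linearZ /= (proj1 psdP) sM.
  move=> z; have := H z; rewrite quadDm quadZm quadNm ler_norml => /andP[]; lra.
have := bil_CS x y p1; have := bil_CS x y p2.
have := proj2 p1 x; have := proj2 p1 y; have := proj2 p2 x; have := proj2 p2 y.
rewrite !quadDm !bilDm !quadZm !bilZm !quadNm !bilNm -!(sqr_pn _ psdP).
have := pn_ge0 P x; have := pn_ge0 P y.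
set a := pn P x; set b := pn P y; set u := quad M x; set v := quad M y.
set t := bil M x y; set s := bil P x y => b0 a0 r0 s0 p0 q0 hY hX.
have ab0 : 0 <= c * (a * b) by rewrite !mulr_ge0.
suff : (2 * t) ^+ 2 <= (2 * (c * (a * b))) ^+ 2.
  rewrite -real_normK ?num_real// ler_pXn2r ?nnegrE ?mulr_ge0//.
  by rewrite normrM ger0_norm// ler_pM2l.
have := sum_sqrt_CS q0 p0 s0 r0 hX hY.
have -> : c * s + t - (c * s - t) = 2 * t by ring.
have -> : (c * a ^+ 2 + u + (c * a ^+ 2 - u)) * (c * b ^+ 2 + v + (c * b ^+ 2 - v)) = (2 * (c * (a * b))) ^+ 2 by ring.
by [].
Qed.

End QuadraticForms.

Section EuclideanNorm.
Context {R : realType}.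

Lemma psd1 n : possemidef (1%:M : 'M[R]_n).
Proof.
split; first by rewrite trmx1.
move=> x; rewrite /quad mulmx1 mxE sumr_ge0// => i _.
by rewrite mxE -expr2 sqr_ge0.
Qed.

Lemma quad1 n (x : 'cV[R]_n) : quad 1%:M x = \sum_i x i 0 ^+ 2.
Proof. by rewrite /quad mulmx1 mxE; apply: eq_bigr => i _; rewrite mxE expr2. Qed.

Lemma l2normE n (x : 'cV[R]_n) : l2norm x = pn 1%:M x.
Proof. by rewrite /pn quad1. Qed.

Lemma l2norm_ge0 n (x : 'cV[R]_n) : 0 <= l2norm x.
Proof. exact: sqrtr_ge0. Qed.

Lemma sqr_l2norm n (x : 'cV[R]_n) : l2norm x ^+ 2 = quad 1%:M x.
Proof. by rewrite l2normE sqr_pn//; exact: psd1. Qed.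

Lemma l2normD n (x y : 'cV[R]_n) : l2norm (x + y) <= l2norm x + l2norm y.
Proof. by rewrite !l2normE pn_triangle//; exact: psd1. Qed.

Lemma l2normN n (x : 'cV[R]_n) : l2norm (- x) = l2norm x.
Proof. by rewrite !l2normE pnN. Qed.

Lemma l2normZ n a (x : 'cV[R]_n) : l2norm (a *: x) = `|a| * l2norm x.
Proof. by rewrite !l2normE pnZ. Qed.

Lemma l2norm0 n : l2norm (0 : 'cV[R]_n) = 0.
Proof. by rewrite -(scale0r 0) l2normZ normr0 mul0r. Qed.

Lemma bil1_le n (x y : 'cV[R]_n) : bil 1%:M x y <= l2norm x * l2norm y.
Proof.
by rewrite (le_trans (ler_norm _))// !l2normE bil_le_pn//; exact: psd1.
Qed.

Lemma l2norm_eq0 n (x : 'cV[R]_n) : l2norm x = 0 -> x = 0.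
Proof.
move=> x0; have : quad 1%:M x = 0 by rewrite -sqr_l2norm x0 expr0n.
rewrite quad1 => /psumr_eq0P H; apply/matrixP => i j; rewrite ord1 mxE.
by apply/eqP; rewrite -sqrf_eq0; apply/eqP/H => // k _; exact: sqr_ge0.
Qed.

Lemma l2norm_gt0 n (x : 'cV[R]_n) : x != 0 -> 0 < l2norm x.
Proof.
move=> x0; rewrite lt_neqAle l2norm_ge0 andbT eq_sym.
by apply: contraNneq x0 => /l2norm_eq0 ->.
Qed.

Lemma l2norm_sum n (I : Type) (r : seq I) (F : I -> 'cV[R]_n) :
  l2norm (\sum_(i <- r) F i) <= \sum_(i <- r) l2norm (F i).
Proof.
elim: r => [|i r IH]; first by rewrite !big_nil l2norm0.
by rewrite !big_cons (le_trans (l2normD _ _))// lerD2l.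
Qed.

(** A crude constant, whose purpose is that the supremum in [opnorm] runs over a bounded set. *)
Lemma l2norm_mulmx_bounded n m (M : 'M[R]_(m, n)) :
  exists2 c, 0 <= c & forall x, l2norm (M *m x) <= c * l2norm x.
Proof.
exists (\sum_j l2norm (col j M)); first by rewrite sumr_ge0// => j _; exact: l2norm_ge0.
move=> x; have -> : M *m x = \sum_j x j 0 *: col j M.
  apply/matrixP => i k; rewrite ord1 mxE summxE; apply: eq_bigr => j _.
  by rewrite !mxE mulrC.
rewrite (le_trans (l2norm_sum _ _))// mulr_suml ler_sum// => j _.
rewrite l2normZ mulrC ler_wpM2l ?l2norm_ge0//.
rewrite -(@ler_pXn2r _ 2)// ?nnegrE ?l2norm_ge0// sqr_l2norm quad1.
rewrite real_normK ?num_real// (bigD1 j)//= lerDl sumr_ge0// => k _.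
exact: sqr_ge0.
Qed.

Lemma has_sup_opnorm n m (M : 'M[R]_(m, n)) :
  has_sup [set l2norm (M *m x) | x in [set x : 'cV[R]_n | l2norm x <= 1]].
Proof.
split; first by exists (l2norm (M *m 0)); exists 0 => //=; rewrite l2norm0.
have [c c0 H] := l2norm_mulmx_bounded M.
by exists c => _ [x /= x1 <-]; rewrite (le_trans (H x))// ler_piMr.
Qed.

Lemma opnorm_ge0 n m (M : 'M[R]_(m, n)) : 0 <= opnorm M.
Proof.
apply: ub_le_sup; first exact: (has_sup_opnorm M).2.
by exists 0; rewrite /= ?l2norm0// mulmx0 l2norm0.
Qed.

Lemma l2norm_opnorm n m (M : 'M[R]_(m, n)) x :
  l2norm (M *m x) <= opnorm M * l2norm x.
Proof.
have [->|x0] := eqVneq x 0; first by rewrite mulmx0 !l2norm0 mulr0.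
have nx := l2norm_gt0 x0.
rewrite -ler_pdivrMr//; apply: ub_le_sup; first exact: (has_sup_opnorm M).2.
exists ((l2norm x)^-1 *: x) => /=.
  by rewrite l2normZ ger0_norm ?invr_ge0 ?(ltW nx)// mulVf ?lexx// gt_eqF.
by rewrite -scalemxAr l2normZ ger0_norm ?invr_ge0 ?(ltW nx)// mulrC.
Qed.

Lemma opnorm_le n m (M : 'M[R]_(m, n)) c : 0 <= c ->
  (forall x, l2norm (M *m x) <= c * l2norm x) -> opnorm M <= c.
Proof.
move=> c0 H; apply: ge_sup; first exact: (has_sup_opnorm M).1.
by move=> _ [x /= x1 <-]; rewrite (le_trans (H x))// ler_piMr.
Qed.

Lemma opnormM n m p (M : 'M[R]_(m, n)) (N : 'M[R]_(n, p)) :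
  opnorm (M *m N) <= opnorm M * opnorm N.
Proof.
apply: opnorm_le => [|x]; first by rewrite mulr_ge0 ?opnorm_ge0.
rewrite -mulmxA (le_trans (l2norm_opnorm _ _))// -mulrA ler_wpM2l ?opnorm_ge0//.
exact: l2norm_opnorm.
Qed.

Lemma opnormD n m (M N : 'M[R]_(m, n)) :
  opnorm (M + N) <= opnorm M + opnorm N.
Proof.
apply: opnorm_le => [|x]; first by rewrite addr_ge0 ?opnorm_ge0.
by rewrite mulmxDl (le_trans (l2normD _ _))// mulrDl lerD ?l2norm_opnorm.
Qed.

(** |M^T x|^2 = <x, M M^T x> <= |x| [opnorm M] |M^T x|, and one factor cancels. *)
Lemma l2norm_opnorm_tr n m (M : 'M[R]_(m, n)) x :
  l2norm (M^T *m x) <= opnorm M * l2norm x.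
Proof.
have [h|h] := leP (l2norm (M^T *m x)) 0.
  by rewrite (le_trans h)// mulr_ge0 ?opnorm_ge0 ?l2norm_ge0.
rewrite -(ler_pM2l h) -expr2 sqr_l2norm quadE.
have -> : bil 1%:M (M^T *m x) (M^T *m x) = bil 1%:M x (M *m (M^T *m x)).
  by rewrite /bil trmx_mul trmxK !mulmx1 !mulmxA.
rewrite (le_trans (bil1_le _ _))// mulrC mulrA ler_wpM2r ?l2norm_ge0//.
by rewrite mulrC l2norm_opnorm.
Qed.

Lemma opnorm1 n : opnorm (1%:M : 'M[R]_n.+1) = 1.
Proof.
apply/eqP; rewrite eq_le; apply/andP; split.
  by apply: opnorm_le => // x; rewrite mul1mx mul1r.
have e0 : 0 < l2norm (delta_mx 0 0 : 'cV[R]_n.+1).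
  by apply: l2norm_gt0; apply/eqP => /matrixP/(_ 0 0)/eqP; rewrite !mxE oner_eq0.
have := l2norm_opnorm (1%:M : 'M[R]_n.+1) (delta_mx 0 0).
by rewrite mul1mx -{1}[l2norm _]mul1r ler_pM2r.
Qed.

Lemma quad_opnorm n (M : 'M[R]_n) x : quad M x <= opnorm M * quad 1%:M x.
Proof.
have -> : quad M x = bil 1%:M x (M *m x) by rewrite /quad /bil mulmx1 mulmxA.
rewrite (le_trans (bil1_le _ _))// -sqr_l2norm expr2 mulrCA ler_wpM2l ?l2norm_ge0//.
exact: l2norm_opnorm.
Qed.

(** At x = y the hypotheses give |y|^4 <= c g |y|^2. This turns a bound on a functional in the
    P-seminorm into a Euclidean bound on the vector that represents it. *)
Lemma quad_le_functional n (P : 'M[R]_n) (y : 'cV[R]_n) c g : 0 <= c -> 0 <= g ->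
  (forall x, bil 1%:M y x ^+ 2 <= c * quad P x) ->
  (forall x, quad P x <= g * quad 1%:M x) -> quad 1%:M y <= c * g.
Proof.
move=> c0 g0 H Pg; have := H y; rewrite -quadE => h.
have : 0 <= quad 1%:M y := (proj2 (psd1 n)) y.
rewrite le_eqVlt => /orP[/eqP <-|y0]; first by rewrite mulr_ge0.
rewrite -(ler_pM2r y0) -expr2 (le_trans h)// -mulrA ler_wpM2l//.
Qed.

End EuclideanNorm.

Section SymmetricSpectrum.
Context {R : realType}.

(** Cauchy-Schwarz for the form [S] between x and S^-1 x gives |x|^4 <= (x^T S x) b |x|^2. The
    constant uses [b + 1] since b may be 0 in dimension 0. *)
Lemma psd_unit_coercive n (S : 'M[R]_n) : possemidef S -> S \in unitmx ->
  exists2 c, 0 < c & forall x, c * quad 1%:M x <= quad S x.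
Proof.
move=> psdS uS; set b := opnorm (invmx S).
have b0 : 0 <= b := opnorm_ge0 _.
exists (b + 1)^-1 => [|x]; first by rewrite invr_gt0 ltr_wpDl.
rewrite ler_pdivrMl ?ltr_wpDl//.
have nx := (proj2 (psd1 (R := R) n)) x.
have sx := (proj2 psdS) x.
suff h : quad 1%:M x <= b * quad S x by rewrite (le_trans h)// mulrDl mul1r lerDl.
move: nx; rewrite le_eqVlt => /orP[/eqP <-|nx]; first by rewrite mulr_ge0.
have E1 : quad 1%:M x = bil S x (invmx S *m x).
  by rewrite /quad /bil mulmx1 -mulmxA mulKVmx.
have E2 : quad S (invmx S *m x) <= b * quad 1%:M x.
  have -> : quad S (invmx S *m x) = bil 1%:M (invmx S *m x) x.
    by rewrite /quad /bil mulmx1 -mulmxA mulKVmx.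
  rewrite (le_trans (bil1_le _ _))// -sqr_l2norm expr2 mulrA.
  by rewrite ler_wpM2r ?l2norm_ge0// l2norm_opnorm.
have := bil_CS x (invmx S *m x) psdS; rewrite -E1 expr2 => h.
rewrite -(ler_pM2r nx) (le_trans h)// [b * _]mulrC -mulrA ler_wpM2l//.
Qed.

Lemma eigenvalue_quad n (S : 'M[R]_n) a : S^T = S -> eigenvalue S a ->
  exists v : 'cV[R]_n, [/\ v != 0, S *m v = a *: v & quad S v = a * quad 1%:M v].
Proof.
move=> sS /eigenvalueP [v vS v0]; exists v^T.
have Sv : S *m v^T = a *: v^T by rewrite -[in LHS]sS -trmx_mul vS linearZ.
split=> //; last by rewrite /quad mulmx1 -mulmxA Sv -scalemxAr mxE.
by apply: contraNneq v0 => h; rewrite -(trmxK v) h trmx0.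
Qed.

Lemma quad1_gt0 n (x : 'cV[R]_n) : x != 0 -> 0 < quad 1%:M x.
Proof. by move=> x0; rewrite -sqr_l2norm exprn_gt0// l2norm_gt0. Qed.

(** No compactness of the sphere is invoked: if S - m were invertible at the infimum m of the
    Rayleigh quotient, coercivity would raise the lower bound m by some c > 0. So m is an
    eigenvalue, and the least one. *)
Lemma lambda_min_spec n (S : 'M[R]_n.+1) : S^T = S ->
  eigenvalue S (lambda_min S) /\
  forall x, lambda_min S * quad 1%:M x <= quad S x.
Proof.
move=> sS.
pose E := [set quad S x | x in [set x : 'cV[R]_n.+1 | quad 1%:M x = 1]].
have normalize (x : 'cV[R]_n.+1) : x != 0 -> quad 1%:M ((l2norm x)^-1 *: x) = 1.
  by move=> x0; rewrite quadZ -sqr_l2norm -exprMn mulVf ?expr1n// gt_eqF// l2norm_gt0.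
have lbE : has_lbound E.
  exists (- opnorm S) => _ [x /= x1 <-].
  have := quad_opnorm (- S) x; rewrite quadNm x1 mulr1 lerNl => h.
  apply: le_trans h; rewrite lerN2; apply: opnorm_le; first exact: opnorm_ge0.
  by move=> y; rewrite mulNmx l2normN l2norm_opnorm.
have E0 : E !=set0.
  pose e : 'cV[R]_n.+1 := delta_mx 0 0.
  have e0 : e != 0 by apply/eqP => /matrixP/(_ 0 0)/eqP; rewrite !mxE oner_eq0.
  by exists (quad S ((l2norm e)^-1 *: e)); exists ((l2norm e)^-1 *: e) => //=; exact: normalize.
pose m := inf E.
have mS x : m * quad 1%:M x <= quad S x.
  have [->|x0] := eqVneq x 0; first by rewrite !quad0 mulr0.
  have nx := l2norm_gt0 x0.
  have : m <= quad S ((l2norm x)^-1 *: x).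
    by apply: ge_inf => //; exists ((l2norm x)^-1 *: x) => //=; exact: normalize.
  by rewrite quadZ exprVn -sqr_l2norm ler_pdivlMl ?exprn_gt0// mulrC.
have psdT : possemidef (S - m%:M).
  split; first by rewrite linearB /= sS tr_scalar_mx.
  by move=> x; rewrite quadDm quadNm -scalemx1 quadZm subr_ge0.
have em : eigenvalue S m.
  rewrite /eigenvalue /eigenspace kermx_eq0 row_free_unit; apply/negP => uT.
  have [c c0 H] := psd_unit_coercive psdT uT.
  have : m + c <= m; last by rewrite gerDl leNgt c0.
  apply: lb_le_inf => // _ [x /= x1 <-].
  by have := H x; rewrite quadDm quadNm -(scalemx1 _ m) quadZm x1 !mulr1; lra.
have lE a : eigenvalue S a -> m <= a.
  move=> /(eigenvalue_quad sS)[v [v0 _ ev]].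
  by have := mS v; rewrite ev ler_pM2r// quad1_gt0.
suff -> : lambda_min S = m by [].
apply/eqP; rewrite eq_le; apply/andP; split.
  by apply: ge_inf => //; exists m => a /= /lE.
by apply: lb_le_inf; [exists m|move=> a /= /lE].
Qed.

(** Testing Q Q^T at an eigenvector of Q for its least eigenvalue gives sigma_min Q <= lambda_min Q,
    which is the direction required. *)
Lemma posdef_sigma_min n (Q : 'M[R]_n.+1) : posdef Q ->
  0 < sigma_min Q /\ forall x, sigma_min Q * quad 1%:M x <= quad Q x.
Proof.
move=> [sQ pQ].
have [/(eigenvalue_quad sQ)[v [v0 Qv qv]] qQ] := lambda_min_spec sQ.
have q0 : 0 < lambda_min Q.
  by have := pQ v v0; rewrite qv pmulr_lgt0// quad1_gt0.
have sQQ : (Q *m Q^T)^T = Q *m Q^T by rewrite trmx_mul trmxK.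
have quadQQ x : quad (Q *m Q^T) x = quad 1%:M (Q *m x).
  by rewrite /quad mulmx1 trmx_mul sQ !mulmxA.
have [/(eigenvalue_quad sQQ)[u [u0 QQu qu]] qQQ] := lambda_min_spec sQQ.
have l0 : 0 < lambda_min (Q *m Q^T).
  move: qu; rewrite quadQQ => qu.
  rewrite -(pmulr_lgt0 _ (quad1_gt0 u0)) -qu quad1_gt0//.
  apply/eqP => Qu; have := pQ u u0.
  by rewrite /quad -mulmxA Qu mulmx0 mxE ltxx.
have sq : sigma_min Q <= lambda_min Q.
  rewrite /sigma_min -(ger0_norm (ltW q0)) -sqrtr_sqr ler_wsqrtr//.
  have := qQQ v; rewrite quadQQ Qv quadZ ler_pM2r// quad1_gt0//.
split; first by rewrite sqrtr_gt0.
move=> x; apply: le_trans (qQ x); rewrite ler_wpM2r//.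
exact: (proj2 (psd1 _)).
Qed.

(** Controllability as a lower bound on the Gramian: it is free of eigenvalues and can be perturbed
    term by term. *)
Definition gram_controllable {n d} (l : nat) (nu : R)
    (A : 'M[R]_n) (B : 'M[R]_(n, d)) : Prop :=
  forall z : 'cV[R]_n, nu ^+ 2 * quad 1%:M z <=
    \sum_(j < l) quad 1%:M ((A ^+ j *m B)^T *m z).

Lemma controllable_gram n d l nu (A : 'M[R]_n.+1) (B : 'M[R]_(n.+1, d)) :
  0 < nu -> controllable l nu A B -> gram_controllable l nu A B.
Proof.
move=> nu0; rewrite /controllable /sigma_min; set C := controllability_mx l A B.
move=> h z.
have sC : (C *m C^T)^T = C *m C^T by rewrite trmx_mul trmxK.
have -> : \sum_(j < l) quad 1%:M ((A ^+ j *m B)^T *m z) = quad (C *m C^T) z.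
  rewrite /C /controllability_mx tr_mxrow mul_mxrow_mxcol quad_sum.
  by apply: eq_bigr => j _; rewrite quad_mulmx trmxK mulmx1.
apply: le_trans (proj2 (lambda_min_spec sC) z).
rewrite ler_wpM2r ?(proj2 (psd1 _))//.
have l0 : 0 < lambda_min (C *m C^T) by rewrite -sqrtr_gt0 (lt_le_trans nu0).
by rewrite -[leRHS]sqr_sqrtr ?(ltW l0)// ler_pXn2r ?nnegrE ?sqrtr_ge0 ?(ltW nu0).
Qed.

End SymmetricSpectrum.

(** * Average cost of a stable closed loop *)

Section AverageCost.
Context {R : realType}.

Definition power_gram {n} (L : 'M[R]_n) k : 'M[R]_n := L ^+ k *m (L ^+ k)^T.

Lemma power_gramS n (L : 'M[R]_n) k : power_gram L k.+1 = L *m power_gram L k *m L^T.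
Proof. by rewrite /power_gram exprS -mulmxE trmx_mul !mulmxA. Qed.

Lemma state_covE n sw (L : 'M[R]_n) t :
  state_cov sw L t = power_gram L t + sw ^+ 2 *: \sum_(0 <= k < t) power_gram L k.
Proof.
elim: t => [|t IH].
  by rewrite big_nil scaler0 addr0 /power_gram expr0 mul1mx trmx1.
rewrite /= IH mulmxDr mulmxDl -power_gramS -addrA; congr (_ + _).
rewrite -scalemxAr -scalemxAl big_nat_recl// scalerDr addrC; congr (_ + _).
  by rewrite /power_gram expr0 mul1mx trmx1 scalemx1.
congr (_ *: _); rewrite mulmx_sumr mulmx_suml.
by apply: eq_bigr => k _; rewrite power_gramS.
Qed.

Lemma trace_mul_gram n m (M : 'M[R]_n) (X : 'M[R]_(n, m)) :
  \tr (M *m (X *m X^T)) = \sum_j quad M (col j X).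
Proof.
rewrite mulmxA mxtrace_mulC mulmxA /mxtrace; apply: eq_bigr => j _.
by rewrite colE quad_mulmx quadE bil_delta.
Qed.

Lemma tr_psd_gram_ge0 n m (M : 'M[R]_n) (X : 'M[R]_(n, m)) : possemidef M ->
  0 <= \tr (M *m (X *m X^T)).
Proof. by move=> [_ pM]; rewrite trace_mul_gram sumr_ge0. Qed.

Lemma tr_gram_le n m (M : 'M[R]_n) (X : 'M[R]_(n, m)) :
  \tr (M *m (X *m X^T)) <= opnorm M * \tr (X *m X^T).
Proof.
rewrite -[X in _ <= _ * \tr X]mul1mx !trace_mul_gram mulr_sumr ler_sum// => j _.
exact: quad_opnorm.
Qed.

Section Limit.
Variables (n : nat) (L P D : 'M[R]_n) (sw b c : R).
Hypotheses (psdP : possemidef P) (psdD : possemidef D).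
Hypothesis sumL : forall N, \sum_(0 <= k < N) \tr (power_gram L k) <= c.
Hypothesis sumD : forall N, \sum_(0 <= k < N) \tr (D *m power_gram L k) <= b.

Let trG_ge0 k : 0 <= \tr (power_gram L k).
Proof. by have := tr_psd_gram_ge0 (L ^+ k) (psd1 n); rewrite mul1mx. Qed.

Let trcovE (M : 'M[R]_n) t : \tr (M *m state_cov sw L t) =
  \tr (M *m power_gram L t) + sw ^+ 2 * \sum_(0 <= k < t) \tr (M *m power_gram L k).
Proof.
rewrite state_covE mulmxDr mxtraceD; congr (_ + _).
by rewrite -scalemxAr mxtraceZ mulmx_sumr raddf_sum.
Qed.

Let trcov_bounded t :
  0 <= \tr (P *m state_cov sw L t) <= opnorm P * c * (1 + sw ^+ 2).
Proof.
have g0 k : 0 <= \tr (P *m power_gram L k) by exact: tr_psd_gram_ge0.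
have gle k : \tr (P *m power_gram L k) <= opnorm P * \tr (power_gram L k).
  exact: tr_gram_le.
rewrite trcovE; apply/andP; split.
  by rewrite addr_ge0// mulr_ge0 ?sqr_ge0// sumr_ge0.
rewrite mulrDr mulr1 lerD//.
  rewrite (le_trans (gle t))// ler_wpM2l ?opnorm_ge0//.
  by apply: le_trans (sumL t.+1); rewrite big_nat_recr//= lerDr sumr_ge0.
rewrite mulrC ler_wpM2r ?sqr_ge0//.
apply: (@le_trans _ _ (\sum_(0 <= k < t) opnorm P * \tr (power_gram L k))).
  by rewrite ler_sum.
by rewrite -mulr_sumr ler_wpM2l ?opnorm_ge0.
Qed.

(** Write p t for the trace of P against the covariance at time t. The expected stage cost is p t -
    p (t+1) + sw^2 tr P plus the trace of D against the covariance. The first difference telescopes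
    and stays bounded, and the last term converges to sw^2 times the sum g of the traces of D L^k
    (L^k)^T, hence so do its Cesaro means. *)
Lemma average_cost_limit : exists g : R, [/\ 0 <= g, g <= b &
  (N%:R^-1 * \sum_(0 <= t < N.+1)
    \tr ((P + D - L^T *m P *m L) *m state_cov sw L t)) @[N --> \oo]
  --> sw ^+ 2 * (\tr P + g)].
Proof.
have d0 k : 0 <= \tr (D *m power_gram L k) by exact: tr_psd_gram_ge0.
pose u : R^nat := fun k => \tr (D *m power_gram L k).
have cu : cvgn (series u).
  apply: nondecreasing_is_cvgn; first by apply: nondecreasing_series => k _ _; exact: d0.
  by exists b => _ [N _ <-]; rewrite /series /=; exact: sumD.
pose g := limn (series u).
have ug : series u @ \oo --> g by [].
exists g; split.
- by apply: limr_ge => //; apply: nearW => N; rewrite /series /= sumr_ge0// => k _; exact: d0.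
- by apply: limr_le => //; apply: nearW => N; exact: sumD.
pose e : R^nat := fun t => \tr (D *m state_cov sw L t).
have eg : e @ \oo --> sw ^+ 2 * g.
  rewrite -[X in _ --> X]add0r.
  rewrite (_ : e = fun t => u t + sw ^+ 2 * series u t); last first.
    by apply/funext => t; rewrite /e trcovE.
  apply: cvgD; first exact: cvg_series_cvg_0.
  by apply: cvgM => //; exact: cvg_cst.
pose p t := \tr (P *m state_cov sw L t).
have step t : \tr ((P + D - L^T *m P *m L) *m state_cov sw L t) =
    p t - p t.+1 + (sw ^+ 2 * \tr P + e t).
  rewrite !mulmxDl mulNmx !mxtraceD raddfN /= -/(p t) -/(e t).
  have -> : p t.+1 = \tr (L^T *m P *m L *m state_cov sw L t) + sw ^+ 2 * \tr P.
    rewrite /p /= mulmxDr mxtraceD mul_mx_scalar mxtraceZ; congr (_ + _).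
    by rewrite mulmxA [LHS]mxtrace_mulC !mulmxA.
  ring.
have sumE N : \sum_(0 <= t < N.+1) \tr ((P + D - L^T *m P *m L) *m state_cov sw L t) =
    p 0 - p N.+1 + (N.+1%:R * (sw ^+ 2 * \tr P) + series e N.+1).
  rewrite (eq_bigr _ (fun t _ => step t)) /series /=.
  elim: N => [|N IH]; first by rewrite !big_nat1 mul1r.
  rewrite big_nat_recr//= IH [in RHS]big_nat_recr//= -[in RHS]natr1.
  ring.
set M := opnorm P * c * (1 + sw ^+ 2).
have pb : (N.+1%:R^-1 * (p 0 - p N.+1)) @[N --> \oo] --> (0 : R).
  apply: (@squeeze_cvgr _ _ _ _ (fun N => - M * harmonic N) (fun N => M * harmonic N)).
  - near=> N; have /andP[h1 h2] := trcov_bounded 0; have /andP[h3 h4] := trcov_bounded N.+1.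
    have i0 : 0 <= N.+1%:R^-1 :> R by rewrite invr_ge0.
    rewrite /harmonic /= [_ * (p 0 - _)]mulrC !ler_wpM2r//.
    + by rewrite lerBlDr (le_trans h2)// lerDl.
    + by rewrite lerNl opprB lerBlDr (le_trans h4)// lerDl.
  - rewrite -(mulr0 (- M)); apply: cvgM; [exact: cvg_cst|exact: cvg_harmonic].
  - rewrite -(mulr0 M); apply: cvgM; [exact: cvg_cst|exact: cvg_harmonic].
have ce := cesaro eg.
have inv0 : (N%:R^-1 : R) @[N --> \oo] --> (0 : R).
  rewrite -cvg_shiftS /=; exact: cvg_harmonic.
(* The cost adds N + 1 terms but divides by N; the factor 1 + 1/N corrects the mean over N + 1
   terms. *)
have main : ((1 + N%:R^-1) * (N.+1%:R^-1 * (p 0 - p N.+1) + (sw ^+ 2 * \tr P + arithmetic_mean e N)))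
    @[N --> \oo] --> (1 + 0) * (0 + (sw ^+ 2 * \tr P + sw ^+ 2 * g)).
  apply: cvgM; first by apply: cvgD => //; exact: cvg_cst.
  by apply: cvgD => //; apply: cvgD => //; exact: cvg_cst.
rewrite mulrDr; move: main; rewrite addr0 mul1r add0r; apply: cvg_trans.
apply: near_eq_cvg; near=> N.
rewrite sumE /arithmetic_mean /=.
have N0 : N%:R != 0 :> R by rewrite pnatr_eq0 -lt0n; near: N; exact: nbhs_infty_gt.
have N1 : N.+1%:R != 0 :> R by rewrite pnatr_eq0.
have -> : 1 + N%:R^-1 = N%:R^-1 * N.+1%:R :> R by rewrite -natr1 mulrDr mulVf// mulr1.
by rewrite -!mulrA; congr (_ * _); rewrite !mulrDr !mulVKf.
Unshelve. all: by end_near. Qed.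

End Limit.

End AverageCost.

(** * The Riccati equation *)

Section Riccati.
Context {R : realType}.
Variables n d : nat.
Implicit Types (A P H Q : 'M[R]_n) (B : 'M[R]_(n, d)) (K : 'M[R]_(d, n)) (Rc : 'M[R]_d).

Lemma posdef_unit m (M : 'M[R]_m) : posdef M -> M \in unitmx.
Proof.
move=> [sM pM]; apply/negPn/negP => nu.
have : eigenvalue M 0.
  by rewrite /eigenvalue /eigenspace kermx_eq0 row_free_unit raddf0 subr0.
move=> /(eigenvalue_quad sM)[v [v0 _ qv]].
by have := pM v v0; rewrite qv mul0r ltxx.
Qed.

Lemma posdef_add_psd m (M N : 'M[R]_m) : posdef M -> possemidef N -> posdef (M + N).
Proof.
move=> [sM pM] [sN pN]; split; first by rewrite linearD /= sM sN.
by move=> x x0; rewrite quadDm ltr_wpDr// pM.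
Qed.

Definition input_hessian B Rc P : 'M[R]_d := Rc + B^T *m P *m B.

Definition riccati_gain A B Rc P : 'M[R]_(d, n) :=
  - (invmx (input_hessian B Rc P) *m B^T *m P *m A).

(** The derivative in u of the one-step cost u^T Rc u + (A x + B u)^T P (A x + B u) vanishes at u =
    K x for every x; no inverse is involved. *)
Definition stationary A B Rc P K : Prop :=
  Rc *m K + B^T *m P *m (A + B *m K) = 0.

Definition closed_loop_cost A B Q Rc P K : 'M[R]_n :=
  Q + K^T *m Rc *m K + (A + B *m K)^T *m P *m (A + B *m K).

(** The Riccati equation with the gain as a second unknown tied by stationarity. The perturbation
    arguments use this inverse-free form; [lqr_sol_dare] and [dare_lqr_sol] connect it with the
    textbook equation. *)
Definition lqr_sol A B Q Rc P K : Prop :=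
  [/\ possemidef P, stationary A B Rc P K & P = closed_loop_cost A B Q Rc P K].

Lemma input_hessian_posdef B Rc P : posdef Rc -> possemidef P ->
  posdef (input_hessian B Rc P).
Proof. by move=> pR psdP; apply: posdef_add_psd => //; exact: psd_mulmx. Qed.

Lemma stationary_iff A B Rc P K :
  stationary A B Rc P K <-> input_hessian B Rc P *m K = - (B^T *m P *m A).
Proof.
rewrite /stationary /input_hessian mulmxDr mulmxDl !mulmxA.
rewrite addrCA -[X in _ <-> X = _]addr0; split => /eqP.
  by rewrite addr_eq0 => /eqP ->; rewrite opprK addr0.
by rewrite addr0 => /eqP ->; rewrite subrr.
Qed.

Lemma riccati_gain_stationary A B Rc P : posdef Rc -> possemidef P ->
  stationary A B Rc P (riccati_gain A B Rc P).
Proof.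
move=> pR psdP; apply/stationary_iff.
rewrite /riccati_gain mulmxN -!mulmxA mulKVmx//.
exact/posdef_unit/input_hessian_posdef.
Qed.

Lemma stationary_gain A B Rc P K : posdef Rc -> possemidef P ->
  stationary A B Rc P K -> K = riccati_gain A B Rc P.
Proof.
move=> pR psdP /stationary_iff E; have uM := posdef_unit (input_hessian_posdef B pR psdP).
by rewrite -[LHS](mulKmx uM) E /riccati_gain mulmxN !mulmxA.
Qed.

Lemma stationary_cross A B Rc P K x v : Rc^T = Rc -> P^T = P ->
  stationary A B Rc P K ->
  bil Rc (K *m x) v + bil P ((A + B *m K) *m x) (B *m v) = 0.
Proof.
move=> sR sP st; rewrite bil_mulmx -[v in bil Rc _ v]mul1mx bil_mulmx mulmx1 -bilDm.
rewrite (_ : _ + _ = 0) ?bil0m// -[LHS]trmxK linearD /= !trmx_mul !trmxK sR sP.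
by rewrite mulmxA st trmx0.
Qed.

(** Stationarity kills the term linear in u - K x. [P] is an arbitrary symmetric matrix here, so the
    identity applies to value iterates as well as to Riccati solutions. *)
Lemma complete_square A B Q Rc P K x u : Rc^T = Rc -> P^T = P ->
  stationary A B Rc P K ->
  quad Q x + quad Rc u + quad P (A *m x + B *m u) =
  quad (closed_loop_cost A B Q Rc P K) x + quad (input_hessian B Rc P) (u - K *m x).
Proof.
move=> sR sP st; set v := u - _; set L := A + B *m K.
have -> : u = K *m x + v by rewrite addrC subrK.
clearbody v; have -> : A *m x + B *m (K *m x + v) = L *m x + B *m v.
  by rewrite /L mulmxDr mulmxDl !mulmxA addrA.
have cross := stationary_cross x v sR sP st; rewrite -/L in cross.
rewrite /closed_loop_cost -/L /input_hessian !quadDm !quadD// -!quad_mulmx; clearbody L.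
by move: cross; set a := bil _ _ _; set b := bil _ _ _ => cross; lra.
Qed.

Lemma psd_closed_loop_cost A B Q Rc P K : possemidef Q -> possemidef Rc ->
  possemidef P -> possemidef (closed_loop_cost A B Q Rc P K).
Proof. by move=> pQ pR pP; do 2?apply: psdD => //; exact: psd_mulmx. Qed.

Lemma closed_loop_costE A B Q Rc P K : stationary A B Rc P K -> Rc^T = Rc -> P^T = P ->
  closed_loop_cost A B Q Rc P K = A^T *m P *m (A + B *m K) + Q.
Proof.
move=> st sR sP; rewrite /closed_loop_cost; move: st; rewrite /stationary; set L := A + B *m K => st.
have -> : L^T = A^T + K^T *m B^T by rewrite linearD /= trmx_mul.
have : K^T *m (Rc *m K + B^T *m P *m L) = 0 by rewrite st mulmx0.
rewrite mulmxDr !mulmxDl !mulmxA => /eqP; rewrite addr_eq0 => /eqP ->.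
by rewrite [_ *m L + _]addrC addrA subrK addrC.
Qed.

Lemma lqr_sol_dare A B Q Rc P K : posdef Rc -> Q^T = Q ->
  lqr_sol A B Q Rc P K -> dare_solution A B Q Rc P.
Proof.
move=> pR sQ [psdP st PE]; split=> //.
have KE := stationary_gain pR psdP st.
rewrite [LHS]PE closed_loop_costE ?(proj1 psdP) ?(proj1 pR)//; congr (_ + _).
by rewrite mulmxDr {1}KE /riccati_gain !mulmxN !mulmxA.
Qed.

Lemma dare_lqr_sol A B Q Rc P : posdef Rc ->
  dare_solution A B Q Rc P -> lqr_sol A B Q Rc P (riccati_gain A B Rc P).
Proof.
move=> pR [psdP PE]; have st := riccati_gain_stationary A B pR psdP.
split=> //; rewrite closed_loop_costE ?(proj1 psdP) ?(proj1 pR)//.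
by rewrite {1}PE mulmxDr /riccati_gain !mulmxN !mulmxA.
Qed.

Lemma lqr_sol_step A B Q Rc P K x u : Rc^T = Rc -> lqr_sol A B Q Rc P K ->
  quad Q x + quad Rc u + quad P (A *m x + B *m u) =
  quad P x + quad (input_hessian B Rc P) (u - K *m x).
Proof.
by move=> sR [[sP _] st PE]; rewrite (complete_square Q x u sR sP st) -PE.
Qed.

Lemma lqr_sol_le A B Q Rc P K x u : posdef Rc -> lqr_sol A B Q Rc P K ->
  quad P x <= quad Q x + quad Rc u + quad P (A *m x + B *m u).
Proof.
move=> pR sol; rewrite (lqr_sol_step x u (proj1 pR) sol) lerDl.
case: sol => psdP _ _; exact: (proj2 (posdef_psd (input_hessian_posdef B pR psdP))).
Qed.

Lemma lqr_sol_opt A B Q Rc P K x : lqr_sol A B Q Rc P K ->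
  quad P x = quad Q x + quad Rc (K *m x) + quad P ((A + B *m K) *m x).
Proof. by case=> _ _ {1}->; rewrite /closed_loop_cost !quadDm -!quad_mulmx. Qed.

(** The polarized Bellman identity. Stationarity makes it hold for every input [v], so the optimal
    trajectory can be paired with an arbitrary one. *)
Lemma lqr_sol_bil A B Q Rc P K x y v : Q^T = Q -> Rc^T = Rc ->
  lqr_sol A B Q Rc P K ->
  bil P x y = bil Q x y + bil Rc (K *m x) v +
    bil P ((A + B *m K) *m x) (A *m y + B *m v).
Proof.
move=> sQ sR [[sP _] st PE]; have cross := stationary_cross x v sR sP st.
rewrite bilDr (bilC x y sP) {1}PE closed_loop_costE// bilDm (bilC y x sQ).
rewrite (bilC _ (A *m y) sP) bil_mulmx.
by move: cross; lra.
Qed.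

(** Adding up the decrements would give k e <= c f(0) for every k. *)
Lemma quad_iter_bounded (f : nat -> R) c : (forall k, 0 <= f k) -> 0 <= c ->
  forall e, 0 < e -> (forall k, e <= c * (f k - f k.+1)) -> False.
Proof.
move=> f0 c0 e e0 H.
have S k : k%:R * e <= c * (f 0%N - f k).
  elim: k => [|k IH]; first by rewrite mul0r subrr mulr0.
  have := H k; rewrite -natr1; move: IH; lra.
have [k] : exists k : nat, c * f 0%N < k%:R * e.
  exists (Num.truncn (c * f 0%N / e)).+1; rewrite -ltr_pdivrMr//; exact: truncnS_gt.
have := S k; have := mulr_ge0 c0 (f0 k); lra.
Qed.

(** Along the loop of [K'], P loses at most the running cost and H at least that much, so a positive
    gap P - H never shrinks. The gap is at most |P| |y|^2, which the dissipation bounds by a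
    multiple of the decrease of H; H would thus drop by a fixed amount forever. Dissipation takes
    the place of stability of the loop. *)
Lemma lqr_sol_min A B Q Rc P K K' H q : posdef Rc -> lqr_sol A B Q Rc P K ->
  0 < q -> (forall x, q * quad 1%:M x <= quad Q x) -> possemidef H ->
  (forall x, quad Q x + quad Rc (K' *m x) + quad H ((A + B *m K') *m x) <= quad H x) ->
  forall x, quad P x <= quad H x.
Proof.
move=> pR sol q0 qQ psdH diss x; rewrite leNgt; apply/negP => lt.
set L := A + B *m K'; pose y k := iter k (mulmx L) x.
have step k : quad P (y k) - quad H (y k) <= quad P (y k.+1) - quad H (y k.+1).
  have := lqr_sol_le (y k) (K' *m y k) pR sol; have := diss (y k).
  by rewrite /= -/L mulmxA -mulmxDl -/L; lra.
have grow k : quad P x - quad H x <= quad P (y k) - quad H (y k).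
  by elim: k => [|k IH] //; exact: le_trans IH (step k).
have [psdP _ _] := sol.
apply: (@quad_iter_bounded (fun k => quad H (y k)) (opnorm P / q)
   _ _ (quad P x - quad H x)).
- by move=> k; exact: (proj2 psdH).
- by rewrite divr_ge0 ?opnorm_ge0 ?ltW.
- by rewrite subr_gt0.
move=> k; have := grow k; have := (proj2 psdH) (y k).
have := quad_opnorm P (y k); have := diss (y k); have := qQ (y k).
have := (proj2 (posdef_psd pR)) (K' *m y k).
rewrite -/L /= => h1 h2 h3 h4 h5 h6.
have h7 : q * quad 1%:M (y k) <= quad H (y k) - quad H (L *m y k) by lra.
have : opnorm P * quad 1%:M (y k) <= opnorm P / q * (quad H (y k) - quad H (L *m y k)).
  by rewrite -mulrA ler_wpM2l ?opnorm_ge0// ler_pdivlMl.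
lra.
Qed.

Lemma lqr_sol_unique A B Q Rc P K P' K' q : posdef Rc -> 
  0 < q -> (forall x, q * quad 1%:M x <= quad Q x) ->
  lqr_sol A B Q Rc P K -> lqr_sol A B Q Rc P' K' -> P = P'.
Proof.
move=> pR q0 qQ sol sol'.
have [psdP _ _] := sol; have [psdP' _ _] := sol'.
apply: eq_quad => [| |x]; [exact: (proj1 psdP)|exact: (proj1 psdP')|].
apply/eqP; rewrite eq_le; apply/andP; split.
  by apply: (lqr_sol_min (K' := K') pR sol q0 qQ psdP') => y; rewrite -(lqr_sol_opt y sol').
by apply: (lqr_sol_min (K' := K) pR sol' q0 qQ psdP) => y; rewrite -(lqr_sol_opt y sol).
Qed.

Lemma lqr_sol_is_dare A B Q Rc P K q : posdef Rc -> Q^T = Q ->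
  0 < q -> (forall x, q * quad 1%:M x <= quad Q x) ->
  lqr_sol A B Q Rc P K ->
  [/\ is_dare A B Q Rc (dare A B Q Rc), dare A B Q Rc = P & lqr_gain A B Q Rc = K].
Proof.
move=> pR sQ q0 qQ sol.
have dP : is_dare A B Q Rc P.
  split; first exact: lqr_sol_dare pR sQ sol.
  by move=> P' /(dare_lqr_sol pR) sol'; exact: lqr_sol_unique pR q0 qQ sol' sol.
have dE : dare A B Q Rc = P.
  by rewrite /dare; case: xgetP => [P' _ [dP' _]|/(_ P)//]; exact: (proj2 dP).
rewrite dE; split=> //; rewrite /lqr_gain dE.
by case: sol => psdP st _; rewrite (stationary_gain pR psdP st).
Qed.

End Riccati.

(** * Minimum-energy steering *)

Section Steering.
Context {R : realType}.

Fixpoint traj {n d} (A : 'M[R]_n) (B : 'M[R]_(n, d)) (v : nat -> 'cV[R]_d)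
    (x : 'cV[R]_n) (j : nat) : 'cV[R]_n :=
  if j is i.+1 then A *m traj A B v x i + B *m v i else x.

Variables n d : nat.
Implicit Types (A : 'M[R]_n) (B : 'M[R]_(n, d)) (v : nat -> 'cV[R]_d).

Lemma traj_sol A B v x j : traj A B v x j =
  A ^+ j *m x + \sum_(0 <= i < j) A ^+ (j - i.+1) *m B *m v i.
Proof.
elim: j => [|j IH]; first by rewrite /= big_nil addr0 expr0 mul1mx.
rewrite /= IH big_nat_recr//= subnn expr0 mul1mx mulmxDr addrA; congr (_ + _).
have <- : A *m A ^+ j = A ^+ j.+1 by rewrite exprS mulmxE.
rewrite mulmxA; congr (_ + _).
rewrite mulmx_sumr; apply: eq_big_nat => i /andP[_ ij].
by rewrite subSn// exprS -mulmxE !mulmxA.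
Qed.

Lemma sqr_sum_le (f : nat -> R) k :
  (\sum_(0 <= i < k) f i) ^+ 2 <= k%:R * \sum_(0 <= i < k) f i ^+ 2.
Proof.
elim: k => [|k IH]; first by rewrite !big_nil expr0n mul0r.
rewrite !big_nat_recr//=; set S := \sum_(_ <= _ < _) _ in IH *.
set Q := \sum_(_ <= _ < _) _ in IH *.
have Q0 : 0 <= Q by rewrite sumr_ge0// => i _; exact: sqr_ge0.
have K0 : 0 <= k%:R :> R by [].
rewrite -natr1; move: K0 IH; set K := k%:R; set a := f k; clearbody S Q K a.
rewrite le_eqVlt => /orP[/eqP <-|K0] IH.
  have S0 : S = 0 by apply/eqP; rewrite -sqrf_eq0 eq_le sqr_ge0 andbT; move: IH; rewrite mul0r.
  by rewrite S0 !add0r mul1r lerDr.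
suff : 2 * S * a <= K * a ^+ 2 + Q.
  have -> : (S + a) ^+ 2 = S ^+ 2 + 2 * S * a + a ^+ 2 by ring.
  have -> : (K + 1) * (Q + a ^+ 2) = K * Q + (K * a ^+ 2 + Q) + a ^+ 2 by ring.
  lra.
rewrite -(ler_pM2l K0); have := sqr_ge0 (K * a - S).
have -> : (K * a - S) ^+ 2 = K * (K * a ^+ 2) - K * (2 * S * a) + S ^+ 2 by ring.
rewrite mulrDr; lra.
Qed.

(** The minimum-energy input, built from h = W^-1 w with W the controllability Gramian. Its energy
    is h^T W h = <h, w>, and nu^2 |h|^2 <= h^T W h together with Cauchy-Schwarz bounds it. The
    exponents run backwards because the first input is propagated longest. *)
Lemma gram_steering A B l nu w : 0 < nu -> gram_controllable l nu A B ->
  exists v, traj A B v 0 l = w /\ nu ^+ 2 * (\sum_(0 <= i < l) quad 1%:M (v i)) <= quad 1%:M w.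
Proof.
move=> nu0 gc.
pose W : 'M[R]_n := \sum_(j < l) (A ^+ j *m B) *m (A ^+ j *m B)^T.
have quadW z : quad W z = \sum_(j < l) quad 1%:M ((A ^+ j *m B)^T *m z).
  by rewrite /W quad_sum; apply: eq_bigr => j _; rewrite quad_mulmx trmxK mulmx1.
have pW : posdef W.
  split.
    rewrite /W linear_sum /=; apply: eq_bigr => j _; by rewrite trmx_mul trmxK.
  move=> z z0; rewrite quadW (lt_le_trans _ (gc z))// mulr_gt0 ?exprn_gt0//.
  exact: quad1_gt0.
have uW := posdef_unit pW.
pose h := invmx W *m w; have Wh : W *m h = w by rewrite /h mulKVmx.
exists (fun i => (A ^+ (l - i.+1) *m B)^T *m h).
have E2 : \sum_(0 <= i < l) quad 1%:M ((A ^+ (l - i.+1) *m B)^T *m h) = quad W h.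
  rewrite quadW big_nat_rev /= add0n big_mkord; apply: eq_bigr => i _.
  by rewrite subnSK ?subKn// ltnW.
split.
  rewrite traj_sol mulmx0 add0r -[RHS]Wh /W mulmx_suml big_nat_rev /= add0n big_mkord.
  by apply: eq_bigr => i _; rewrite subnSK ?subKn ?mulmxA// ltnW.
rewrite E2; have hw : quad W h = bil 1%:M h w by rewrite /quad /bil mulmx1 -mulmxA Wh.
have Wh0 : 0 <= quad W h := (proj2 (posdef_psd pW)) h.
have := gc h; rewrite -quadW => gh.
move: Wh0; rewrite le_eqVlt => /orP[/eqP <-|Wh0].
  by rewrite mulr0; exact: (proj2 (psd1 n)).
rewrite -(ler_pM2r Wh0) -mulrA -expr2 {1}hw.
apply: (le_trans (y := nu ^+ 2 * (quad 1%:M h * quad 1%:M w))).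
  by rewrite ler_wpM2l ?sqr_ge0//; exact: bil_CS (psd1 n).
by rewrite mulrA mulrC ler_wpM2l//; exact: (proj2 (psd1 n)).
Qed.

(** One factor l comes from Cauchy-Schwarz over the inputs, the other from the number of states. *)
Lemma traj_energy A B v l a : 0 <= a ->
  (forall k, (k < l)%N -> opnorm (A ^+ k *m B) <= a) ->
  \sum_(0 <= j < l) quad 1%:M (traj A B v 0 j) <=
    (l%:R * a) ^+ 2 * \sum_(0 <= i < l) quad 1%:M (v i).
Proof.
move=> a0 Ha; set E := (X in _ <= _ * X).
have q0 x : 0 <= quad 1%:M x :> R by exact: (proj2 (psd1 _)).
have bd j : (j < l)%N -> quad 1%:M (traj A B v 0 j) <= l%:R * a ^+ 2 * E.
  move=> jl; rewrite traj_sol mulmx0 add0r -sqr_l2norm.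
  have h1 : l2norm (\sum_(0 <= i < j) A ^+ (j - i.+1) *m B *m v i) <=
      a * \sum_(0 <= i < j) l2norm (v i).
    rewrite (le_trans (l2norm_sum _ _))// mulr_sumr ler_sum_nat// => i /andP[_ ij].
    rewrite (le_trans (l2norm_opnorm _ _))// ler_wpM2r ?l2norm_ge0// Ha//.
    by rewrite (leq_ltn_trans _ jl)// leq_subr.
  have s0 : 0 <= \sum_(0 <= i < j) l2norm (v i).
    by rewrite sumr_ge0// => i _; exact: l2norm_ge0.
  apply: (le_trans (y := (a * \sum_(0 <= i < j) l2norm (v i)) ^+ 2)).
    by rewrite ler_pXn2r ?nnegrE ?mulr_ge0 ?l2norm_ge0.
  have -> : l%:R * a ^+ 2 * E = a ^+ 2 * (l%:R * E) by ring.
  rewrite exprMn ler_wpM2l ?sqr_ge0//.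
  rewrite (le_trans (sqr_sum_le _ _))// ler_pM//.
  - by rewrite sumr_ge0// => i _; exact: sqr_ge0.
  - by rewrite ler_nat ltnW.
  rewrite /E (big_cat_nat (leq0n j) (ltnW jl))/=.
  rewrite (eq_bigr (fun i => quad 1%:M (v i))) => [|i _]; last exact: sqr_l2norm.
  by rewrite lerDl sumr_ge0.
apply: (le_trans (y := \sum_(0 <= j < l) l%:R * a ^+ 2 * E)).
  by rewrite ler_sum_nat// => j /andP[_ jl]; exact: bd.
rewrite sumr_const_nat subn0 -[_ *+ l]mulr_natl.
by rewrite exprMn expr2 !mulrA.
Qed.

End Steering.

(** * Existence of the Riccati solution by value iteration *)

Section ValueIteration.
Context {R : realType}.

Lemma cvg_sum_fin (I : Type) (r : seq I) (F : I -> R^nat) (c : I -> R) :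
  (forall i, F i @ \oo --> c i) ->
  (fun k => \sum_(i <- r) F i k) @ \oo --> \sum_(i <- r) c i.
Proof.
move=> H; elim: r => [|i r IH].
  rewrite big_nil (_ : (fun k => _) = cst 0); first exact: cvg_cst.
  by apply/funext => k; rewrite big_nil.
rewrite big_cons (_ : (fun k => _) = (fun k => F i k + \sum_(i <- r) F i k)).
  by apply: cvgD => //; exact: H.
by apply/funext => k; rewrite big_cons.
Qed.

Lemma quad_sumE n (M : 'M[R]_n) x :
  quad M x = \sum_i \sum_j M i j * (x i 0 * x j 0).
Proof.
rewrite /quad mxE exchange_big; apply: eq_bigr => j _ /=; rewrite mxE mulr_suml.
by apply: eq_bigr => i _; rewrite mxE; ring.
Qed.

Lemma quad_entries_le n (M : 'M[R]_n) x :
  quad M x <= (\sum_i \sum_j `|M i j|) * quad 1%:M x.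
Proof.
rewrite quad_sumE mulr_suml ler_sum// => i _; rewrite mulr_suml ler_sum// => j _.
rewrite (le_trans (ler_norm _))// normrM ler_wpM2l//.
have comp k : `|x k 0| <= l2norm x.
  rewrite -(@ler_pXn2r _ 2)// ?nnegrE ?l2norm_ge0// sqr_l2norm quad1.
  rewrite real_normK ?num_real// (bigD1 k)//= lerDl sumr_ge0// => ? _.
  exact: sqr_ge0.
by rewrite -sqr_l2norm expr2 normrM ler_pM.
Qed.

(** Matrix entries are polarized values of the quadratic forms, so pointwise monotone convergence of
    the forms yields convergence of the entries. *)
Lemma psd_matrix_limit n (V : nat -> 'M[R]_n) :
  (forall k, possemidef (V k)) ->
  (forall x, nondecreasing_seq (fun k => quad (V k) x)) ->
  (forall x, exists c, forall k, quad (V k) x <= c) ->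
  exists P : 'M[R]_n, [/\ possemidef P, forall k x, quad (V k) x <= quad P x,
    forall x, (fun k => quad (V k) x) @ \oo --> quad P x &
    (fun k => \sum_i \sum_j `|(P - V k) i j|) @ \oo --> 0].
Proof.
move=> psdV ndV bV.
have cq x : cvgn (fun k => quad (V k) x).
  by apply: nondecreasing_is_cvgn => //; have [c H] := bV x; exists c => _ [k _ <-].
pose e i : 'cV[R]_n := delta_mx i 0.
have pol k i j : V k i j = 2^-1 * (quad (V k) (e i + e j) - quad (V k) (e i) - quad (V k) (e j)).
  by rewrite quadD ?(proj1 (psdV k))// /e bil_delta; field.
have ce i j : cvgn (fun k => V k i j).
  rewrite (_ : (fun k => _) = fun k => 2^-1 * (quad (V k) (e i + e j) - quad (V k) (e i) - quad (V k) (e j))); last first.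
    by apply/funext => k; exact: pol.
  by apply: is_cvgM; [exact: is_cvg_cst|apply: is_cvgB => //; exact: is_cvgB].
pose P := \matrix_(i, j) limn (fun k => V k i j).
have cP i j : (fun k => V k i j) @ \oo --> P i j by rewrite mxE; exact: ce.
have cqP x : (fun k => quad (V k) x) @ \oo --> quad P x.
  rewrite quad_sumE (_ : (fun k => _) = fun k => \sum_i \sum_j V k i j * (x i 0 * x j 0)).
    apply: (cvg_sum_fin (F := fun i k => \sum_j V k i j * (x i 0 * x j 0))) => i.
    apply: (cvg_sum_fin (F := fun j k => V k i j * (x i 0 * x j 0))) => j.
    by apply: cvgM => //; exact: cvg_cst.
  by apply/funext => k; rewrite quad_sumE.
have leP k x : quad (V k) x <= quad P x.
  rewrite -(cvg_lim _ (cqP x))//; exact: (nondecreasing_cvgn_le (ndV x) (cq x)).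
exists P; split=> //.
  split; last by move=> x; apply: le_trans (leP 0%N x); exact: (proj2 (psdV 0%N)).
  apply/matrixP => i j; rewrite !mxE.
  suff -> : (fun k => V k j i) = (fun k => V k i j) by [].
  by apply/funext => k; rewrite -[in LHS](proj1 (psdV k)) mxE.
rewrite -[X in _ --> X](_ : \sum_(i < n) \sum_(j < n) 0 = 0); last first.
  by rewrite big1// => i _; rewrite big1.
apply: (cvg_sum_fin (F := fun i k => \sum_j `|(P - V k) i j|)) => i.
apply: (cvg_sum_fin (F := fun j k => `|(P - V k) i j|)) => j.
rewrite -(normr0 R) -(subrr (P i j)).
rewrite (_ : (fun k => _) = fun k => `|P i j - V k i j|); last first.
  by apply/funext => k; rewrite !mxE.
by apply: cvg_norm; apply: cvgB => //; exact: cvg_cst.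
Qed.

Variables n d : nat.
Variables (A : 'M[R]_n) (B : 'M[R]_(n, d)) (Q : 'M[R]_n) (Rc : 'M[R]_d) (r : R).
Hypotheses (psdQ : possemidef Q) (pR : posdef Rc) (r0 : 0 < r).
Hypothesis rR : forall u, r * quad 1%:M u <= quad Rc u.

(** The optimal cost over [k] steps with zero terminal cost; starting from 0 makes the sequence
    increasing. *)
Fixpoint value_iter (k : nat) : 'M[R]_n :=
  if k is j.+1 then
    closed_loop_cost A B Q Rc (value_iter j) (riccati_gain A B Rc (value_iter j))
  else 0.

Local Notation V := value_iter.
Local Notation G k := (riccati_gain A B Rc (V k)).

Let psdR := posdef_psd pR.

Lemma psd_value_iter k : possemidef (V k).
Proof.
by elim: k => [|k IH]; [exact: psd0|exact: psd_closed_loop_cost].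
Qed.

Lemma value_iter_le k x u :
  quad (V k.+1) x <= quad Q x + quad Rc u + quad (V k) (A *m x + B *m u).
Proof.
have psdV := psd_value_iter k.
rewrite (complete_square Q x u (proj1 pR) (proj1 psdV) (riccati_gain_stationary A B pR psdV)).
by rewrite lerDl; apply: (proj2 (posdef_psd _)); exact: input_hessian_posdef.
Qed.

Lemma value_iter_eq k x : quad (V k.+1) x =
  quad Q x + quad Rc (G k *m x) + quad (V k) (A *m x + B *m (G k *m x)).
Proof.
by rewrite /= /closed_loop_cost !quadDm -!quad_mulmx mulmxDl !mulmxA.
Qed.

Lemma value_iter_mono k x : quad (V k) x <= quad (V k.+1) x.
Proof.
elim: k x => [|k IH] x; first by rewrite quad0m; exact: (proj2 (psd_value_iter 1)).
rewrite [leRHS]value_iter_eq (le_trans (value_iter_le k x (G k.+1 *m x)))//.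
by rewrite lerD2l.
Qed.

Lemma value_iter_traj v x j k : quad (V (j + k)) x <=
  \sum_(0 <= i < j) (quad Q (traj A B v x i) + quad Rc (v i)) + quad (V k) (traj A B v x j).
Proof.
elim: j k => [|j IH] k; first by rewrite big_nil add0r.
rewrite addSnnS (le_trans (IH k.+1))// big_nat_recr//= -addrA lerD2l.
exact: value_iter_le.
Qed.

(** The iterates are bounded by the cost of an input that steers to the origin in l steps, hence
    converge to some P, which by monotonicity is at most its own closed-loop cost. For the converse,
    the greedy inputs stay bounded because [Rc] is coercive, so replacing the iterate by P at the
    states they reach costs an error tending to 0. *)
Lemma lqr_sol_exists l nu : 0 < nu -> gram_controllable l nu A B ->
  exists P K, lqr_sol A B Q Rc P K.
Proof.
move=> nu0 gc.
have nd x : nondecreasing_seq (fun k => quad (V k) x).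
  by apply/nondecreasing_seqP => k; exact: value_iter_mono.
have bd x : exists c, forall k, quad (V k) x <= c.
  have [v [vE _]] := gram_steering (- (A ^+ l *m x)) nu0 gc.
  exists (\sum_(0 <= i < l) (quad Q (traj A B v x i) + quad Rc (v i))) => k.
  apply: (le_trans (nd x k (l + k)%N (leq_addl _ _))).
  rewrite (le_trans (value_iter_traj v x l k))//.
  have -> : traj A B v x l = 0.
    move: vE; rewrite !traj_sol mulmx0 add0r => ->; exact: subrr.
  by rewrite quad0 addr0.
have [P [psdP VP cP eP]] := psd_matrix_limit psd_value_iter nd bd.
exists P, (riccati_gain A B Rc P).
have st := riccati_gain_stationary A B pR psdP; split=> //.
have psdP' := psd_closed_loop_cost A B (riccati_gain A B Rc P) psdQ psdR psdP.
apply: (eq_quad (proj1 psdP) (proj1 psdP')) => x.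
have sq := complete_square Q x _ (proj1 pR) (proj1 psdP) st.
apply/eqP; rewrite eq_le; apply/andP; split.
  rewrite -(cvg_lim _ (cP x))//; apply: limr_le; first by apply/cvg_ex; exists (quad P x).
  apply: nearW => k; apply: (le_trans (value_iter_mono k x)).
  apply: (le_trans (value_iter_le k x (riccati_gain A B Rc P *m x))).
  have := sq (riccati_gain A B Rc P *m x); rewrite subrr quad0 addr0 => <-.
  by rewrite lerD2l VP.
pose e k := \sum_i \sum_j `|(P - V k) i j|.
(* A bound, uniform in [k], on the squared norm of the next state under any input whose cost is at
   most [quad P x]. *)
pose c := (l2norm (A *m x) + opnorm B * Num.sqrt (quad P x / r)) ^+ 2.
have key k : quad (closed_loop_cost A B Q Rc P (riccati_gain A B Rc P)) x <= quad P x + e k * c.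
  set u := G k *m x.
  have h1 : quad (closed_loop_cost A B Q Rc P (riccati_gain A B Rc P)) x <=
      quad Q x + quad Rc u + quad P (A *m x + B *m u).
    by rewrite sq lerDl; apply: (proj2 (posdef_psd _)); exact: input_hessian_posdef.
  apply: (le_trans h1); have := VP k.+1 x; rewrite value_iter_eq -/u => h2.
  have uP : quad Rc u <= quad P x.
    apply: le_trans h2; rewrite addrAC lerDr addr_ge0//; first exact: (proj2 psdQ).
    exact: (proj2 (psd_value_iter k)).
  have ub : l2norm u <= Num.sqrt (quad P x / r).
    rewrite l2normE /pn ler_wsqrtr// ler_pdivlMr// mulrC (le_trans (rR u))//.
  have dP : quad P (A *m x + B *m u) - quad (V k) (A *m x + B *m u) <= e k * c.
    rewrite -quadNm -quadDm (le_trans (quad_entries_le _ _))// ler_wpM2l//.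
      by rewrite sumr_ge0// => i _; rewrite sumr_ge0.
    rewrite -sqr_l2norm ler_pXn2r ?nnegrE ?addr_ge0 ?mulr_ge0 ?l2norm_ge0 ?opnorm_ge0 ?sqrtr_ge0//.
    rewrite (le_trans (l2normD _ _))// lerD2l (le_trans (l2norm_opnorm _ _))//.
    by rewrite ler_wpM2l ?opnorm_ge0.
  by move: h2 dP; lra.
have ck : (fun k => quad P x + e k * c) @ \oo --> quad P x + 0 * c.
  by apply: cvgD; [exact: cvg_cst|apply: cvgM => //; exact: cvg_cst].
move: ck; rewrite mul0r addr0 => ck.
rewrite -[leRHS](cvg_lim _ ck)//; apply: limr_ge; first by apply/cvg_ex; exists (quad P x).
exact: nearW.
Qed.

End ValueIteration.

(** * Decay along the optimal closed loop *)

Section Decay.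
Context {R : realType}.
Variables n d : nat.
Implicit Types (A P L U : 'M[R]_n) (B : 'M[R]_(n, d)) (K : 'M[R]_(d, n)).

Lemma mulmx_powS L j (x : 'cV[R]_n) : L ^+ j.+1 *m x = L *m (L ^+ j *m x).
Proof. by rewrite exprS -mulmxE mulmxA. Qed.

(** The polarized Bellman identity is summed along a trajectory from the origin, where the initial
    pairing with P vanishes. *)
Lemma lqr_sol_adjoint A B Q Rc P K x v l : Q^T = Q -> Rc^T = Rc ->
  lqr_sol A B Q Rc P K -> let L := A + B *m K in
  \sum_(0 <= j < l) (bil Q (L ^+ j *m x) (traj A B v 0 j)
     + bil Rc (K *m (L ^+ j *m x)) (v j))
  + bil P (L ^+ l *m x) (traj A B v 0 l) = 0.
Proof.
move=> sQ sR sol L; elim: l => [|l IH]; first by rewrite big_nil add0r /= bil0r.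
rewrite -[RHS]IH big_nat_recr//= -addrA; congr (_ + _).
by rewrite mulmx_powS [RHS](lqr_sol_bil _ _ (v l) sQ sR sol).
Qed.

Lemma lqr_sol_telescope A B Q Rc P K x l : lqr_sol A B Q Rc P K ->
  let L := A + B *m K in
  \sum_(0 <= j < l) (quad Q (L ^+ j *m x) + quad Rc (K *m (L ^+ j *m x))) =
  quad P x - quad P (L ^+ l *m x).
Proof.
move=> sol L; elim: l => [|l IH]; first by rewrite big_nil expr0 mul1mx subrr.
rewrite big_nat_recr//= IH mulmx_powS; have := lqr_sol_opt (L ^+ l *m x) sol.
by rewrite -/L; lra.
Qed.

Lemma sum_bil_CS (I : Type) (r : seq I) m (M : 'M[R]_n) (N : 'M[R]_m)
    (x y : I -> 'cV[R]_n) (u v : I -> 'cV[R]_m) :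
  possemidef M -> possemidef N ->
  (\sum_(i <- r) (bil M (x i) (y i) + bil N (u i) (v i))) ^+ 2 <=
  (\sum_(i <- r) (quad M (x i) + quad N (u i))) *
  (\sum_(i <- r) (quad M (y i) + quad N (v i))).
Proof.
move=> [sM pM] [sN pN]; apply: discriminant_le => s t.
rewrite !mulr_sumr -!big_split /=; apply: sumr_ge0 => i _.
have := addr_ge0 (pM (s *: x i + t *: y i)) (pN (s *: u i + t *: v i)).
rewrite !quadD// !quadZ !bilZl !bilZr; lra.
Qed.

(* Stationarity turns the cost-to-go at the end of a block into the inner product of
   the optimal block with a manoeuvre that steers to the origin, so Cauchy-Schwarz
   makes it small whenever little cost is paid along the block. *)
Lemma lqr_sol_block_decay A B Q Rc P K l nu b q0 q1 t :
  possemidef Q -> posdef Rc -> lqr_sol A B Q Rc P K ->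
  0 < nu -> gram_controllable l nu A B ->
  0 <= b -> (forall k, (k < l)%N -> opnorm (A ^+ k *m B) <= b) ->
  0 < q0 -> (forall x, q0 * quad 1%:M x <= quad Q x) ->
  (forall x, quad Q x <= q1 * quad 1%:M x) ->
  (forall u, quad Rc u <= q1 * quad 1%:M u) -> 0 <= q1 ->
  0 <= t -> q1 * ((l%:R * b) ^+ 2 + 1) <= 4 * t ^+ 2 * q0 * nu ^+ 2 ->
  forall x, (1 + t) * quad P ((A + B *m K) ^+ l.+1 *m x) <= t * quad P x.
Proof.
move=> psdQ pR sol nu0 gc b0 Hb q00 qQ Qq Rq q10 t0 Ht x.
have psdR := posdef_psd pR; have [psdP _ _] := sol.
set L := A + B *m K; set xl := L ^+ l *m x.
have [v [vE vb]] := gram_steering (- xl) nu0 gc.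
have n1 m (y : 'cV[R]_m) : 0 <= quad 1%:M y by exact: (proj2 (psd1 _)).
set E := \sum_(0 <= i < l) quad 1%:M (v i) in vb.
have E0 : 0 <= E by rewrite /E sumr_ge0.
rewrite quadN in vb.
have pl : quad P xl = \sum_(0 <= j < l) (bil Q (L ^+ j *m x) (traj A B v 0 j)
     + bil Rc (K *m (L ^+ j *m x)) (v j)).
  have := lqr_sol_adjoint x v l (proj1 psdQ) (proj1 pR) sol; cbv zeta.
  by rewrite -/L -/xl vE bilNr -quadE => /eqP; rewrite subr_eq0 => /eqP ->.
have tel := lqr_sol_telescope x l sol; cbv zeta in tel; rewrite -/L -/xl in tel.
have CS := sum_bil_CS (index_iota 0 l) (fun j => L ^+ j *m x) (traj A B v 0)
  (fun j => K *m (L ^+ j *m x)) v psdQ psdR.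
rewrite -pl tel in CS.
have costb : \sum_(0 <= j < l) (quad Q (traj A B v 0 j) + quad Rc (v j)) <=
    q1 * ((l%:R * b) ^+ 2 + 1) * E.
  rewrite big_split /= mulrDr mulr1 mulrDl lerD//.
    apply: (le_trans (y := \sum_(0 <= j < l) q1 * quad 1%:M (traj A B v 0 j))).
      by rewrite ler_sum.
    by rewrite -mulr_sumr -mulrA ler_wpM2l// traj_energy.
  by rewrite /E mulr_sumr ler_sum.
(* One more step of the loop converts the size of [xl], which governs the energy of the manoeuvre,
   into a decrease of P; hence the block length l + 1. *)
have step : q0 * quad 1%:M xl <= quad P xl - quad P (L *m xl).
  have := lqr_sol_opt xl sol; have := (proj2 psdR) (K *m xl); have := qQ xl.
  by rewrite -/L; lra.
rewrite mulmx_powS -/xl.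
move: CS costb step Ht vb; have := (proj2 psdP) x; have := (proj2 psdP) (L *m xl).
have := (proj2 psdP) xl; have := n1 _ xl.
set p0 := quad P x; set pl' := quad P xl; set p2 := quad P (L *m xl).
set c := \sum_(_ <= _ < _) _; set N := quad 1%:M xl; set W := q1 * _.
move=> N0 pl0 p20 p00 CS costb step Ht vb.
have W0 : 0 <= W by rewrite /W mulr_ge0// addr_ge0// sqr_ge0.
have d0 : 0 <= pl' - p2 by apply: le_trans step; rewrite mulr_ge0// ltW.
have tb : 0 <= 4 * t ^+ 2 by rewrite mulr_ge0 ?sqr_ge0.
have c0 : 0 <= c.
  by rewrite /c sumr_ge0// => j _; rewrite addr_ge0 ?(proj2 psdQ) ?(proj2 psdR).
have d1 : 0 <= p0 - pl'.
  by rewrite -tel sumr_ge0// => j _; rewrite addr_ge0 ?(proj2 psdQ) ?(proj2 psdR).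
have h1 : c <= 4 * t ^+ 2 * (pl' - p2).
  apply: (le_trans costb); apply: (le_trans (y := 4 * t ^+ 2 * q0 * nu ^+ 2 * E)).
    by rewrite ler_wpM2r.
  apply: (le_trans (y := 4 * t ^+ 2 * (q0 * N))); last by rewrite ler_wpM2l.
  by rewrite -[_ * nu ^+ 2 * E]mulrA -[_ * q0 * _]mulrA ler_wpM2l// ler_wpM2l// ltW.
(* AM-GM: the two decreases add up to p0 - p2, so four times their product is at most the square of
   p0 - p2. *)
have h2 : pl' ^+ 2 <= (t * (p0 - p2)) ^+ 2.
  apply: (le_trans CS); apply: (le_trans (y := (p0 - pl') * (4 * t ^+ 2 * (pl' - p2)))).
    by rewrite ler_wpM2l.
  have -> : (p0 - pl') * (4 * t ^+ 2 * (pl' - p2)) = t ^+ 2 * (4 * ((p0 - pl') * (pl' - p2))) by ring.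
  rewrite exprMn ler_wpM2l ?sqr_ge0//.
  have := sqr_ge0 ((p0 - pl') - (pl' - p2)).
  have -> : (p0 - p2) ^+ 2 = ((p0 - pl') - (pl' - p2)) ^+ 2 + 4 * ((p0 - pl') * (pl' - p2)) by ring.
  by rewrite lerDr.
have : pl' <= t * (p0 - p2).
  move: h2; rewrite ler_pXn2r// nnegrE// mulr_ge0//; lra.
lra.
Qed.

(** The sum telescopes: U(x) - U(L x) = (1 + t) (P(x) - P(L^(l+1) x)), which is at least P(x) by the
    block decay. *)
Lemma decay_lyapunov P L l t : possemidef P -> 0 <= t ->
  (forall x, quad P (L *m x) <= quad P x) ->
  (forall x, (1 + t) * quad P (L ^+ l.+1 *m x) <= t * quad P x) ->
  exists U : 'M[R]_n, [/\ possemidef U,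
    forall x, quad P x + quad U (L *m x) <= quad U x &
    forall x, quad U x <= l.+1%:R * (1 + t) * quad P x].
Proof.
move=> psdP t0 mono dec.
have t1 : 0 <= 1 + t by rewrite addr_ge0.
pose U := (1 + t) *: \sum_(0 <= j < l.+1) (L ^+ j)^T *m P *m L ^+ j.
have UE x : quad U x = (1 + t) * \sum_(0 <= j < l.+1) quad P (L ^+ j *m x).
  by rewrite /U quadZm quad_sum; congr (_ * _); apply: eq_bigr => j _; rewrite quad_mulmx.
exists U; split=> [|x|x].
- by apply: psdZ => //; apply: psd_sum => j; exact: psd_mulmx.
- rewrite !UE big_nat_recr//= [in leRHS]big_nat_recl//= expr0 mul1mx !mulrDr.
  have -> : \sum_(0 <= j < l) quad P (L ^+ j *m (L *m x)) = \sum_(0 <= j < l) quad P (L ^+ j.+1 *m x).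
    by apply: eq_bigr => j _; rewrite mulmxA mulmxE -exprSr.
  rewrite addrCA [leRHS]addrC lerD2l mulmxA mulmxE -exprSr.
  have := dec x; lra.
rewrite UE mulrAC [leLHS]mulrC ler_wpM2r//.
have mon j : quad P (L ^+ j *m x) <= quad P x.
  elim: j => [|j IH]; first by rewrite expr0 mul1mx.
  by rewrite mulmx_powS (le_trans (mono _)).
apply: (le_trans (y := \sum_(0 <= j < l.+1) quad P x)); first by rewrite ler_sum.
by rewrite sumr_const_nat subn0 mulr_natl.
Qed.

(** The hypothesis on theta says 1 / (1 - theta) <= 1 + t, written without the division; each power
    of theta is repeated at most b times. *)
Lemma sum_block_geometric (theta t : R) b m : 0 <= theta -> (0 < b)%N -> 0 <= t ->
  (1 + t) * theta <= t ->
  \sum_(0 <= k < m) theta ^+ (k %/ b) <= b%:R * (1 + t).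
Proof.
move=> th0 b0 t0 tht; have b00 : 0 <= b%:R :> R by [].
have [k mk] := ubnP m; elim: k m mk => // k IH m mk.
have [mb|bm] := leqP m b.
  apply: (le_trans (y := \sum_(0 <= k < m) 1)).
    rewrite ler_sum_nat// => i /andP[_ im].
    by rewrite divn_small ?expr0// (leq_trans im).
  rewrite sumr_const_nat subn0; apply: (le_trans (y := b%:R)); first by rewrite ler_nat.
  by rewrite mulrDr mulr1 lerDl mulr_ge0.
rewrite (big_cat_nat (n := b))//=; last exact: ltnW.
have -> : \sum_(b <= i < m) theta ^+ (i %/ b) = theta * \sum_(0 <= i < m - b) theta ^+ (i %/ b).
  rewrite -{1}[b]add0n big_addn mulr_sumr; apply: eq_bigr => i _.
  by rewrite divnDr ?dvdnn// divnn b0 addn1 exprS.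
have -> : \sum_(0 <= i < b) theta ^+ (i %/ b) = b%:R.
  rewrite (eq_big_nat _ _ (F2 := fun=> 1)) ?sumr_const_nat ?subn0// => i /andP[_ ib].
  by rewrite divn_small.
have mbk : (m - b < k)%N by rewrite (leq_trans _ (_ : m <= k)%N)// ltn_subrL b0 (ltn_trans b0 bm).
have h := IH _ mbk.
have h2 : theta * \sum_(0 <= i < m - b) theta ^+ (i %/ b) <= theta * (b%:R * (1 + t)).
  by rewrite ler_wpM2l.
have h3 : theta * (b%:R * (1 + t)) <= b%:R * t.
  by rewrite mulrCA ler_wpM2l// mulrC.
rewrite mulrDr mulr1; lra.
Qed.

(** The decay of P read on the dual side: a functional bounded in the P-seminorm has square-summable
    images under the powers of L^T, with a bound that does not involve [tau]. *)
Lemma decay_functional_sum P L l t c g y m : possemidef P -> 0 <= t -> 0 <= c -> 0 <= g ->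
  (forall x, quad P (L *m x) <= quad P x) ->
  (forall x, (1 + t) * quad P (L ^+ l.+1 *m x) <= t * quad P x) ->
  (forall x, bil 1%:M y x ^+ 2 <= c * quad P x) ->
  (forall x, quad P x <= g * quad 1%:M x) ->
  \sum_(0 <= k < m) quad 1%:M ((L ^+ k)^T *m y) <= c * g * (l.+1%:R * (1 + t)).
Proof.
move=> psdP t0 c0 g0 mono dec yP Pg.
have t1 : 0 < 1 + t by rewrite ltr_wpDr.
pose th := t / (1 + t).
have th0 : 0 <= th by rewrite divr_ge0// ltW.
have pw i x : quad P ((L ^+ l.+1) ^+ i *m x) <= th ^+ i * quad P x.
  elim: i => [|i IH]; first by rewrite !expr0 mul1mx mul1r.
  rewrite mulmx_powS [th ^+ _]exprS -mulrA.
  apply: (le_trans (y := th * quad P ((L ^+ l.+1) ^+ i *m x))); last by rewrite ler_wpM2l.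
  by rewrite /th mulrAC ler_pdivlMr// mulrC dec.
have mon i x : quad P (L ^+ i *m x) <= quad P x.
  elim: i => [|i IH]; first by rewrite expr0 mul1mx.
  by rewrite mulmx_powS (le_trans (mono _)).
have pk k x : quad P (L ^+ k *m x) <= th ^+ (k %/ l.+1) * quad P x.
  rewrite {1}(divn_eq k l.+1) addnC exprD mulnC exprM -mulmxE -mulmxA.
  by rewrite (le_trans (mon _ _)).
apply: (le_trans (y := \sum_(0 <= k < m) c * g * th ^+ (k %/ l.+1))).
  rewrite ler_sum// => k _.
  have <- : c * th ^+ (k %/ l.+1) * g = c * g * th ^+ (k %/ l.+1) by rewrite mulrAC.
  apply: (quad_le_functional (P := P)) => //; first by rewrite mulr_ge0 ?exprn_ge0.
  move=> x; have -> : bil 1%:M ((L ^+ k)^T *m y) x = bil 1%:M y (L ^+ k *m x).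
    by rewrite /bil trmx_mul trmxK !mulmx1 mulmxA.
  by rewrite (le_trans (yP _))// -mulrA ler_wpM2l.
rewrite -mulr_sumr ler_wpM2l ?mulr_ge0// sum_block_geometric//.
by rewrite /th mulrC divfK ?gt_eqF.
Qed.

End Decay.

(** * Perturbation of the Riccati equation *)

Section Perturbation.
Context {R : realType}.
Variables n d : nat.
Implicit Types (A P U Q : 'M[R]_n) (B : 'M[R]_(n, d)) (K : 'M[R]_(d, n)) (Rc : 'M[R]_d).

Lemma quad1_ge0 m (x : 'cV[R]_m) : 0 <= quad 1%:M x.
Proof. exact: (proj2 (psd1 _)). Qed.

Lemma add_differences (W : zmodType) (a b c f : W) :
  a + b + ((c - a) + (f - b)) = c + f.
Proof. by rewrite addrACA [a + _]addrC subrK [b + _]addrC subrK. Qed.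

Lemma quad1_opnorm_le m p (M : 'M[R]_(p, m)) e x : opnorm M <= e ->
  quad 1%:M (M *m x) <= e ^+ 2 * quad 1%:M x.
Proof.
move=> Me; have e0 := le_trans (opnorm_ge0 M) Me.
rewrite -!sqr_l2norm -exprMn ler_pXn2r ?nnegrE ?mulr_ge0 ?l2norm_ge0//.
by rewrite (le_trans (l2norm_opnorm _ _))// ler_wpM2r ?l2norm_ge0.
Qed.

Lemma quad1D_le m (x y : 'cV[R]_m) :
  quad 1%:M (x + y) <= 2 * (quad 1%:M x + quad 1%:M y).
Proof.
have := quad1_ge0 (x - y); rewrite !quadD ?trmx1// quadN bilNr; lra.
Qed.

Lemma quadD_young m (Z : 'M[R]_m) x y s : possemidef Z -> 0 < s ->
  quad Z (x + y) <= (1 + s) * quad Z x + (1 + s^-1) * quad Z y.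
Proof.
move=> [sZ pZ] s0; have := pZ (s *: x - y).
rewrite !quadD// quadN quadZ bilNr bilZl => h.
have : 0 <= s^-1 * (s ^+ 2 * quad Z x + 2 * - (s * bil Z x y) + quad Z y).
  by rewrite mulr_ge0// invr_ge0 ltW.
have -> : s^-1 * (s ^+ 2 * quad Z x + 2 * - (s * bil Z x y) + quad Z y) =
  s * quad Z x - 2 * bil Z x y + s^-1 * quad Z y by field; rewrite gt_eqF.
lra.
Qed.

(** The decrease of P is the running cost, which controls state and input at once. The model error
    is thus charged to the dissipation, and no bound on the gain enters. *)
Lemma model_error_le A B Q Rc P K Ah Bh e q0 x : 
  lqr_sol A B Q Rc P K -> 0 <= q0 ->
  (forall x, q0 * quad 1%:M x <= quad Q x) ->
  (forall u, q0 * quad 1%:M u <= quad Rc u) ->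
  opnorm (Ah - A) <= e -> opnorm (Bh - B) <= e ->
  q0 * quad 1%:M ((Ah - A) *m x + (Bh - B) *m (K *m x)) <=
    2 * e ^+ 2 * (quad P x - quad P ((A + B *m K) *m x)).
Proof.
move=> sol q00 qQ qR hA hB.
have e0 := le_trans (opnorm_ge0 _) hA; have := lqr_sol_opt x sol; set u := K *m x => E.
have h1 := quad1_opnorm_le x hA; have h2 := quad1_opnorm_le u hB.
have h3 := quad1D_le ((Ah - A) *m x) ((Bh - B) *m u).
apply: (le_trans (y := q0 * (2 * (e ^+ 2 * quad 1%:M x + e ^+ 2 * quad 1%:M u)))).
  by rewrite ler_wpM2l// (le_trans h3)// ler_pM2l// lerD.
have -> : q0 * (2 * (e ^+ 2 * quad 1%:M x + e ^+ 2 * quad 1%:M u)) =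
  2 * e ^+ 2 * (q0 * quad 1%:M x + q0 * quad 1%:M u) by ring.
rewrite ler_wpM2l ?mulr_ge0 ?sqr_ge0//; have := qQ x; have := qR u; lra.
Qed.

(* The controller [K] of the true system is tested on the perturbed one with the
   dissipation function [(1 + eta / 2) P + (eta / 2 T) U]: the decrease of [U] pays
   for the cross terms created by the model error. *)
Lemma riccati_perturb A B Q Rc P K U Ah Bh Ph Kh e q0 g T eta :
  posdef Rc -> lqr_sol A B Q Rc P K -> lqr_sol Ah Bh Q Rc Ph Kh ->
  possemidef U ->
  (forall x, quad P x + quad U ((A + B *m K) *m x) <= quad U x) ->
  (forall x, quad U x <= T * quad P x) -> 1 <= T ->
  (forall x, quad P x <= g * quad 1%:M x) -> 0 <= g -> 0 < q0 ->
  (forall x, q0 * quad 1%:M x <= quad Q x) ->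
  (forall u, q0 * quad 1%:M u <= quad Rc u) ->
  opnorm (Ah - A) <= e -> opnorm (Bh - B) <= e ->
  0 < eta -> eta <= 1 -> 64 * e ^+ 2 * g * T <= eta ^+ 2 * q0 ->
  forall x, quad Ph x <= (1 + eta) * quad P x.
Proof.
move=> pR sol solh psdU dU UT T1 Pg g0 q00 qQ qR hA hB eta0 eta1 small x.
have [psdP _ _] := sol; have T0 : 0 < T by rewrite (lt_le_trans _ T1).
(* [al * T = eta / 2] keeps [Z] below (1 + eta) P. *)
pose al := eta / (2 * T); pose Z := (1 + eta / 2) *: P + al *: U.
have al0 : 0 < al by rewrite divr_gt0// mulr_gt0.
have alT : al * T = eta / 2 by rewrite /al; field; rewrite gt_eqF.
have psdZ' : possemidef Z.
  apply: psdD; apply: psdZ => //; last exact: ltW.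
  by rewrite addr_ge0// divr_ge0// ltW.
have ZE y : quad Z y = (1 + eta / 2) * quad P y + al * quad U y.
  by rewrite quadDm !quadZm.
have ZP y : quad Z y <= (1 + eta) * quad P y.
  rewrite ZE; have := UT y => /(ler_wpM2l (ltW al0)); rewrite mulrA alT; lra.
apply: le_trans (ZP x).
apply: (lqr_sol_min (K' := K) pR solh q00 qQ psdZ') => y.
set L := A + B *m K; set D := (Ah - A) *m y + (Bh - B) *m (K *m y).
have -> : (Ah + Bh *m K) *m y = L *m y + D.
  rewrite /D /L !mulmxBl !mulmxDl !mulmxA.
  by rewrite add_differences.
have opt := lqr_sol_opt y sol; rewrite -/L in opt.
set c := quad P y - quad P (L *m y).
have c0 : 0 <= c.
  rewrite /c opt addrK addr_ge0// ?(proj2 (posdef_psd pR))//.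
  by apply: le_trans (qQ y); rewrite mulr_ge0 ?quad1_ge0 ?ltW.
have -> : quad Q y + quad Rc (K *m y) = c by rewrite /c opt addrK.
have P0 z := (proj2 psdP) z.
(* Since Z(L y) <= 2 P(y), this Young weight costs at most al P(y), exactly what the decrease of U
   returns. *)
have s0 : 0 < al / 2 by rewrite divr_gt0.
have young := quadD_young (L *m y) D psdZ' s0.
have ZL : quad Z (L *m y) <= (1 + eta / 2) * (quad P y - c) + al * (quad U y - quad P y).
  by rewrite ZE /c subKr lerD2l ler_pM2l// lerBrDl; exact: dU.
have sZL : al / 2 * quad Z (L *m y) <= al * quad P y.
  rewrite -mulrA ler_pM2l//; have := ZP (L *m y); have := P0 (L *m y); have := P0 y.
  by move: c0; rewrite /c; nra.
have Dc : q0 * quad 1%:M D <= 2 * e ^+ 2 * c by exact: model_error_le sol (ltW q00) qQ qR hA hB.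
have ZD : q0 * quad Z D <= 4 * g * e ^+ 2 * c.
  have h1 : quad Z D <= 2 * (g * quad 1%:M D).
    have := ZP D; have := Pg D; have := P0 D; nra.
  apply: (le_trans (y := q0 * (2 * (g * quad 1%:M D)))); first by rewrite ler_pM2l.
  have -> : q0 * (2 * (g * quad 1%:M D)) = 2 * g * (q0 * quad 1%:M D) by ring.
  have -> : 4 * g * e ^+ 2 * c = 2 * g * (2 * e ^+ 2 * c) by ring.
  by rewrite ler_wpM2l// mulr_ge0.
have sV : (al / 2)^-1 = 4 * T / eta by rewrite /al; field; rewrite !gt_eqF.
(* Origin of 64: the factor 8 T / eta times 4 g e^2 / q0 must not exceed eta / 2. *)
have last : (1 + (al / 2)^-1) * quad Z D <= eta / 2 * c.
  have ZD0 := (proj2 psdZ') D.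
  have h1 : (1 + (al / 2)^-1) * quad Z D <= 8 * T / eta * quad Z D.
    rewrite ler_wpM2r// sV; have : 1 <= T / eta by rewrite ler_pdivlMr// mul1r (le_trans eta1).
    by rewrite -!mulrA; lra.
  apply: (le_trans h1); rewrite -(ler_pM2l q00).
  have -> : q0 * (8 * T / eta * quad Z D) = 8 * T / eta * (q0 * quad Z D) by ring.
  apply: (le_trans (y := 8 * T / eta * (4 * g * e ^+ 2 * c))).
    by rewrite ler_wpM2l// divr_ge0 ?mulr_ge0// ltW.
  have -> : 8 * T / eta * (4 * g * e ^+ 2 * c) = (64 * e ^+ 2 * g * T) * (c / (2 * eta)).
    by field; rewrite gt_eqF.
  have -> : q0 * (eta / 2 * c) = (eta ^+ 2 * q0) * (c / (2 * eta)).
    by field; rewrite gt_eqF.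
  by rewrite ler_wpM2r// divr_ge0// mulr_ge0// ltW.
rewrite [leRHS]ZE; lra.
Qed.

(* The error is measured by the true input Hessian, so that the size of [Rc] does not enter. *)
Lemma gain_perturb A B Q Rc P K Ah Bh Ph Kh e q0 g eta x :
  posdef Rc -> lqr_sol A B Q Rc P K -> lqr_sol Ah Bh Q Rc Ph Kh ->
  (forall x, quad P x <= g * quad 1%:M x) -> 0 <= g -> 0 < q0 ->
  (forall x, q0 * quad 1%:M x <= quad Q x) ->
  (forall u, q0 * quad 1%:M u <= quad Rc u) ->
  opnorm (Ah - A) <= e -> opnorm (Bh - B) <= e ->
  0 < eta -> eta <= 2^-1 -> 64 * e ^+ 2 * g <= eta ^+ 2 * q0 ->
  (forall x, `|quad (Ph - P) x| <= eta * quad P x) ->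
  quad (input_hessian B Rc P) ((Kh - K) *m x) <= 36 * eta ^+ 2 * quad P x.
Proof.
move=> pR sol solh Pg g0 q00 qQ qR hA hB eta0 eta1 small dP.
have e0 := le_trans (opnorm_ge0 _) hA; have [psdP st _] := sol; have [psdPh sth _] := solh.
have sR := proj1 pR; have [sP P0] := psdP; have [sPh Ph0] := psdPh.
set z := (Kh - K) *m x; set L := A + B *m K; set Lt := Ah + Bh *m K.
set D := (Ah - A) *m x + (Bh - B) *m (K *m x).
have LtE : Lt *m x = L *m x + D.
  rewrite /D /L !mulmxBl !mulmxDl !mulmxA.
  by rewrite add_differences.
have KhE : Kh *m x = K *m x + z by rewrite /z mulmxBl addrC subrK.
have LhE : (Ah + Bh *m Kh) *m x = Lt *m x + Bh *m z.
  by rewrite /Lt !mulmxDl -!mulmxA KhE mulmxDr addrA.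
have BhE : Bh *m z = B *m z + (Bh - B) *m z by rewrite mulmxBl addrC subrK.
have c1 := stationary_cross x z sR sP st.
have c2 := stationary_cross x z sR sPh sth.
rewrite KhE LhE !bilDl in c2; rewrite -/L in c1.
(* The difference of the two stationarity conditions tested on [z]; each term on the right carries
   [Ph - P], [D] or [Bh - B]. *)
have key : quad (input_hessian Bh Rc Ph) z =
    - bil (Ph - P) (Lt *m x) (Bh *m z) - bil P D (Bh *m z) - bil P (L *m x) ((Bh - B) *m z).
  rewrite /input_hessian quadDm -quad_mulmx bilDm bilNm.
  have e1 : bil P (Lt *m x) (Bh *m z) = bil P (L *m x) (Bh *m z) + bil P D (Bh *m z).
    by rewrite LtE bilDl.
  have e2 : bil P (L *m x) (Bh *m z) = bil P (L *m x) (B *m z) + bil P (L *m x) ((Bh - B) *m z).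
    by rewrite -bilDr -BhE.
  move: c1 c2 e1 e2; rewrite -!quadE; lra.
pose r := pn (input_hessian Bh Rc Ph) z; pose X := pn P x.
have psdM := posdef_psd (input_hessian_posdef Bh pR psdPh).
have r0 : 0 <= r := pn_ge0 _ _; have X0 : 0 <= X := pn_ge0 _ _.
have rE : r ^+ 2 = quad Rc z + quad Ph (Bh *m z).
  by rewrite /r sqr_pn// /input_hessian quadDm -quad_mulmx.
have XE : X ^+ 2 = quad P x by exact: sqr_pn.
have Rz0 : 0 <= quad Rc z by exact: (proj2 (posdef_psd pR)).
have psqr y : pn P y ^+ 2 = quad P y by exact: sqr_pn.
have root (a b : R) : 0 <= a -> 0 <= b -> a ^+ 2 <= b ^+ 2 -> a <= b.
  by move=> a0 b0; rewrite ler_pXn2r ?nnegrE.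
have pLx : pn P (L *m x) <= X.
  apply: root; rewrite ?pn_ge0// psqr XE (lqr_sol_opt x sol) -/L lerDr addr_ge0//.
    by apply: le_trans (qQ x); rewrite mulr_ge0 ?quad1_ge0 ?ltW.
  exact: (proj2 (posdef_psd pR)).
have pD : pn P D <= eta / 5 * X.
  apply: root; rewrite ?pn_ge0 ?mulr_ge0 ?divr_ge0 ?(ltW eta0)// psqr exprMn XE.
  have h1 := Pg D; have h2 := model_error_le x sol (ltW q00) qQ qR hA hB.
  rewrite -/D -/L in h2; have h3 := P0 (L *m x); have h4 := P0 x.
  rewrite -(ler_pM2l q00).
  apply: (le_trans (y := g * (q0 * quad 1%:M D))); first by rewrite mulrCA ler_pM2l.
  apply: (le_trans (y := g * (2 * e ^+ 2 * quad P x))).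
    rewrite ler_wpM2l// (le_trans h2)// ler_wpM2l ?mulr_ge0 ?sqr_ge0// lerBlDr lerDl//.
  have -> : g * (2 * e ^+ 2 * quad P x) = (64 * e ^+ 2 * g) * (quad P x / 32) by field.
  have -> : q0 * ((eta / 5) ^+ 2 * quad P x) = eta ^+ 2 * q0 * (quad P x / 25) by field.
  apply: ler_pM => //; first by rewrite !mulr_ge0 ?sqr_ge0.
    by rewrite divr_ge0.
  by rewrite ler_wpM2l// lef_pV2 ?posrE// ler_nat.
have pdB : pn P ((Bh - B) *m z) <= eta / 8 * r.
  apply: root; rewrite ?pn_ge0 ?mulr_ge0 ?divr_ge0 ?(ltW eta0)// psqr exprMn rE.
  have h1 := Pg ((Bh - B) *m z); have h2 := quad1_opnorm_le z hB; have h3 := qR z.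
  rewrite -(ler_pM2l q00).
  apply: (le_trans (y := q0 * (g * (e ^+ 2 * quad 1%:M z)))).
    by rewrite ler_pM2l// (le_trans h1)// ler_wpM2l.
  have -> : q0 * (g * (e ^+ 2 * quad 1%:M z)) = (64 * e ^+ 2 * g) * (q0 * quad 1%:M z / 64) by field.
  have -> : q0 * ((eta / 8) ^+ 2 * (quad Rc z + quad Ph (Bh *m z))) =
    eta ^+ 2 * q0 * ((quad Rc z + quad Ph (Bh *m z)) / 64) by field.
  apply: ler_pM => //; first by rewrite !mulr_ge0 ?sqr_ge0.
    by rewrite divr_ge0// mulr_ge0 ?quad1_ge0 ?ltW.
  by rewrite ler_wpM2r// (le_trans h3)// lerDl.
(* From eta <= 1/2, P is at most 2 Ph on this vector, and sqrt 2 < 3/2. *)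
have pBh : pn P (Bh *m z) <= 3 / 2 * r.
  apply: root; rewrite ?pn_ge0 ?mulr_ge0// psqr exprMn rE.
  have := dP (Bh *m z); rewrite ler_norml quadDm quadNm => /andP[h1 _].
  have := P0 (Bh *m z); nra.
have pLt : pn P (Lt *m x) <= 11 / 10 * X.
  rewrite LtE (le_trans (pn_triangle _ _ psdP))//.
  have : eta / 5 * X <= 1 / 10 * X by rewrite ler_wpM2r//; lra.
  lra.
have sd : (Ph - P)^T = Ph - P by rewrite linearB /= sPh sP.
have b1 := quad_bounded_form (Lt *m x) (Bh *m z) psdP sd (ltW eta0) dP.
have b2 := bil_le_pn D (Bh *m z) psdP.
have b3 := bil_le_pn (L *m x) ((Bh - B) *m z) psdP.
have n0 y := pn_ge0 P y.
have b1' : `|bil (Ph - P) (Lt *m x) (Bh *m z)| <= eta * (11 / 10 * X * (3 / 2 * r)).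
  by apply: (le_trans b1); rewrite ler_wpM2l ?(ltW eta0)// ler_pM.
have b2' : `|bil P D (Bh *m z)| <= eta / 5 * X * (3 / 2 * r).
  by apply: (le_trans b2); rewrite ler_pM.
have b3' : `|bil P (L *m x) ((Bh - B) *m z)| <= X * (eta / 8 * r).
  by apply: (le_trans b3); rewrite ler_pM.
have rr : r ^+ 2 <= 3 * eta * X * r.
  have -> : r ^+ 2 = quad (input_hessian Bh Rc Ph) z by rewrite /r sqr_pn.
  rewrite key; move: b1' b2' b3'; rewrite !ler_norml => /andP[h1 _] /andP[h2 _] /andP[h3 _].
  have : 0 <= eta * X * r by rewrite !mulr_ge0// ltW.
  move: h1 h2 h3; rewrite (_ : eta * (11 / 10 * X * (3 / 2 * r)) = 33 / 20 * (eta * X * r)); last by field.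
  rewrite (_ : eta / 5 * X * (3 / 2 * r) = 3 / 10 * (eta * X * r)); last by field.
  rewrite (_ : X * (eta / 8 * r) = 1 / 8 * (eta * X * r)); last by field.
  rewrite (_ : 3 * eta * X * r = 3 * (eta * X * r)); last by ring.
  lra.
have rX : r <= 3 * eta * X.
  move: r0; rewrite le_eqVlt => /orP[/eqP <-|r0]; first by rewrite !mulr_ge0// ltW.
  by rewrite -(ler_pM2r r0) -expr2.
have BzE : B *m z = Bh *m z + - ((Bh - B) *m z) by rewrite BhE addrK.
have pBz : pn P (B *m z) <= 8 / 5 * r.
  rewrite BzE (le_trans (pn_triangle _ _ psdP))// pnN.
  have : eta / 8 * r <= 1 / 10 * r by rewrite ler_wpM2r//; lra.
  lra.
have Ph1 : 0 <= quad Ph (Bh *m z) by exact: Ph0.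
have PB : quad P (B *m z) <= (8 / 5 * r) ^+ 2.
  by rewrite -psqr ler_pXn2r ?nnegrE ?mulr_ge0.
have r2 : r ^+ 2 <= (3 * eta * X) ^+ 2.
  by rewrite ler_pXn2r ?nnegrE// !mulr_ge0// ltW.
rewrite /input_hessian quadDm -quad_mulmx -XE.
(* 36 = 4 * 3^2: the costs of [z] and of [B *m z] are at most r^2 and (8/5)^2 r^2, and 1 + 64/25 <
   4. *)
have -> : 36 * eta ^+ 2 * X ^+ 2 = 4 * (3 * eta * X) ^+ 2 by ring.
move: PB; rewrite exprMn; lra.
Qed.

End Perturbation.

Section Cholesky.
Context {R : realType}.

Lemma quad_col_mx m1 m2 (a : 'M[R]_m1) (b : 'M[R]_(m2, m1)) (c : 'M[R]_m2)
    (x : 'cV[R]_m1) (y : 'cV[R]_m2) :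
  quad (block_mx a b^T b c) (col_mx x y) = quad a x + 2 * bil b y x + quad c y.
Proof.
have E (X Y : 'M[R]_1) : (X + Y) 0 0 = X 0 0 + Y 0 0 by rewrite mxE.
rewrite /quad tr_col_mx mul_row_block mul_row_col !mulmxDl !E.
have -> : (x^T *m b^T *m y) 0 0 = bil b y x by rewrite -[LHS]/(bil b^T x y) bil_tr.
rewrite /bil; ring.
Qed.

(** Induction on the Schur complement of the top left entry. The factor serves to write the trace
    against the input Hessian as a sum over d functionals. *)
Lemma posdef_cholesky m (M : 'M[R]_m) : posdef M -> exists N : 'M[R]_m, M = N^T *m N.
Proof.
elim: m M => [|m IH]; first by move=> M _; exists 0; apply/matrixP => -[].
rewrite -[m.+1]/(1 + m)%N => M [sM pM].
pose a : 'M[R]_1 := ulsubmx M; pose b : 'M[R]_(m, 1) := dlsubmx M.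
pose c : 'M[R]_m := drsubmx M.
have ME : M = block_mx a b^T b c.
  rewrite -[LHS]submxK; congr block_mx.
  by rewrite /b trmx_dlsub sM.
have sc : c^T = c by rewrite /c trmx_drsub sM.
pose al := a 0 0.
have aE : a = al%:M by rewrite [LHS]mx11_scalar.
have quada (s : R) : quad a (s%:M : 'cV[R]_1) = al * s ^+ 2.
  by rewrite /quad aE tr_scalar_mx -!scalar_mxM !mxE eqxx mulr1n; ring.
have al0 : 0 < al.
  have := pM (col_mx (1%:M : 'cV[R]_1) 0); rewrite ME quad_col_mx bil0l quad0 quada expr1n mulr1 mulr0 !addr0.
  apply; apply/eqP => /(congr1 usubmx); rewrite col_mxKu => /matrixP/(_ 0 0)/eqP.
  by rewrite linear0 !mxE eqxx oner_eq0.
pose S := c - al^-1 *: (b *m b^T).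
have pS : posdef S.
  split; first by rewrite /S linearB linearZ /= trmx_mul trmxK sc.
  (* [s] minimizes the form of [M] over the first coordinate, where its value is the Schur
     complement at [y]. *)
  move=> y y0; pose s := - (bil b y 1%:M / al).
  have := pM (col_mx (s%:M : 'cV[R]_1) y); rewrite ME quad_col_mx quada.
  have -> : bil b y (s%:M : 'cV[R]_1) = s * bil b y 1%:M.
    by rewrite -bilZr scalemx1.
  have bb : quad (b *m b^T) y = bil b y 1%:M ^+ 2.
    rewrite /quad /bil mulmx1; set r := y^T *m b.
    have -> : y^T *m (b *m b^T) *m y = r *m r^T by rewrite /r trmx_mul trmxK !mulmxA.
    by rewrite mxE big_ord1 [r^T _ _]mxE expr2.
  rewrite /S quadDm quadNm quadZm bb /s => h; have := h _; move: h => _ h.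
  have -> : quad c y - al^-1 * bil b y 1%:M ^+ 2 = al * (- (bil b y 1%:M / al)) ^+ 2 +
    2 * (- (bil b y 1%:M / al) * bil b y 1%:M) + quad c y by field; rewrite gt_eqF.
  apply: h; apply: contraNneq y0 => /(congr1 dsubmx); rewrite col_mxKd linear0 => ->.
  by [].
have [N NE] := IH S pS.
exists (block_mx (Num.sqrt al)%:M ((Num.sqrt al)^-1 *: b^T) 0 N : 'M[R]_(1 + m)).
have sq : Num.sqrt al * Num.sqrt al = al by rewrite -expr2 sqr_sqrtr// ltW.
have sq0 : Num.sqrt al != 0 by rewrite gt_eqF// sqrtr_gt0.
rewrite [LHS]ME tr_block_mx mulmx_block trmx0 !mulmx0 !mul0mx !addr0.
have tb : ((Num.sqrt al)^-1 *: b^T)^T = (Num.sqrt al)^-1 *: b by rewrite linearZ /= trmxK.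
rewrite tr_scalar_mx -scalar_mxM sq -aE tb mul_scalar_mx mul_mx_scalar.
rewrite !scalerA mulfV// !scale1r -scalemxAl -scalemxAr scalerA.
by rewrite -invfM sq -NE /S addrC subrK.
Qed.

End Cholesky.

(** * Stability under a change of gain *)

Section ClosedLoopStability.
Context {R : realType}.

Lemma geometric_sum_le (x : R) m : 0 <= x -> x < 1 ->
  \sum_(0 <= k < m) x ^+ k <= (1 - x)^-1.
Proof.
move=> x0 x1; have d0 : 0 < 1 - x by rewrite subr_gt0.
rewrite -[leRHS]mul1r ler_pdivlMr//.
have -> : (\sum_(0 <= k < m) x ^+ k) * (1 - x) = 1 - x ^+ m.
  elim: m => [|m IH]; first by rewrite big_nil mul0r expr0 subrr.
  by rewrite big_nat_recr//= mulrDl IH exprSr; ring.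
by rewrite gerBl exprn_ge0.
Qed.

Lemma geometric_small (x c e : R) : 0 <= x -> x < 1 -> 0 < e ->
  exists m, c * x ^+ m <= e.
Proof.
move=> x0 x1 e0.
have : (fun m => c * x ^+ m) @ \oo --> c * 0.
  by apply: cvgM; [exact: cvg_cst|apply: cvg_expr; rewrite ger0_norm].
rewrite mulr0 => /cvgr_le/(_ e e0)[m _ H].
by exists m; apply: H => /=.
Qed.

Lemma quad1_tr_opnorm_le m p (M : 'M[R]_(p, m)) e x : opnorm M <= e ->
  quad 1%:M (M^T *m x) <= e ^+ 2 * quad 1%:M x.
Proof.
move=> Me; have e0 := le_trans (opnorm_ge0 M) Me.
rewrite -!sqr_l2norm -exprMn ler_pXn2r ?nnegrE ?mulr_ge0 ?l2norm_ge0//.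
by rewrite (le_trans (l2norm_opnorm_tr _ _))// ler_wpM2r ?l2norm_ge0.
Qed.

Variables n d : nat.
Variables (A P : 'M[R]_n) (B : 'M[R]_(n, d)) (K Kh : 'M[R]_(d, n)) (M : 'M[R]_d).
Variables (l : nat) (t g eta b tau0 gam : R).
Let L := A + B *m K.
Let Lh := A + B *m Kh.
Let W := tau0 ^+ 2 / (1 - gam ^+ 2).
Hypotheses (psdP : possemidef P) (t0 : 0 <= t) (g0 : 0 <= g).
Hypothesis mono : forall x, quad P (L *m x) <= quad P x.
Hypothesis dec : forall x, (1 + t) * quad P (L ^+ l.+1 *m x) <= t * quad P x.
Hypothesis Pg : forall x, quad P x <= g * quad 1%:M x.
Hypothesis M1 : forall u, quad 1%:M u <= quad M u.
Hypothesis gain : forall x, quad M ((Kh - K) *m x) <= 36 * eta ^+ 2 * quad P x.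
Hypothesis Bb : opnorm B <= b.
Hypotheses (gam0 : 0 <= gam) (gam1 : gam < 1) (tau1 : 1 <= tau0).
Hypothesis Ltau : forall k, opnorm (L ^+ k) <= tau0 * gam ^+ k.
Hypothesis small :
  W * (b ^+ 2 * (36 * eta ^+ 2) * g * (l.+1%:R * (1 + t))) <= 100^-1.

Let gam2 : gam ^+ 2 < 1.
Proof. by rewrite expr_lt1. Qed.

Let W1 : 1 <= W.
Proof.
rewrite /W ler_pdivlMr ?subr_gt0// mul1r.
have : 1 <= tau0 ^+ 2 by rewrite exprn_ege1.
have := sqr_ge0 gam; lra.
Qed.

(* A partial sum of [L^k (L^k)^T] is a Lyapunov function for [L^T], and the decay of [P]
   along [L] makes it insensitive to the change of gain. *)
Lemma perturbed_gram_sum N z :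
  \sum_(0 <= k < N) quad 1%:M ((Lh ^+ k)^T *m z) <= 2 * W * quad 1%:M z.
Proof.
(* The truncation makes the last term of the telescoped sum at most |y|^2 / 4, so [S] still loses
   3/4 of |y|^2 along L^T. *)
have [m Hm] : exists m, tau0 ^+ 2 * (gam ^+ 2) ^+ m <= 4^-1.
  by apply: geometric_small; rewrite ?sqr_ge0.
pose S : 'M[R]_n := \sum_(0 <= k < m) L ^+ k *m (L ^+ k)^T.
have SE y : quad S y = \sum_(0 <= k < m) quad 1%:M ((L ^+ k)^T *m y).
  by rewrite /S quad_sum; apply: eq_bigr => k _; rewrite quad_mulmx trmxK mulmx1.
have psdS : possemidef S.
  apply: psd_sum => k; have := psd_mulmx (L ^+ k)^T (psd1 n).
  by rewrite trmxK mulmx1.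
have pw k y : quad 1%:M ((L ^+ k)^T *m y) <= tau0 ^+ 2 * (gam ^+ 2) ^+ k * quad 1%:M y.
  by rewrite (le_trans (quad1_tr_opnorm_le _ (Ltau k)))// exprMn -!exprM mulnC.
have SW y : quad S y <= W * quad 1%:M y.
  rewrite SE; apply: (le_trans (y := \sum_(0 <= k < m) tau0 ^+ 2 * quad 1%:M y * (gam ^+ 2) ^+ k)).
    by rewrite ler_sum// => k _; rewrite mulrAC.
  rewrite -mulr_sumr.
  have -> : W * quad 1%:M y = tau0 ^+ 2 * quad 1%:M y * (1 - gam ^+ 2)^-1 by rewrite /W mulrAC.
  apply: ler_wpM2l; first by apply: mulr_ge0; [exact: sqr_ge0|exact: quad1_ge0].
  by apply: geometric_sum_le => //; exact: sqr_ge0.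
have SL y : quad S (L^T *m y) <= quad S y - 3 / 4 * quad 1%:M y.
  have -> : quad S (L^T *m y) = quad S y - quad 1%:M y + quad 1%:M ((L ^+ m)^T *m y).
    rewrite !SE; apply/eqP; rewrite eq_sym addrAC subr_eq; apply/eqP.
    rewrite -(big_nat_recr m 0 (fun k => quad 1%:M ((L ^+ k)^T *m y)))//=.
    rewrite big_nat_recl//= expr0 trmx1 mul1mx addrC; congr (_ + _).
    by apply: eq_bigr => k _; rewrite mulmxA -trmx_mul mulmxE -exprS.
  have := pw m y; have := ler_wpM2r (quad1_ge0 y) Hm; lra.
pose chi := b ^+ 2 * (36 * eta ^+ 2) * g * (l.+1%:R * (1 + t)).
have e0 : 0 <= 36 * eta ^+ 2 by rewrite mulr_ge0// sqr_ge0.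
(* The gain error is summed through the decay of P, not through [S <= W]; this avoids a second
   factor [W]. *)
have SE2 y : quad S ((Kh - K)^T *m (B^T *m y)) <= chi * quad 1%:M y.
  rewrite SE; set w := B^T *m y; set c := quad 1%:M w * (36 * eta ^+ 2).
  have c0 : 0 <= c by rewrite mulr_ge0 ?quad1_ge0.
  apply: (le_trans (y := c * g * (l.+1%:R * (1 + t)))).
    apply: (decay_functional_sum (P := P)) => // x.
    have -> : bil 1%:M ((Kh - K)^T *m w) x = bil 1%:M w ((Kh - K) *m x).
      by rewrite /bil trmx_mul trmxK !mulmx1 mulmxA.
    apply: (le_trans (bil_CS _ _ (psd1 _))).
    have -> : c * quad P x = quad 1%:M w * (36 * eta ^+ 2 * quad P x) by rewrite /c; ring.
    by apply: ler_wpM2l; [exact: quad1_ge0|exact: le_trans (M1 _) (gain _)].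
  have -> : chi * quad 1%:M y = (b ^+ 2 * quad 1%:M y) * (36 * eta ^+ 2) * g * (l.+1%:R * (1 + t)).
    by rewrite /chi; ring.
  rewrite ler_wpM2r ?mulr_ge0 ?addr_ge0// ler_wpM2r// ler_wpM2r//.
  exact: quad1_tr_opnorm_le.
have W0 : 0 < W by rewrite (lt_le_trans _ W1).
have chi0 : 0 <= chi.
  exact: (mulr_ge0 (mulr_ge0 (mulr_ge0 (sqr_ge0 _) e0) g0)
    (mulr_ge0 (ler0n _ _) (addr_ge0 ler01 t0))).
have step y : quad S (Lh^T *m y) <= quad S y - 2^-1 * quad 1%:M y.
  have -> : Lh^T *m y = L^T *m y + (Kh - K)^T *m (B^T *m y).
    rewrite mulmxA -trmx_mul -mulmxDl -linearD /=; congr (_^T *m _).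
    by rewrite /Lh /L mulmxBr -addrA [B *m K + _]addrC subrK.
  (* As [S <= W], this weight costs |y|^2 / 8, and its inverse turns the gain error into at most
     9/100 of |y|^2: 3/4 - 1/8 - 9/100 exceeds 1/2. *)
  have s0 : 0 < (8 * W)^-1 by rewrite invr_gt0 mulr_gt0.
  have := quadD_young (L^T *m y) ((Kh - K)^T *m (B^T *m y)) psdS s0.
  rewrite invrK; have h1 := SL y; have h2 := SE2 y; have h3 := SW y.
  have q0 := quad1_ge0 y.
  have h4 : (8 * W)^-1 * quad S (L^T *m y) <= 8^-1 * quad 1%:M y.
    rewrite invfM -mulrA ler_pM2l ?invr_gt0// ler_pdivrMl//.
    by apply: le_trans h3; apply: (le_trans h1); rewrite gerBl mulr_ge0.
  have h5 : (1 + 8 * W) * quad S ((Kh - K)^T *m (B^T *m y)) <= 9 / 100 * quad 1%:M y.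
    apply: (le_trans (y := (1 + 8 * W) * (chi * quad 1%:M y))).
      by rewrite ler_wpM2l// addr_ge0// mulr_ge0// ltW.
    rewrite mulrA ler_wpM2r//; have : chi <= W * chi by rewrite ler_peMl.
    by move: small; rewrite -/chi; lra.
  lra.
pose zz k := (Lh ^+ k)^T *m z.
have zS k : zz k.+1 = Lh^T *m zz k by rewrite /zz exprSr -mulmxE trmx_mul mulmxA.
have tel : 2^-1 * \sum_(0 <= k < N) quad 1%:M (zz k) <= quad S (zz 0%N) - quad S (zz N).
  elim: N => [|N IH]; first by rewrite big_nil mulr0 subrr.
  rewrite big_nat_recr//= mulrDr; have := step (zz N); rewrite -zS; lra.
have := (proj2 psdS) (zz N); have := SW (zz 0%N).
rewrite {2}/zz expr0 trmx1 mul1mx.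
by move: tel; rewrite /zz; lra.
Qed.

Lemma tr_gramE m p (X : 'M[R]_(m, p)) :
  \tr (X *m X^T) = \sum_i quad 1%:M (X^T *m delta_mx i (0 : 'I_1)).
Proof.
rewrite /mxtrace; apply: eq_bigr => i _.
by rewrite quad_mulmx trmxK mulmx1 quadE bil_delta.
Qed.

Lemma perturbed_trace_sum N :
  \sum_(0 <= k < N) \tr (power_gram Lh k) <= 2 * W * n%:R.
Proof.
under eq_bigr do rewrite /power_gram tr_gramE.
rewrite exchange_big /= mulr_natr -[n in leRHS]card_ord -sumr_const ler_sum// => i _.
rewrite (le_trans (perturbed_gram_sum N _))//.
by rewrite quadE bil_delta mxE eqxx mulr1.
Qed.

(** With M = C^T C the trace is a sum over the d rows of C (Kh - K). Each row is a functional with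
    square at most 36 eta^2 P, so [perturbed_gram_sum] applies to each of them. *)
Lemma perturbed_cost_sum N : posdef M ->
  \sum_(0 <= k < N) \tr ((Kh - K)^T *m M *m (Kh - K) *m power_gram Lh k) <=
  d%:R * (2 * W * (36 * eta ^+ 2 * g)).
Proof.
move=> /posdef_cholesky[C CE].
have e0 : 0 <= 36 * eta ^+ 2 by rewrite mulr_ge0// sqr_ge0.
pose G := C *m (Kh - K).
have trE k : \tr ((Kh - K)^T *m M *m (Kh - K) *m power_gram Lh k) =
    \sum_i quad 1%:M ((Lh ^+ k)^T *m (G^T *m delta_mx i (0 : 'I_1))).
  have -> : (Kh - K)^T *m M *m (Kh - K) = G^T *m G by rewrite CE /G trmx_mul !mulmxA.
  rewrite /power_gram -mulmxA mxtrace_mulC.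
  have -> : G *m (Lh ^+ k *m (Lh ^+ k)^T) *m G^T = (G *m Lh ^+ k) *m (G *m Lh ^+ k)^T.
    by rewrite [(G *m _)^T]trmx_mul !mulmxA.
  by rewrite tr_gramE; apply: eq_bigr => i _; rewrite [(G *m _)^T]trmx_mul mulmxA.
under eq_bigr do rewrite trE.
rewrite exchange_big /= mulrC mulr_natr -[d in leRHS]card_ord -sumr_const ler_sum// => i _.
rewrite (le_trans (perturbed_gram_sum N _))// ler_wpM2l//.
  by rewrite mulr_ge0// (le_trans _ W1).
apply: (quad_le_functional (P := P)) => // x.
have -> : bil 1%:M (G^T *m delta_mx i (0 : 'I_1)) x = bil 1%:M (delta_mx i 0) (G *m x).
  by rewrite /bil trmx_mul trmxK !mulmx1 mulmxA.
apply: (le_trans (bil_CS _ _ (psd1 _))).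
rewrite quadE bil_delta mxE eqxx mul1r (le_trans _ (gain x))//.
have -> : G *m x = C *m ((Kh - K) *m x) by rewrite mulmxA.
by rewrite quad_mulmx mulmx1 -CE.
Qed.

End ClosedLoopStability.

(** * Powers and controllability of the estimated system *)

Section EstimatedSystem.
Context {R : realType}.
Variables n d : nat.
Variables (A Ah : 'M[R]_n) (B Bh : 'M[R]_(n, d)) (ta rho be eps g : R).
Hypotheses (ta1 : 1 <= ta) (rho0 : 0 <= rho) (be1 : 1 <= be) (eps0 : 0 <= eps).
Hypothesis bee : eps * ta + rho <= be.
Hypothesis Ata : forall k, opnorm (A ^+ k) <= ta * rho ^+ k.
Hypotheses (hA : opnorm (Ah - A) <= eps) (hB : opnorm (Bh - B) <= eps).
Hypotheses (Bg : opnorm B <= g) (g1 : 1 <= g) (eps1 : eps <= 1).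

Let ta0 : 0 <= ta. Proof. exact: le_trans ta1. Qed.
Let be0 : 0 <= be. Proof. exact: le_trans be1. Qed.
Let rhobe : rho <= be. Proof. by rewrite (le_trans _ bee)// lerDr mulr_ge0. Qed.

(** Keeping a power of A in front makes the induction close with a single constant [ta]: splitting
    the leftmost Ah as A + (Ah - A) contributes rho from the first term and eps ta from the
    second. *)
Lemma mixed_power_le m j : opnorm (A ^+ m *m Ah ^+ j) <= ta * rho ^+ m * be ^+ j.
Proof.
elim: j m => [|j IH] m; first by rewrite !expr0 mulmx1 mulr1.
have -> : A ^+ m *m Ah ^+ j.+1 = A ^+ m.+1 *m Ah ^+ j + A ^+ m *m ((Ah - A) *m Ah ^+ j).
  by rewrite mulmxBl mulmxBr exprS exprSr -!mulmxE !mulmxA addrC subrK.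
rewrite (le_trans (opnormD _ _))//.
have h2 : opnorm (A ^+ m *m ((Ah - A) *m Ah ^+ j)) <= ta * rho ^+ m * (eps * (ta * be ^+ j)).
  rewrite (le_trans (opnormM _ _))// ler_pM ?opnorm_ge0//.
  rewrite (le_trans (opnormM _ _))// ler_pM ?opnorm_ge0//.
  by have := IH 0%N; rewrite !expr0 mul1mx mulr1.
rewrite (le_trans (lerD (IH m.+1) h2))//.
have -> : ta * rho ^+ m.+1 * be ^+ j + ta * rho ^+ m * (eps * (ta * be ^+ j)) =
  ta * rho ^+ m * be ^+ j * (eps * ta + rho) by rewrite [rho ^+ _]exprSr; ring.
rewrite exprSr mulrA ler_wpM2l// mulr_ge0 ?exprn_ge0//.
by rewrite mulr_ge0 ?exprn_ge0.
Qed.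

Lemma est_power_le j : opnorm (Ah ^+ j) <= ta * be ^+ j.
Proof. by have := mixed_power_le 0 j; rewrite expr0 mul1mx mulr1. Qed.

Lemma mixed_power_diff_le m j :
  opnorm (A ^+ m *m (Ah ^+ j - A ^+ j)) <= j%:R * eps * ta ^+ 2 * rho ^+ m * be ^+ j.
Proof.
elim: j m => [|j IH] m.
  rewrite !expr0 subrr mulmx0 !mul0r; apply: opnorm_le => // x.
  by rewrite mul0mx l2norm0 mul0r.
have -> : A ^+ m *m (Ah ^+ j.+1 - A ^+ j.+1) =
    A ^+ m.+1 *m (Ah ^+ j - A ^+ j) + A ^+ m *m ((Ah - A) *m Ah ^+ j).
  rewrite [A ^+ m.+1]exprSr !exprS -!mulmxE -mulmxA -mulmxDr; congr (_ *m _).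
  by rewrite mulmxBr mulmxBl [RHS]addrC addrA subrK.
rewrite (le_trans (opnormD _ _))//.
have h2 : opnorm (A ^+ m *m ((Ah - A) *m Ah ^+ j)) <= ta * rho ^+ m * (eps * (ta * be ^+ j)).
  rewrite (le_trans (opnormM _ _))// ler_pM ?opnorm_ge0//.
  by rewrite (le_trans (opnormM _ _))// ler_pM ?opnorm_ge0// est_power_le.
rewrite (le_trans (lerD (IH m.+1) h2))//.
set c := eps * ta ^+ 2 * rho ^+ m * be ^+ j.
have c0 : 0 <= c.
  exact: (mulr_ge0 (mulr_ge0 (mulr_ge0 eps0 (sqr_ge0 _)) (exprn_ge0 _ rho0)) (exprn_ge0 _ be0)).
have -> : j%:R * eps * ta ^+ 2 * rho ^+ m.+1 * be ^+ j + ta * rho ^+ m * (eps * (ta * be ^+ j))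
  = j%:R * c * rho + c * 1 by rewrite /c [rho ^+ _.+1]exprSr; ring.
have -> : j.+1%:R * eps * ta ^+ 2 * rho ^+ m * be ^+ j.+1 = j%:R * c * be + c * be.
  by rewrite /c [be ^+ _.+1]exprSr -natr1; ring.
by rewrite lerD// ler_wpM2l// mulr_ge0.
Qed.

Lemma power_input_le l k : (k < l)%N -> opnorm (A ^+ k *m B) <= ta * be ^+ (l - 1) * g.
Proof.
move=> kl; rewrite (le_trans (opnormM _ _))// ler_pM ?opnorm_ge0//.
rewrite (le_trans (Ata k))// ler_wpM2l// (le_trans (y := be ^+ k))//.
  by rewrite lerXn2r// nnegrE.
by rewrite ler_weXn2l//; move: kl; case: l => // l; rewrite subn1.
Qed.

Lemma est_power_input_le l k : (k < l)%N ->
  opnorm (Ah ^+ k *m Bh) <= ta * be ^+ (l - 1) * (2 * g).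
Proof.
move=> kl; rewrite (le_trans (opnormM _ _))// ler_pM ?opnorm_ge0//.
  rewrite (le_trans (est_power_le k))// ler_wpM2l// ler_weXn2l//.
  by move: kl; case: l => // l; rewrite subn1.
rewrite -[Bh](subrK B) (le_trans (opnormD _ _))//.
by move: hB Bg g1 eps1; lra.
Qed.

Lemma input_diff_le l k : (k < l)%N ->
  opnorm (Ah ^+ k *m Bh - A ^+ k *m B) <= 2 * l%:R * g * eps * ta ^+ 2 * be ^+ (l - 1).
Proof.
move=> kl; have kl1 : (k <= l - 1)%N by move: kl; case: l => // l; rewrite subn1.
have -> : Ah ^+ k *m Bh - A ^+ k *m B = (Ah ^+ k - A ^+ k) *m Bh + A ^+ k *m (Bh - B).
  by rewrite mulmxBl mulmxBr addrA subrK.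
rewrite (le_trans (opnormD _ _))//.
set c := eps * ta ^+ 2 * be ^+ (l - 1).
have c0 : 0 <= c.
  by apply: mulr_ge0; [apply: mulr_ge0 => //; exact: sqr_ge0|rewrite exprn_ge0].
have bek : be ^+ k <= be ^+ (l - 1) by rewrite ler_weXn2l.
have h1 : opnorm ((Ah ^+ k - A ^+ k) *m Bh) <= k%:R * c * (2 * g).
  rewrite (le_trans (opnormM _ _))// ler_pM ?opnorm_ge0//.
    have := mixed_power_diff_le 0 k; rewrite expr0 mul1mx mulr1 => /le_trans; apply.
    have -> : k%:R * c = k%:R * eps * ta ^+ 2 * be ^+ (l - 1) by rewrite /c; ring.
    apply: ler_wpM2l => //; apply: mulr_ge0 (sqr_ge0 _); exact: mulr_ge0.
  rewrite -[Bh](subrK B) (le_trans (opnormD _ _))//.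
  by move: hB Bg g1 eps1; lra.
have h2 : opnorm (A ^+ k *m (Bh - B)) <= c * g.
  rewrite (le_trans (opnormM _ _))// (le_trans (y := (ta * be ^+ (l - 1)) * eps))//.
    rewrite ler_pM ?opnorm_ge0// (le_trans (Ata k))// ler_wpM2l// (le_trans _ bek)//.
    by rewrite lerXn2r// nnegrE.
  have -> : c * g = ta * be ^+ (l - 1) * eps * (ta * g) by rewrite /c; ring.
  rewrite ler_peMr ?mulr_ege1// mulr_ge0// mulr_ge0// exprn_ge0//.
rewrite (le_trans (lerD h1 h2))//.
have -> : k%:R * c * (2 * g) + c * g = c * g * (2 * k%:R + 1) by ring.
have -> : 2 * l%:R * g * eps * ta ^+ 2 * be ^+ (l - 1) = c * g * (2 * l%:R) by rewrite /c; ring.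
apply: ler_wpM2l; first by apply: mulr_ge0 => //; exact: le_trans g1.
have : k%:R + 1 <= l%:R :> R by rewrite natr1 ler_nat.
lra.
Qed.

(** Termwise |u|^2 <= 2 |v|^2 + 2 |u - v|^2. The errors take up at most half of nu^2, which leaves
    nu^2 / 4. *)
Lemma est_gram_controllable l nu : 0 <= nu -> gram_controllable l nu A B ->
  4 * l%:R * (2 * l%:R * g * eps * ta ^+ 2 * be ^+ (l - 1)) ^+ 2 <= nu ^+ 2 ->
  gram_controllable l (nu / 2) Ah Bh.
Proof.
move=> nu0 gc small z; set e := _ * be ^+ _ in small.
have -> : (nu / 2) ^+ 2 = nu ^+ 2 / 4 by field.
suff : nu ^+ 2 * quad 1%:M z <=
    2 * \sum_(j < l) quad 1%:M ((Ah ^+ j *m Bh)^T *m z) + 2 * (l%:R * (e ^+ 2 * quad 1%:M z)).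
  have := ler_wpM2r (quad1_ge0 z) small; lra.
rewrite (le_trans (gc z))//.
have -> : l%:R * (e ^+ 2 * quad 1%:M z) = \sum_(j < l) e ^+ 2 * quad 1%:M z.
  by rewrite sumr_const card_ord mulr_natl.
rewrite -mulrDr -big_split mulr_sumr ler_sum// => j _ /=.
have -> : (A ^+ j *m B)^T *m z = (Ah ^+ j *m Bh)^T *m z + - ((Ah ^+ j *m Bh - A ^+ j *m B)^T *m z).
  by rewrite -mulNmx -mulmxDl; congr (_ *m _); rewrite linearB /= opprB addrC subrK.
rewrite (le_trans (quad1D_le _ _))// ler_wpM2l// lerD2l quadN.
exact: quad1_tr_opnorm_le (input_diff_le (ltn_ord j)).
Qed.

End EstimatedSystem.

(** * Choice of the constants *)

Section ConstantTracking.
Context {R : realType}.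

(** All conditions of the perturbation argument are met by one t and one eta, with nu / 2 and 2 g
    throughout so that they fit both systems. Here [a] stands for ta be^(l-1) and [W] for tau(L,
    gamma)^2 / (1 - gamma^2). *)
Lemma certainty_parameters (l : nat) (c q0 q1 nu g a a2 eps W : R) :
  4608 * 3600 <= c ->
  (1 <= l)%N -> 0 < q0 -> q0 <= q1 -> 1 <= q1 -> 0 < nu -> 1 <= g -> 1 <= a ->
  a ^+ 2 <= a2 -> 0 < eps -> 1 <= W ->
  let Y := l%:R ^+ 5 * g ^+ 15 * a2 * W * (q1 / q0) ^+ 2 * (1 + nu^-1) ^+ 2 * eps ^+ 2 in
  c * Y < 1 ->
  exists t eta, [/\ 0 <= t, 0 < eta <= 2^-1,
    q1 * ((l%:R * (a * (2 * g))) ^+ 2 + 1) <= 4 * t ^+ 2 * q0 * (nu / 2) ^+ 2,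
    64 * eps ^+ 2 * (2 * g) * (l.+1%:R * (1 + t)) <= eta ^+ 2 * q0 &
    W * (g ^+ 2 * (36 * eta ^+ 2) * g * (l.+1%:R * (1 + t))) <= 100^-1 /\
    2 * W * (36 * eta ^+ 2 * g) <= c * Y].
Proof.
move=> c9 l1 q00 q01 q11 nu0 g1 a1 aa2 eps0 W1 Y small.
have lr1 : 1 <= l%:R :> R by rewrite ler1n.
have pos1 (x : R) : 1 <= x -> 0 <= x by exact: le_trans.
set kap := q1 / q0 in Y small *; set v := 1 + nu^-1 in Y small *.
have nui : 0 < nu^-1 by rewrite invr_gt0.
have v1 : 1 <= v by rewrite lerDl ltW.
have kap1 : 1 <= kap by rewrite ler_pdivlMr// mul1r.
have kq : kap * q0 = q1 by rewrite /kap divfK// gt_eqF.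
have q0k : q0^-1 <= kap by rewrite /kap ler_peMl// ltW ?invr_gt0.
set s := Num.sqrt kap; have s0 : 0 <= s := sqrtr_ge0 _.
have s2 : s ^+ 2 = kap by rewrite sqr_sqrtr// pos1.
have s1 : 1 <= s by rewrite -(@ler_pXn2r _ 2)// ?nnegrE// s2 expr1n.
set X := s * l%:R * a * g.
have X1 : 1 <= X by rewrite /X !mulr_ege1.
have X0 := pos1 _ X1.
(* With this t the block condition reads q1 (4 (l a g)^2 + 1) <= 9 q1 (l a g)^2. *)
set t := 3 * X * nu^-1.
have t0 : 0 <= t by rewrite /t mulr_ge0 ?(ltW nui)// mulr_ge0.
set T := l.+1%:R * (1 + t).
have T1 : 1 <= T by rewrite mulr_ege1 ?ler1n// lerDl.
have T0 := pos1 _ T1.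
have TX : T <= 6 * l%:R * X * v.
  have -> : 6 * l%:R * X * v = (2 * l%:R) * (3 * X * v) by ring.
  apply: ler_pM => //; first by rewrite addr_ge0.
    by rewrite -natr1 mulr_natl mulr2n lerD2l.
  by rewrite /v mulrDr mulr1 -/t lerD2r (le_trans X1)// ler_peMl// ler1n.
(* The square of eta, chosen to give equality in the Riccati perturbation condition with 2 g in
   place of g. *)
set e2 := 128 * eps ^+ 2 * g * T / q0.
have eps2 : 0 < eps ^+ 2 by rewrite exprn_gt0.
have g0 : 0 < g by rewrite (lt_le_trans _ g1).
have e20 : 0 < e2.
  apply: divr_gt0 => //; apply: mulr_gt0; last exact: lt_le_trans T1.
  exact: (mulr_gt0 (mulr_gt0 (ltr0Sn _ _) eps2) g0).
have sq2 : Num.sqrt e2 ^+ 2 = e2 by rewrite sqr_sqrtr// ltW.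
set Z := eps ^+ 2 * g ^+ 3 * l%:R ^+ 4 * kap ^+ 2 * a ^+ 2 * v ^+ 2.
have Z0 : 0 <= Z.
  exact: (mulr_ge0 (mulr_ge0 (mulr_ge0 (mulr_ge0 (mulr_ge0 (sqr_ge0 _)
    (exprn_ge0 3 (ltW g0))) (exprn_ge0 4 (ler0n _ _))) (sqr_ge0 _)) (sqr_ge0 _)) (sqr_ge0 _)).
(* 4608 = 128 * 6^2. The other factor 3600 = 36 * 100 of the constant comes from the stability
   condition, where 36 is that of the gain error. *)
have e2T : e2 * T <= 4608 * Z.
  have -> : e2 * T = 128 * eps ^+ 2 * g * q0^-1 * T ^+ 2 by rewrite /e2; ring.
  have -> : 4608 * Z = 128 * eps ^+ 2 * g * kap * (6 * l%:R * X * v) ^+ 2.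
    by rewrite /Z /X -s2; ring.
  have d0 : 0 <= 128 * eps ^+ 2 * g.
    exact: (mulr_ge0 (mulr_ge0 (ler0n _ _) (ltW eps2)) (ltW g0)).
  apply: ler_pM; [| exact: sqr_ge0 | exact: ler_wpM2l |].
    by apply: mulr_ge0; rewrite // invr_ge0 ltW.
  by apply: lerXn2r (TX); rewrite ?nnegrE; [exact: T0|exact: le_trans TX].
have e2Z : e2 <= 4608 * Z by rewrite (le_trans _ e2T)// ler_peMr// ltW.
have W0 := pos1 _ W1.
have gZ : W * g ^+ 3 * Z <= Y.
  have -> : W * g ^+ 3 * Z = (W * kap ^+ 2 * v ^+ 2 * eps ^+ 2) * (l%:R ^+ 4 * g ^+ 6 * a ^+ 2).
    by rewrite /Z; ring.
  have -> : Y = (W * kap ^+ 2 * v ^+ 2 * eps ^+ 2) * (l%:R ^+ 5 * g ^+ 15 * a2) by rewrite /Y; ring.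
  apply: ler_wpM2l.
    exact: (mulr_ge0 (mulr_ge0 (mulr_ge0 W0 (sqr_ge0 _)) (sqr_ge0 _)) (sqr_ge0 _)).
  apply: ler_pM; rewrite ?sqr_ge0 ?mulr_ge0 ?exprn_ge0 ?(ltW g0)//.
  by apply: ler_pM; rewrite ?exprn_ge0 ?(ltW g0) ?ler_weXn2l.
have g3 : g <= g ^+ 3 by rewrite -{1}[g]expr1 ler_weXn2l.
have WgZ : W * g * Z <= Y.
  by apply: le_trans gZ; rewrite ler_wpM2r// ler_wpM2l.
have g31 : 1 <= g ^+ 3 by rewrite exprn_ege1.
have ZY : Z <= Y.
  apply: le_trans gZ; rewrite -[leLHS]mul1r ler_wpM2r// mulr_ege1//.
have Y0 : 0 <= Y by exact: le_trans ZY.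
have small' : 4608 * Y <= 3600^-1.
  have : 4608 * 3600 * Y <= c * Y by exact: ler_wpM2r.
  by move: small; move: (Y) ; clear=> ?; lra.
exists t, (Num.sqrt e2); split=> //.
- rewrite sqrtr_gt0 e20 /= -(@ler_pXn2r _ 2)// ?nnegrE ?sqrtr_ge0// sq2 exprVn.
  have -> : 2 ^+ 2 = 4 :> R by ring.
  by move: small' e2Z ZY; move: (e2) (Z) (Y); clear=> ? ? ?; lra.
- have -> : 4 * t ^+ 2 * q0 * (nu / 2) ^+ 2 = 9 * (kap * q0) * (l%:R * a * g) ^+ 2.
    by rewrite /t /X -s2; field; rewrite gt_eqF.
  have -> : 9 * (kap * q0) * (l%:R * a * g) ^+ 2 = q1 * (9 * (l%:R * a * g) ^+ 2).
    by rewrite kq; ring.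
  apply: ler_wpM2l; first exact: pos1.
  have -> : (l%:R * (a * (2 * g))) ^+ 2 = 4 * (l%:R * a * g) ^+ 2 by ring.
  have : 1 <= (l%:R * a * g) ^+ 2 by rewrite exprn_ege1// !mulr_ege1.
  by move: (_ ^+ 2); clear=> ?; lra.
- rewrite sq2 -/T /e2 divfK ?gt_eqF//.
  by have -> : 64 * eps ^+ 2 * (2 * g) * T = 128 * eps ^+ 2 * g * T by ring.
- rewrite sq2 -/T; split.
    have -> : W * (g ^+ 2 * (36 * e2) * g * T) = 36 * (W * g ^+ 3) * (e2 * T) by ring.
    apply: (le_trans (y := 36 * (W * g ^+ 3) * (4608 * Z))).
      by rewrite ler_wpM2l// mulr_ge0// mulr_ge0// exprn_ge0// ltW.
    have -> : 36 * (W * g ^+ 3) * (4608 * Z) = 36 * (4608 * (W * g ^+ 3 * Z)) by ring.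
    by move: gZ small'; move: (Y) (_ * Z); clear=> ? ?; lra.
  have -> : 2 * W * (36 * e2 * g) = 72 * (W * g) * e2 by ring.
  apply: (le_trans (y := 72 * (W * g) * (4608 * Z))).
    by rewrite ler_wpM2l// mulr_ge0// mulr_ge0// ltW.
  apply: (le_trans (y := 4608 * 3600 * Y)); last exact: ler_wpM2r.
  have -> : 72 * (W * g) * (4608 * Z) = 72 * (4608 * (W * g * Z)) by ring.
  by move: WgZ Y0; move: (Y) (_ * Z); clear=> ? ?; lra.
Qed.

Lemma controllability_parameters (l : nat) (c nu g ta bl eps W kap : R) :
  100 <= c ->
  (1 <= l)%N -> 0 < nu -> 1 <= g -> 1 <= ta -> 1 <= bl -> 0 < eps -> 1 <= W -> 1 <= kap ->
  c * (l%:R ^+ 5 * g ^+ 15 * (ta ^+ 6 * bl ^+ 4) * W * kap ^+ 2 *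
    (1 + nu^-1) ^+ 2 * eps ^+ 2) < 1 ->
  eps <= 1 /\ 4 * l%:R * (2 * l%:R * g * eps * ta ^+ 2 * bl) ^+ 2 <= nu ^+ 2.
Proof.
move=> c100 l1 nu0 g1 ta1 bl1 eps0 W1 kap1.
have lr1 : 1 <= l%:R :> R by rewrite ler1n.
have pos1 (x : R) : 1 <= x -> 0 <= x by exact: le_trans.
have nui : 0 < nu^-1 by rewrite invr_gt0.
set v := 1 + nu^-1; have v1 : 1 <= v by rewrite lerDl ltW.
have -> : l%:R ^+ 5 * g ^+ 15 * (ta ^+ 6 * bl ^+ 4) * W * kap ^+ 2 * v ^+ 2 * eps ^+ 2 =
  (W * kap ^+ 2) * (l%:R ^+ 5 * g ^+ 15 * (ta ^+ 6 * bl ^+ 4)) * (v ^+ 2 * eps ^+ 2) by ring.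
set V := W * _; set U := _ * (_ * bl ^+ 4).
have V1 : 1 <= V by rewrite mulr_ege1// exprn_ege1.
have UU : l%:R ^+ 3 * g ^+ 2 * (ta ^+ 4 * bl ^+ 2) <= U.
  apply: ler_pM; rewrite ?mulr_ge0 ?exprn_ge0 ?pos1//.
    by apply: ler_pM; rewrite ?exprn_ge0 ?pos1 ?ler_weXn2l.
  by apply: ler_pM; rewrite ?exprn_ge0 ?pos1 ?ler_weXn2l.
set U0 := _ * (_ * bl ^+ 2) in UU.
have U01 : 1 <= U0 by rewrite !mulr_ege1 ?exprn_ege1.
have e2 : 0 <= eps ^+ 2 by rewrite sqr_ge0.
have ve : 0 <= v ^+ 2 * eps ^+ 2 by rewrite mulr_ge0 ?sqr_ge0.
have h1 : U0 * (v ^+ 2 * eps ^+ 2) <= V * U * (v ^+ 2 * eps ^+ 2).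
  by rewrite ler_wpM2r// (le_trans UU)// ler_peMl// (le_trans _ UU)// pos1.
move=> small9.
have small : 100 * (V * U * (v ^+ 2 * eps ^+ 2)) < 1.
  apply: le_lt_trans small9; apply: ler_wpM2r => //.
  by apply: le_trans h1; apply: mulr_ge0 => //; exact: pos1.
have h2 : v ^+ 2 * eps ^+ 2 <= U0 * (v ^+ 2 * eps ^+ 2) by rewrite ler_peMl.
split.
  have : eps ^+ 2 <= v ^+ 2 * eps ^+ 2 by rewrite ler_peMl// exprn_ege1.
  move=> h3; rewrite -(@ler_pXn2r _ 2)// ?nnegrE ?(ltW eps0)// expr1n.
  move: h1 h2 h3 small; lra.
have -> : 4 * l%:R * (2 * l%:R * g * eps * ta ^+ 2 * bl) ^+ 2 = 16 * (U0 * eps ^+ 2).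
  by rewrite /U0; ring.
(* v nu = nu + 1 >= 1: the factor (1 + 1/nu)^2 of the bound pays for the division by nu^2. *)
have vn : 1 <= v ^+ 2 * nu ^+ 2.
  rewrite -exprMn exprn_ege1// /v mulrDl mulVf ?gt_eqF// mul1r lerDr ltW//.
have h4 : U0 * eps ^+ 2 <= U0 * (v ^+ 2 * eps ^+ 2) * nu ^+ 2.
  have -> : U0 * (v ^+ 2 * eps ^+ 2) * nu ^+ 2 = (U0 * eps ^+ 2) * (v ^+ 2 * nu ^+ 2) by ring.
  by rewrite ler_peMr// mulr_ge0// pos1.
have h5 : 16 * (U0 * (v ^+ 2 * eps ^+ 2)) <= 1 by move: h1 h2 small ve; lra.
have := ler_wpM2r (sqr_ge0 nu) h5; move: h4; lra.
Qed.

End ConstantTracking.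

(** * Certainty equivalence *)

Section CertaintyEquivalence.
Context {R : realType}.
Variables n d : nat.
Implicit Types (A P Q : 'M[R]_n) (B : 'M[R]_(n, d)) (K : 'M[R]_(d, n)) (Rc : 'M[R]_d).

Lemma lqr_sol_mono A B Q Rc P K x : possemidef Q -> possemidef Rc ->
  lqr_sol A B Q Rc P K -> quad P ((A + B *m K) *m x) <= quad P x.
Proof.
move=> [_ pQ] [_ pR] sol; rewrite (lqr_sol_opt x sol).
by rewrite lerDr addr_ge0.
Qed.

Lemma opnormB n1 n2 (M N : 'M[R]_(n1, n2)) : opnorm (M - N) = opnorm (N - M).
Proof.
suff h (X Y : 'M[R]_(n1, n2)) : opnorm (X - Y) <= opnorm (Y - X) by apply/eqP; rewrite eq_le !h.
apply: opnorm_le; first exact: opnorm_ge0.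
by move=> x; rewrite -opprB mulNmx l2normN l2norm_opnorm.
Qed.

Section Close.
Variables (A Ah P Ph Q : 'M[R]_n) (B Bh : 'M[R]_(n, d)) (K Kh : 'M[R]_(d, n)) (Rc : 'M[R]_d).
Variables (l : nat) (q0 g eps t eta : R).
Hypotheses (psdQ : possemidef Q) (pR : posdef Rc) (q00 : 0 < q0).
Hypothesis qQ : forall x, q0 * quad 1%:M x <= quad Q x.
Hypothesis qR : forall u, q0 * quad 1%:M u <= quad Rc u.
Hypotheses (sol : lqr_sol A B Q Rc P K) (solh : lqr_sol Ah Bh Q Rc Ph Kh).
Hypothesis t0 : 0 <= t.
Hypothesis dec : forall x,
  (1 + t) * quad P ((A + B *m K) ^+ l.+1 *m x) <= t * quad P x.
Hypothesis dech : forall x,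
  (1 + t) * quad Ph ((Ah + Bh *m Kh) ^+ l.+1 *m x) <= t * quad Ph x.
Hypotheses (Pg : forall x, quad P x <= g * quad 1%:M x) (g0 : 0 <= g).
Hypotheses (hA : opnorm (Ah - A) <= eps) (hB : opnorm (Bh - B) <= eps).
Hypotheses (eta0 : 0 < eta) (eta1 : eta <= 2^-1).
Hypothesis small : 64 * eps ^+ 2 * (2 * g) * (l.+1%:R * (1 + t)) <= eta ^+ 2 * q0.

Let T1 : 1 <= l.+1%:R * (1 + t).
Proof. by rewrite mulr_ege1 ?ler1n// lerDl. Qed.

Let eta_le1 : eta <= 1.
Proof. by rewrite (le_trans eta1)// invf_le1// ler1n. Qed.

Let c0 : 0 <= 64 * eps ^+ 2 * g.
Proof. by rewrite mulr_ge0// mulr_ge0// sqr_ge0. Qed.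

Lemma riccati_upper x : quad Ph x <= (1 + eta) * quad P x.
Proof.
have mono := fun x => lqr_sol_mono x psdQ (posdef_psd pR) sol.
have [psdP _ _] := sol.
have [U [psdU dU UT]] := decay_lyapunov psdP t0 mono dec.
apply: (riccati_perturb pR sol solh psdU dU UT T1 Pg g0 q00 qQ qR hA hB eta0 eta_le1).
apply: le_trans small; have -> : 64 * eps ^+ 2 * (2 * g) = 2 * (64 * eps ^+ 2 * g) by ring.
by apply: ler_wpM2r; [exact: le_trans T1|rewrite ler_peMl// ler1n].
Qed.

(** The two systems exchange roles. The upper bound has to come first: it gives Ph <= 2 P <= 2 g,
    the reason for 2 g in [small]. *)
Lemma riccati_lower x : quad P x <= (1 + eta) * quad Ph x.
Proof.
have mono := fun x => lqr_sol_mono x psdQ (posdef_psd pR) solh.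
have [psdP _ _] := solh.
have [U [psdU dU UT]] := decay_lyapunov psdP t0 mono dech.
have Phg y : quad Ph y <= 2 * g * quad 1%:M y.
  rewrite (le_trans (riccati_upper y))// -mulrA ler_pM//.
  - by rewrite addr_ge0// ltW.
  - by have [[_ h] _ _] := sol.
  - by move: eta_le1; lra.
have g20 : 0 <= 2 * g by rewrite mulr_ge0.
have hA' : opnorm (A - Ah) <= eps by rewrite opnormB.
have hB' : opnorm (B - Bh) <= eps by rewrite opnormB.
exact: (riccati_perturb pR solh sol psdU dU UT T1 Phg g20 q00 qQ qR hA' hB' eta0 eta_le1 small).
Qed.

Lemma riccati_close x : `|quad (Ph - P) x| <= eta * quad P x.
Proof.
rewrite quadDm quadNm ler_norml; apply/andP; split; last first.
  by have := riccati_upper x; rewrite mulrDl mul1r; lra.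
have h1 := riccati_lower x; have h2 : 0 <= quad P x by have [[_ h] _ _] := sol.
have h3 : 0 <= quad Ph x by have [[_ h] _ _] := solh.
have [|h4] := leP (quad P x) (quad Ph x).
  by have := mulr_ge0 (ltW eta0) h2; lra.
have := ler_wpM2l (ltW eta0) (ltW h4); move: h1; rewrite mulrDl mul1r; lra.
Qed.

Lemma gain_close x :
  quad (input_hessian B Rc P) ((Kh - K) *m x) <= 36 * eta ^+ 2 * quad P x.
Proof.
apply: (gain_perturb x pR sol solh Pg g0 q00 qQ qR hA hB eta0 eta1 _ riccati_close).
apply: le_trans small; have -> : 64 * eps ^+ 2 * (2 * g) = 64 * eps ^+ 2 * g * 2 by ring.
rewrite -[leLHS]mulr1 -[leRHS]mulrA; apply: ler_wpM2l => //.
by rewrite mulr_ege1 ?ler1n.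
Qed.

End Close.

Section Bound.
Variables (A Ah P Q : 'M[R]_n) (B Bh : 'M[R]_(n, d)) (K : 'M[R]_(d, n)) (Rc : 'M[R]_d).
Variables (l : nat) (c q0 q1 nu g ta rho be tl gam eps : R).
Let L := A + B *m K.
Let W := tl ^+ 2 / (1 - gam ^+ 2).
Hypotheses (l1 : (1 <= l)%N) (pQ : posdef Q) (pR : posdef Rc).
Hypotheses (q00 : 0 < q0) (q01 : q0 <= q1) (q11 : 1 <= q1).
Hypothesis qQ : forall x, q0 * quad 1%:M x <= quad Q x.
Hypothesis qR : forall u, q0 * quad 1%:M u <= quad Rc u.
Hypothesis Qq : forall x, quad Q x <= q1 * quad 1%:M x.
Hypothesis Rq : forall u, quad Rc u <= q1 * quad 1%:M u.
Hypothesis R1 : forall u, quad 1%:M u <= quad Rc u.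
Hypotheses (nu0 : 0 < nu) (gc : gram_controllable l nu A B).
Hypotheses (sol : lqr_sol A B Q Rc P K) (g1 : 1 <= g).
Hypotheses (Bg : opnorm B <= g) (Pg : opnorm P <= g).
Hypotheses (ta1 : 1 <= ta) (rho0 : 0 <= rho) (be1 : 1 <= be).
Hypothesis bee : eps * ta + rho <= be.
Hypothesis Ata : forall k, opnorm (A ^+ k) <= ta * rho ^+ k.
Hypotheses (gam0 : 0 <= gam) (gam1 : gam < 1) (tl1 : 1 <= tl).
Hypothesis Ltl : forall k, opnorm (L ^+ k) <= tl * gam ^+ k.
Hypothesis eps0 : 0 < eps.
Hypotheses (hA : opnorm (Ah - A) <= eps) (hB : opnorm (Bh - B) <= eps).

Let Y := l%:R ^+ 5 * g ^+ 15 * (ta ^+ 6 * be ^+ (l - 1) ^+ 4) * W * (q1 / q0) ^+ 2 *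
  (1 + nu^-1) ^+ 2 * eps ^+ 2.
Hypotheses (cE : 4608 * 3600 <= c) (small : c * Y < 1).

Let W1 : 1 <= W.
Proof.
have gam2 : gam ^+ 2 < 1 by rewrite expr_lt1.
rewrite /W ler_pdivlMr ?subr_gt0// mul1r.
have : 1 <= tl ^+ 2 by rewrite exprn_ege1.
have := sqr_ge0 gam; lra.
Qed.

Let bl1 : 1 <= be ^+ (l - 1). Proof. by rewrite exprn_ege1. Qed.

Let kap1 : 1 <= q1 / q0. Proof. by rewrite ler_pdivlMr// mul1r. Qed.

Let psdQ := posdef_psd pQ.

Let decay_at A' B' P' K' nu' t : 0 < nu' -> gram_controllable l nu' A' B' ->
  lqr_sol A' B' Q Rc P' K' ->
  (forall k, (k < l)%N -> opnorm (A' ^+ k *m B') <= ta * be ^+ (l - 1) * (2 * g)) ->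
  0 <= t ->
  q1 * ((l%:R * (ta * be ^+ (l - 1) * (2 * g))) ^+ 2 + 1) <= 4 * t ^+ 2 * q0 * nu' ^+ 2 ->
  forall x, (1 + t) * quad P' ((A' + B' *m K') ^+ l.+1 *m x) <= t * quad P' x.
Proof.
move=> nu'0 gc' sol' b' t0 ht.
have pos1 (x : R) : 1 <= x -> 0 <= x by exact: le_trans.
apply: (lqr_sol_block_decay psdQ pR sol' nu'0 gc' _ b' q00 qQ Qq Rq _ t0 ht).
  by rewrite pos1// !mulr_ege1// ler1n.
exact: pos1.
Qed.

Lemma certainty_equivalence_bound : exists Ph Kh, [/\ lqr_sol Ah Bh Q Rc Ph Kh,
  forall N, \sum_(0 <= k < N) \tr (power_gram (A + B *m Kh) k) <= 2 * W * n%:R,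
  forall N, \sum_(0 <= k < N)
    \tr ((Kh - K)^T *m input_hessian B Rc P *m (Kh - K) *m power_gram (A + B *m Kh) k) <=
    d%:R * (c * Y) &
  forall N, \sum_(0 <= k < N) \tr (power_gram L k) <= 2 * W * n%:R].
Proof.
have pos1 (x : R) : 1 <= x -> 0 <= x by exact: le_trans.
have c100 : 100 <= c by apply: le_trans cE; rewrite -natrM ler_nat.
have [eps1 cs] := controllability_parameters c100 l1 nu0 g1 ta1 bl1 eps0 W1 kap1 small.
have aa : (ta * be ^+ (l - 1)) ^+ 2 <= ta ^+ 6 * be ^+ (l - 1) ^+ 4.
  by rewrite exprMn ler_pM ?sqr_ge0// ler_weXn2l.
have [t [eta [t0 /andP[eta0 eta1] ht hT [hW hC]]]] :=
  certainty_parameters cE l1 q00 q01 q11 nu0 g1 (mulr_ege1 ta1 bl1) aa eps0 W1 small.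
have gch := est_gram_controllable ta1 rho0 be1 (ltW eps0) bee Ata hA hB Bg g1 eps1
  (ltW nu0) gc cs.
have nu2 : 0 < nu / 2 by rewrite divr_gt0.
have [Ph [Kh solh]] := lqr_sol_exists psdQ pR q00 qR nu2 gch.
have bA k : (k < l)%N -> opnorm (A ^+ k *m B) <= ta * be ^+ (l - 1) * (2 * g).
  move=> kl; rewrite (le_trans (power_input_le ta1 rho0 be1 (ltW eps0) bee Ata Bg kl))//.
  by rewrite ler_wpM2l ?mulr_ge0 ?pos1// ler_peMl ?ler1n// pos1.
have bAh k (kl : (k < l)%N) :=
  est_power_input_le ta1 rho0 be1 bee Ata hA hB Bg g1 eps1 kl.
(* The constants of the true system are weakened to those of the estimated one, so that a single t
   serves both. *)
have gc2 : gram_controllable l (nu / 2) A B.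
  move=> z; apply: le_trans (gc z); rewrite ler_wpM2r ?quad1_ge0//.
  rewrite ler_pXn2r ?nnegrE ?(ltW nu0) ?(ltW nu2)//; lra.
have dec := decay_at nu2 gc2 sol bA t0 ht.
have dech := decay_at nu2 gch solh bAh t0 ht.
have Pg' x : quad P x <= g * quad 1%:M x.
  by rewrite (le_trans (quad_opnorm _ _))// ler_wpM2r// quad1_ge0.
have [psdP _ _] := sol.
have mono x := lqr_sol_mono x psdQ (posdef_psd pR) sol.
have M1 u : quad 1%:M u <= quad (input_hessian B Rc P) u.
  rewrite /input_hessian quadDm (le_trans (R1 u))// lerDl -quad_mulmx.
  exact: (proj2 psdP).
have gain := gain_close psdQ pR q00 qQ qR sol solh t0 dec dech Pg' (pos1 _ g1) hA hB eta0 eta1 hT.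
exists Ph, Kh; split=> // N.
- exact: (perturbed_trace_sum psdP t0 (pos1 _ g1) mono dec Pg' M1 gain Bg gam0 gam1 tl1 Ltl hW).
- apply: le_trans (perturbed_cost_sum psdP t0 (pos1 _ g1) mono dec Pg' M1 gain Bg
    gam0 gam1 tl1 Ltl hW _ _) _.
    exact: input_hessian_posdef.
  by rewrite ler_wpM2l.
(* The true closed loop is the case [Kh = K], [eta = 0] of the same lemma. *)
- have gain0 x : quad (input_hessian B Rc P) ((K - K) *m x) <= 36 * 0 ^+ 2 * quad P x.
    by rewrite subrr mul0mx quad0 expr0n mulr0 mul0r.
  apply: (perturbed_trace_sum psdP t0 (pos1 _ g1) mono dec Pg' M1 gain0 Bg gam0 gam1 tl1 Ltl).
  by rewrite expr0n !mulr0 !mul0r mulr0 invr_ge0.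
Qed.

End Bound.

End CertaintyEquivalence.

Section ClosedLoopCost.
Context {d0 : measure_display} {T : measurableType d0} {R : realType}.
Variable Pr : probability T R.
Variables (n d : nat) (sw : R).
Variables (x0 : 'I_n -> {RV Pr >-> R}) (w : nat -> 'I_n -> {RV Pr >-> R}).
Variables (A P Q : 'M[R]_n) (B : 'M[R]_(n, d)) (K Kh : 'M[R]_(d, n)) (Rc : 'M[R]_d).

Lemma closed_loop_lqr_cost b c : 0 < sw -> lqr_noise sw x0 w ->
  Q^T = Q -> posdef Rc -> lqr_sol A B Q Rc P K ->
  (forall N, \sum_(0 <= k < N) \tr (power_gram (A + B *m Kh) k) <= c) ->
  (forall N, \sum_(0 <= k < N)
    \tr ((Kh - K)^T *m input_hessian B Rc P *m (Kh - K) *m power_gram (A + B *m Kh) k) <= b) ->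
  exists g, 0 <= g <= b /\ is_lqr_cost Q Rc x0 w A B Kh (sw ^+ 2 * (\tr P + g)).
Proof.
move=> sw0 noise sQ pR sol sumL sumD; have [psdP _ _] := sol.
have pM := input_hessian_posdef B pR psdP.
set D := (Kh - K)^T *m _ *m _ in sumD.
have psdD' : possemidef D by exact: psd_mulmx (posdef_psd pM).
have [g [g0 gb lim]] := average_cost_limit sw psdP psdD' sumL sumD.
exists g; rewrite g0 gb; split=> //.
(* The completed square at u = Kh x brings the stage cost into the telescoping form of
   [average_cost_limit]. *)
have E : Q + Kh^T *m Rc *m Kh = P + D - (A + B *m Kh)^T *m P *m (A + B *m Kh).
  apply: eq_quad.
  - by rewrite linearD /= sQ !trmx_mul trmxK (proj1 pR) mulmxA.
  - by rewrite linearB linearD /= (proj1 psdD') !trmx_mul trmxK (proj1 psdP) mulmxA.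
  move=> x; rewrite !quadDm quadNm /D -!quad_mulmx.
  have := lqr_sol_step x (Kh *m x) (proj1 pR) sol.
  rewrite mulmxA -mulmxDl -mulmxBl; lra.
rewrite /is_lqr_cost; under eq_fun do rewrite (lqr_avg_costE sw0 noise) E.
apply: cvg_EFin lim; exact: nearW.
Qed.

End ClosedLoopCost.

(** * Extended reals, default values and degenerate dimensions *)

Section ProblemData.
Context {R : realType}.

(** A set without supremum is covered by the default value 0 of [sup]. The lemma supplies rho >= 0
    and gamma >= 0. *)
Lemma spectral_radius_ge0 n (M : 'M[R]_n) : 0 <= spectral_radius M.
Proof.
rewrite /spectral_radius; set S := (X in sup X).
have [hS|/sup_out ->//] := pselect (has_sup S).
have [[x Sx] ubS] := hS.
apply: le_trans (ub_le_sup ubS Sx).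
by case: Sx => z _ <-; case: z => a b; rewrite /Normc.normc sqrtr_ge0.
Qed.

Lemma tau_ge1 n (M : 'M[R]_n.+1) r : (1 <= tau M r)%E.
Proof.
apply: ereal_sup_ubound; exists 0%N => //=.
by rewrite !expr0 opnorm1 inve1 mule1.
Qed.

Lemma opnorm_le_tau n (M : 'M[R]_n) r t k : 0 <= r -> tau M r = t%:E ->
  opnorm (M ^+ k) <= t * r ^+ k.
Proof.
move=> r0 tE.
have : ((opnorm (M ^+ k))%:E * ((r ^+ k)%:E)^-1 <= t%:E)%E.
  by rewrite -tE; apply: ereal_sup_ubound; exists k.
(* If r^k = 0, a nonzero power of M would make [tau] infinite, because 0^-1 = +oo. *)
have [rk0|rk0] := eqVneq (r ^+ k) 0.
  rewrite rk0 inve0 mulr0; have := opnorm_ge0 (M ^+ k).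
  rewrite le_eqVlt => /orP[/eqP <-//|o0].
  by rewrite gt0_muley ?lte_fin.
rewrite inver (negbTE rk0) -EFinM lee_fin ler_pdivrMr//.
by rewrite lt_neqAle eq_sym rk0 exprn_ge0.
Qed.

Lemma mule_lty_fin (x y : \bar R) : (0 < x)%E -> (0 < y)%E -> (x * y < +oo)%E ->
  (x < +oo)%E /\ (y < +oo)%E.
Proof.
move=> x0 y0 xy; split; rewrite ltey; apply/eqP => E; move: xy; rewrite E.
  by rewrite gt0_mulye// ltxx.
by rewrite gt0_muley// ltxx.
Qed.

Lemma expe_gt0 (x : \bar R) k : (0 < x)%E -> (0 < x ^+ k)%E.
Proof. by move=> x0; elim: k => [|k IH]; rewrite ?expe0 ?lte01// expeS mule_gt0. Qed.

Lemma expeS_lty (x : \bar R) k : (0 < x)%E -> (x ^+ k.+1 < +oo)%E -> (x < +oo)%E.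
Proof. by move=> x0; rewrite expeS => /mule_lty_fin[//||//]; exact: expe_gt0. Qed.

Lemma ge1_fin (x : \bar R) : (1 <= x)%E -> (x < +oo)%E -> exists2 r, x = r%:E & 1 <= r.
Proof. by case: x => [r| |]// r1 _; exists r => //; rewrite -lee_fin. Qed.

(** Both degenerate dimensions contradict nu > 0: for n = 0 [sigma_min] is 0 by convention, and for
    d = 0 the Gramian vanishes. *)
Lemma controllable_dim n d l nu (A : 'M[R]_n) (B : 'M[R]_(n, d)) :
  0 < nu -> controllable l nu A B -> (0 < n)%N /\ (0 < d)%N.
Proof.
case: n A B => [|n] A B nu0 h.
  suff E : sigma_min (controllability_mx l A B) = 0.
    by move: h; rewrite /controllable E leNgt nu0.
  rewrite /sigma_min /lambda_min (_ : [set a | _] = set0) ?inf0 ?sqrtr0//.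
  by apply/seteqP; split=> // a /=; rewrite /eigenvalue flatmx0 eqxx.
split=> //; case: d B h => // B /(controllable_gram nu0) gc.
have e0 : (delta_mx 0 0 : 'cV[R]_n.+1) != 0.
  by apply/eqP => /matrixP/(_ 0 0)/eqP; rewrite !mxE oner_eq0.
have := gc (delta_mx 0 0); rewrite big1 => [|j _]; last by rewrite quad1 big_ord0.
by rewrite leNgt mulr_gt0 ?exprn_gt0// quad1_gt0.
Qed.

Lemma sigma_min_le_opnorm n (M : 'M[R]_n.+1) : posdef M -> sigma_min M <= opnorm M.
Proof.
move=> /posdef_sigma_min[_ h].
have e0 : (delta_mx 0 0 : 'cV[R]_n.+1) != 0.
  by apply/eqP => /matrixP/(_ 0 0)/eqP; rewrite !mxE oner_eq0.
rewrite -(ler_pM2r (quad1_gt0 e0)); exact: le_trans (h _) (quad_opnorm _ _).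
Qed.

Lemma sqr_max (x y : R) : 0 <= x -> 0 <= y ->
  Num.max (x ^+ 2) (y ^+ 2) = Num.max x y ^+ 2.
Proof.
move=> x0 y0; have [xy|yx] := leP x y.
  by rewrite max_r// ler_pXn2r// nnegrE.
by rewrite max_l// ler_pXn2r ?nnegrE// ltW.
Qed.

Lemma sqr_min (x y : R) : 0 <= x -> 0 <= y ->
  Num.min (x ^+ 2) (y ^+ 2) = Num.min x y ^+ 2.
Proof.
move=> x0 y0; have [xy|yx] := leP x y.
  by rewrite min_l// ler_pXn2r// nnegrE.
by rewrite min_r// ler_pXn2r ?nnegrE// ltW.
Qed.

End ProblemData.

Theorem theorem2 (R : realType) :
  exists C : R, 0 < C /\
  forall (n d : nat) (A : 'M[R]_n) (B : 'M[R]_(n, d))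
    (Q : 'M[R]_n) (Rc : 'M[R]_d)
    (d0 : measure_display) (T : measurableType d0) (P : probability T R)
    (sw : R) (x0 : 'I_n -> {RV P >-> R}) (w : nat -> 'I_n -> {RV P >-> R})
    (l : nat) (nu rho gamma eps : R) (Ahat : 'M[R]_n) (Bhat : 'M[R]_(n, d)),
  let Pstar := dare A B Q Rc in
  let Kstar := lqr_gain A B Q Rc in
  let Lstar := A + B *m Kstar in
  let Khat := lqr_gain Ahat Bhat Q Rc in
  let Gamma := 1 + Num.max (Num.max (opnorm A) (opnorm B))
                           (Num.max (opnorm Pstar) (opnorm Kstar)) in
  let beta := Order.max 1%E (eps%:E * tau A rho + rho%:E)%E in
  let bound :=
    ((C * sw ^+ 2 * d%:R * l%:R ^+ 5 * Gamma ^+ 15)%:E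
     * tau A rho ^+ 6 * beta ^+ (4 * (l - 1))
     * (tau Lstar gamma ^+ 2 * ((1 - gamma ^+ 2)^-1)%:E)
     * (Num.max (opnorm Q ^+ 2) (opnorm Rc ^+ 2)
        / Num.min (sigma_min Q ^+ 2) (sigma_min Rc ^+ 2)
        * (1 + nu^-1) ^+ 2 * eps ^+ 2)%:E)%E in
  0 < sw -> lqr_noise sw x0 w ->
  (d <= n)%N -> posdef Q -> posdef Rc -> 1 <= sigma_min Rc ->
  (1 <= l)%N -> 0 < nu -> controllable l nu A B ->
  spectral_radius A <= rho ->
  spectral_radius Lstar <= gamma -> gamma < 1 ->
  0 < eps -> opnorm (Ahat - A) <= eps -> opnorm (Bhat - B) <= eps ->
  (bound < (sw ^+ 2)%:E)%E ->
  [/\ is_dare A B Q Rc Pstar,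
      is_dare Ahat Bhat Q Rc (dare Ahat Bhat Q Rc) &
      exists Jhat Jstar : R,
        [/\ is_lqr_cost Q Rc x0 w A B Khat Jhat,
            is_lqr_cost Q Rc x0 w A B Kstar Jstar &
            ((Jhat - Jstar)%:E <= bound)%E]].
Proof.
(* Only the inequality on [c] is kept, so the large numeral does not enter later computations. *)
have [c cE] : exists c : R, 4608 * 3600 <= c by exists (4608 * 3600).
have c0 : 0 < c by apply: lt_le_trans cE; rewrite -natrM ltr0n muln_gt0.
exists c; split=> // n d A B Q Rc d0 T P sw x0 w l nu rho gamma eps Ahat Bhat.
move=> Pstar Kstar Lstar Khat Gamma beta bound sw0 noise _ pQ pR sR1 l1 nu0 ctr.
move=> rhoA gamL gam1 eps0 hA hB.
have [] := controllable_dim nu0 ctr.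
case: n A B Q x0 w Ahat Bhat @Pstar @Kstar @Lstar @Khat @Gamma @beta @bound
  noise pQ ctr rhoA gamL hA hB => // n A B Q x0 w Ahat Bhat
  Pstar Kstar Lstar Khat Gamma beta bound noise pQ ctr rhoA gamL hA hB _.
case: d Rc B Bhat @Pstar @Kstar @Lstar @Khat @Gamma @beta @bound
  pR sR1 ctr gamL hB => // d Rc B Bhat
  Pstar Kstar Lstar Khat Gamma beta bound pR sR1 ctr gamL hB _.
have rho0 : 0 <= rho := le_trans (spectral_radius_ge0 A) rhoA.
have gam0 : 0 <= gamma := le_trans (spectral_radius_ge0 Lstar) gamL.
have [sQ0 qQ] := posdef_sigma_min pQ; have [sR0 qR] := posdef_sigma_min pR.
have gc := controllable_gram nu0 ctr.
pose q0 := Num.min (sigma_min Q) (sigma_min Rc).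
pose q1 := Num.max (opnorm Q) (opnorm Rc).
have q00 : 0 < q0 by rewrite lt_min sQ0.
have Ro := sigma_min_le_opnorm pR.
have q0Q : q0 <= sigma_min Q by rewrite ge_min lexx.
have q0R : q0 <= sigma_min Rc by rewrite ge_min lexx orbT.
have q1Q : opnorm Q <= q1 by rewrite le_max lexx.
have q1R : opnorm Rc <= q1 by rewrite le_max lexx orbT.
have q01 : q0 <= q1 := le_trans q0R (le_trans Ro q1R).
have q11 : 1 <= q1 := le_trans sR1 (le_trans Ro q1R).
have qQ0 x : q0 * quad 1%:M x <= quad Q x.
  by apply: le_trans (qQ x); rewrite ler_wpM2r ?quad1_ge0.
have qR0 u : q0 * quad 1%:M u <= quad Rc u.
  by apply: le_trans (qR u); rewrite ler_wpM2r ?quad1_ge0.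
have Qq x : quad Q x <= q1 * quad 1%:M x.
  by apply: le_trans (quad_opnorm _ _) _; rewrite ler_wpM2r ?quad1_ge0.
have Rq u : quad Rc u <= q1 * quad 1%:M u.
  by apply: le_trans (quad_opnorm _ _) _; rewrite ler_wpM2r ?quad1_ge0.
have R1 u : quad 1%:M u <= quad Rc u.
  by apply: le_trans (qR u); rewrite ler_peMl ?quad1_ge0.
have [P0 [K0 sol]] := lqr_sol_exists (posdef_psd pQ) pR q00 qR0 nu0 gc.
have [dareP PE KE] := lqr_sol_is_dare pR (proj1 pQ) sQ0 qQ sol.
have G1 : 1 <= Gamma by rewrite lerDl !le_max opnorm_ge0.
have Bg : opnorm B <= Gamma.
  by rewrite (le_trans (y := Gamma - 1)) ?gerDl ?lerN10// addrAC subrr add0r !le_max lexx orbT.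
have Pg : opnorm P0 <= Gamma.
  rewrite (le_trans (y := Gamma - 1)) ?gerDl ?lerN10//.
  by rewrite addrAC subrr add0r /Pstar PE !le_max lexx !orbT.
have ggam2 : 0 < 1 - gamma ^+ 2 by rewrite subr_gt0 expr_lt1.
have G0 : 0 < Gamma by rewrite (lt_le_trans _ G1).
have lr0 : 0 < l%:R :> R by rewrite ltr0n.
pose c1 := c * sw ^+ 2 * d.+1%:R * l%:R ^+ 5 * Gamma ^+ 15.
have c10 : 0 < c1 by rewrite /c1 !mulr_gt0 ?exprn_gt0.
have v0 : 0 < 1 + nu^-1 by rewrite addr_gt0// invr_gt0.
pose c3 := (q1 / q0) ^+ 2 * (1 + nu^-1) ^+ 2 * eps ^+ 2.
have c30 : 0 < c3.
  have q10 : 0 < q1 := lt_le_trans q00 q01.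
  exact: (mulr_gt0 (mulr_gt0 (exprn_gt0 2 (divr_gt0 q10 q00)) (exprn_gt0 2 v0))
    (exprn_gt0 2 eps0)).
move: @bound; rewrite sqr_max ?opnorm_ge0// sqr_min ?(ltW sQ0) ?(ltW sR0)// -expr_div_n.
rewrite -/q0 -/q1 -/c3 -/c1 => bound.
have c1E : c1 = c * sw ^+ 2 * d.+1%:R * l%:R ^+ 5 * Gamma ^+ 15 by [].
have c3E : c3 = (q1 / q0) ^+ 2 * (1 + nu^-1) ^+ 2 * eps ^+ 2 by [].
clearbody c1 c3.
have tA1 := tau_ge1 A rho; have tL1 := tau_ge1 Lstar gamma.
have b1 : (1 <= beta)%E by rewrite le_max lexx.
have tA0 : (0 < tau A rho)%E := lt_le_trans lte01 tA1.
have tL0 : (0 < tau Lstar gamma)%E := lt_le_trans lte01 tL1.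
have b0 : (0 < beta)%E := lt_le_trans lte01 b1.
(* All factors of the bound are positive and their product is finite, so each of them, in particular
   both values of [tau], is finite. *)
move=> bsmall; have bfin : (bound < +oo)%E := lt_trans bsmall (ltry _).
have igam : (0 < ((1 - gamma ^+ 2)^-1)%:E)%E by rewrite lte_fin invr_gt0.
have f2 : (0 < tau Lstar gamma ^+ 2 * ((1 - gamma ^+ 2)^-1)%:E)%E.
  by rewrite mule_gt0// expe_gt0.
have c10' : (0 < c1%:E)%E by rewrite lte_fin.
have c30' : (0 < c3%:E)%E by rewrite lte_fin.
have f1 := mule_gt0 c10' (expe_gt0 6 tA0).
have f3 := mule_gt0 f1 (expe_gt0 (4 * (l - 1)) b0).
have [h123 _] := mule_lty_fin (mule_gt0 f3 f2) c30' bfin.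
have [h13 h2] := mule_lty_fin f3 f2 h123.
have [h1 _] := mule_lty_fin f1 (expe_gt0 (4 * (l - 1)) b0) h13.
have [_ hA6] := mule_lty_fin c10' (expe_gt0 6 tA0) h1.
have [hL2 _] := mule_lty_fin (expe_gt0 2 tL0) igam h2.
have [ta taE ta1] := ge1_fin tA1 (expeS_lty tA0 hA6).
have [tl tlE tl1] := ge1_fin tL1 (expeS_lty tL0 hL2).
pose be := Num.max 1 (eps * ta + rho).
have beE : beta = be%:E by rewrite /beta taE -EFinM -EFinD -EFin_max.
have be1 : 1 <= be by rewrite le_max lexx.
have bee : eps * ta + rho <= be by rewrite le_max lexx orbT.
have Ata k := opnorm_le_tau k rho0 taE.
have Ltl k : opnorm ((A + B *m K0) ^+ k) <= tl * gamma ^+ k.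
  by rewrite -KE; exact: opnorm_le_tau.
pose W := tl ^+ 2 / (1 - gamma ^+ 2).
pose Y := l%:R ^+ 5 * Gamma ^+ 15 * (ta ^+ 6 * be ^+ (l - 1) ^+ 4) * W * (q1 / q0) ^+ 2 *
  (1 + nu^-1) ^+ 2 * eps ^+ 2.
have boundE : bound = (sw ^+ 2 * (d.+1%:R * (c * Y)))%:E.
  rewrite /bound taE tlE beE -!EFin_expe -!EFinM; congr _%:E.
  by rewrite /Y c1E c3E /W [(4 * _)%N]mulnC exprM; ring.
have sw20 : 0 < sw ^+ 2 by rewrite exprn_gt0.
have Y0 : 0 <= c * Y.
  have : (0 < bound)%E := mule_gt0 (mule_gt0 f3 f2) c30'.
  by rewrite boundE lte_fin pmulr_rgt0// pmulr_rgt0 ?ltr0Sn// => /ltW.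
have small : c * Y < 1.
  have : d.+1%:R * (c * Y) < 1.
    by move: bsmall; rewrite boundE lte_fin gtr_pMr.
  by apply: le_lt_trans; rewrite ler_peMl// ler1n.
have [Ph [Kh [solh sumLh sumD sumL]]] := certainty_equivalence_bound l1 pQ pR q00 q01 q11
  qQ0 qR0 Qq Rq R1 nu0 gc sol G1 Bg Pg ta1 rho0 be1 bee Ata gam0 gam1 tl1 Ltl eps0 hA hB cE small.
have [dareh _ KhE] := lqr_sol_is_dare pR (proj1 pQ) sQ0 qQ solh.
have [gh [/andP[_ ghb] costh]] := closed_loop_lqr_cost sw0 noise (proj1 pQ) pR sol sumLh sumD.
(* The optimal gain is compared with itself, so the excess weight is 0. From the resulting cost only
   [0 <= gs] enters the final comparison. *)
have sum0 N : \sum_(0 <= k < N) \tr ((K0 - K0)^T *m input_hessian B Rc P0 *m (K0 - K0)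
    *m power_gram (A + B *m K0) k) <= 0.
  by rewrite big1// => k _; rewrite subrr mulmx0 mul0mx linear0.
have [gs [/andP[gs0 _] costs]] := closed_loop_lqr_cost sw0 noise (proj1 pQ) pR sol sumL sum0.
split=> //; exists (sw ^+ 2 * (\tr P0 + gh)), (sw ^+ 2 * (\tr P0 + gs)); split.
- by rewrite /Khat KhE.
- by rewrite /Kstar KE.
- rewrite boundE lee_fin -mulrBr; apply: (ler_wpM2l (ltW sw20)).
  rewrite opprD addrACA subrr add0r lerBlDr.
  by apply: (le_trans ghb); rewrite lerDl.
Qed.
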